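(* Let $d\ge 2$. For every $G\in \mathrm{GL}_d * C$, the (randomized) path recovery algorithm $\mathsf{Recover}$ described in the context, applied to $G$, computes (with probability one) a matrix $A\in\mathrm{GL}_d$ such that $G=A*C$. In expectation (over the internal random choices of the algorithm) it requires $\mathcal{O}(d^4)$ elementary operations.
   Context: Notation. $\mathrm{GL}_m=\mathrm{GL}_m(\mathbb{R})$, $\mathrm{I}_m$ is the $m\times m$ identity, $\oplus$ is the direct (block diagonal) sum of matrices, $\mathrm{E}_{i,j}$ is the standard basis of $\mathbb{R}^{d\times d}$, $\mathrm{I}_s\oplus\mathrm{GL}_{d-s}=\{\mathrm{I}_s\oplus A: A\in \mathrm{GL}_{d-s}\}$. The core tensor $C\in\mathbb{R}^{d\times d\times d}$ has entries $C_{i,j,k}=1$ if $i=j=k$; $C_{i,j,k}=3$ if $i<j=k$ or $i=j<k$; $C_{i,j,k}=6$ if $i<j<k$; and $C_{i,j,k}=0$ otherwise. For $A\in\mathbb{R}^{d\times d}$ and $T\in\mathbb{R}^{d\times d\times d}$, the matrix-tensor congruence is $(A*T)_{i,j,k}=\sum_{\alpha,\beta,\gamma=1}^d T_{\alpha,\beta,\gamma}A_{i,\alpha}A_{j,\beta}A_{k,\gamma}$. $\mathrm{GL}_d*C$ is the orbit $\{A*C:A\in\mathrm{GL}_d\}$. Gauss operations. For $1\le s<d$ and $x,y\in\mathbb{R}^{d-s}$: $L^{(s,y)}=\mathrm{I}_d+\sum_{\gamma=s+1}^d y_{\gamma-s}\mathrm{E}_{\gamma,s}$ and $U^{(s,x)}=\mathrm{I}_d+\sum_{\gamma=s+1}^d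 x_{\gamma-s}\mathrm{E}_{s,\gamma}$. For $1\le s\le d$ and $h\in\mathbb{R}\setminus\{0\}$: $D^{(s,h)}=\mathrm{I}_{s-1}\oplus\sqrt[3]{h}\oplus\mathrm{I}_{d-s}$ (real cube root). $P^{(s,t)}$ is the permutation matrix of the transposition $(s,t)$. ''Random $W\in\mathrm{I}_{s-1}\oplus\mathrm{GL}_{d-s+1}$'' means that the lower right block of $W$ is drawn, independently of all previous choices, from a probability distribution that is absolutely continuous with respect to Lebesgue measure on $\mathbb{R}^{(d-s+1)\times(d-s+1)}$. Subroutine $\mathsf{up}_{\ge4}(G,s)$, for $1\le s<d-2$: form $M\in\mathbb{R}^{(d-s)^2\times(d-s)}$ and $B\in\mathbb{R}^{(d-s)^2}$ with $M_{(a-1)(d-s)+b,\gamma}=G_{a+s,b+s,\gamma+s}-G_{b+s,a+s,\gamma+s}$ and $B_{(a-1)(d-s)+b}=G_{b+s,a+s,s}-G_{a+s,b+s,s}$ for $1\le a,b,\gamma\le d-s$. If $\mathrm{rank}(M)=\mathrm{rank}(M\mid B)=d-s$, solve $Mx=B$ for $x\in\mathbb{R}^{d-s}$ and return $U^{(s,x)}$. Otherwise, return $\mathsf{up}_{\ge4}(W*G,s)\,W$ for random $W\in\mathrm{I}_{s-1}\oplus\mathrm{GL}_{d-s+1}$. Subroutine $\mathsf{up}_3(G)$ (for $d\ge3$): set $G_{\mathrm{init}}=G$. If $G_{d-1,d,d}\ne G_{d,d-1,d}$: put $Q_1=\mathrm{I}_d+\frac{G_{d,d-1,d-1}-G_{d-1,d,d-1}}{G_{d-1,d,d}-G_{d,d-1,d}}\mathrm{E}_{d-1,d}$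 and replace $G$ by $Q_1*G$; then put $Q_2=\mathrm{I}_d+\frac{G_{d,d-1,d-2}-G_{d-1,d,d-2}}{G_{d-1,d,d}-G_{d,d-1,d}}\mathrm{E}_{d-2,d}$ and replace $G$ by $Q_2*G$; then, if $G_{d-2,d-1,d-1}\ne G_{d-1,d-2,d-1}$, put $Q_3=\mathrm{I}_d+\frac{G_{d-1,d-2,d-2}-G_{d-2,d-1,d-2}}{G_{d-2,d-1,d-1}-G_{d-1,d-2,d-1}}\mathrm{E}_{d-2,d-1}$, replace $G$ by $Q_3*G$, and if now $G_{d-2,d-2,d-2}\neq0$ return $Q_3Q_2Q_1$. If any of these tests fails, return $\mathsf{up}_3(W*G_{\mathrm{init}})\,W$ with random $W\in\mathrm{I}_{d-3}\oplus\mathrm{GL}_3$. Subroutine $\mathsf{up}_2(G)$: if $G_{d-1,d,d}\ne G_{d,d-1,d}$ return $U^{(d-1,x)}$ with $x=\frac{G_{d,d-1,d-1}-G_{d-1,d,d-1}}{G_{d-1,d,d}-G_{d,d-1,d}}$; otherwise return $P^{(d-1,d)}$. Algorithm $\mathsf{Recover}(G)$: initialize $Q=\mathrm{I}_d$. For $s=1,\dots,d-1$: let $Q_{\mathsf{up}}$ be $\mathsf{up}_{\ge4}(G,s)$ if $s\le d-3$, $\mathsf{up}_3(G)$ if $s=d-2$, and $\mathsf{up}_2(G)$ if $s=d-1$; set $H=Q_{\mathsf{up}}*G$; set $y=-H_{s,s,s}^{-1}(H_{s,s+1,s},\dots,H_{s,d,s})\in\mathbb{R}^{d-s}$; set $Q_{\mathsf{dlow}}=D^{(s,H_{s,s,s}^{-1})}L^{(s,y)}$;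 replace $G$ by $Q_{\mathsf{dlow}}*H$ and $Q$ by $Q_{\mathsf{dlow}}Q_{\mathsf{up}}Q$. After the loop, return $Q^{-1}D^{(d,G_{d,d,d})}$. Elementary operations are real arithmetic operations, comparisons, extraction of real cube roots, and drawing random real entries; linear algebra subroutines (congruence by elementary matrices, rank tests, linear solves) may be implemented suitably. *)

(* Defs.v *)
From mathcomp Require Import all_boot all_order all_algebra.
From mathcomp Require Import all_classical all_reals all_analysis.

Set Implicit Arguments.
Unset Strict Implicit.
Unset Printing Implicit Defensive.

Import Order.TTheory GRing.Theory Num.Theory.

Local Open Scope ring_scope.

Definition tensor (R : realType) (d : nat) := 'I_d -> 'I_d -> 'I_d -> R.

Definition core (R : realType) (d : nat) : tensor R d := fun i j k =>
  if (i == j) && (j == k) then 1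
  else if ((i < j)%N && (j == k)) || ((i == j) && (j < k)%N) then 3
  else if (i < j < k)%N then 6
  else 0.
Arguments core : clear implicits.

Definition congr_tensor (R : realType) (d : nat) (A : 'M[R]_d)
    (T : tensor R d) : tensor R d := fun i j k =>
  \sum_(a < d) \sum_(b < d) \sum_(c < d) T a b c * A i a * A j b * A k c.

Definition core_orbit (R : realType) (d : nat) (G : tensor R d) : Prop :=
  exists2 A : 'M[R]_d, A \in unitmx & G = congr_tensor A (core R d).

Definition cbrt (R : realType) (x : R) : R := Num.sg x * (`|x| `^ 3^-1).

(* A program manipulates real numbers only through the names of the registers
  that hold them, so that every dependence of the control flow or of the output
  on the data goes through a counted operation.  Registers are write-once: each
  operation stores its result in a fresh register.  Index computations are
  free, as in an algebraic computation tree. *)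

Definition reg := nat.

(* Entries of vectors, matrices and tensors of registers are numbered from 1;
   what these functions return outside the intended range is irrelevant. *)
Definition rvec := nat -> reg.
Definition rmx := nat -> nat -> reg.
Definition rtens := nat -> nat -> nat -> reg.

Inductive arith := Add | Sub | Mul | Div.
Inductive comparison := Eq | Le.

(* [Stop] aborts without a result; [Draw m] draws a random m x m block. *)
Inductive prog (T : Type) : Type :=
| Ret of T
| Stop
| Const of int & (reg -> prog T)
| Arith of arith & reg & reg & (reg -> prog T)
| Cbrt of reg & (reg -> prog T)
| Test of comparison & reg & reg & (bool -> prog T)
| Draw of nat & (rmx -> prog T).

Arguments Stop {T}.

Fixpoint bind (S T : Type) (p : prog S) (q : S -> prog T) : prog T :=
  match p with
  | Ret x => q x
  | Stop => Stop
  | Const c k => Const c (fun r => bind (k r) q)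
  | Arith o a b k => Arith o a b (fun r => bind (k r) q)
  | Cbrt a k => Cbrt a (fun r => bind (k r) q)
  | Test o a b k => Test o a b (fun t => bind (k t) q)
  | Draw m k => Draw m (fun w => bind (k w) q)
  end.

Notation "'let*' x := p 'in' q" := (bind p (fun x => q))
  (at level 200, x name, p at level 100, q at level 200,
   format "'[v' 'let*'  x  :=  p  'in' '/' q ']'").

Definition const (c : int) : prog reg := Const c (@Ret reg).
Definition arith2 (o : arith) (a b : reg) : prog reg := Arith o a b (@Ret reg).
Definition cbrt1 (a : reg) : prog reg := Cbrt a (@Ret reg).
Definition test (o : comparison) (a b : reg) : prog bool :=
  Test o a b (@Ret bool).
Definition draw (m : nat) : prog rmx := Draw m (@Ret rmx).

(* The function i |-> (result of f i), 1 <= i <= n, with x0 elsewhere. *)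
Fixpoint tabulate (T : Type) (x0 : T) (n : nat) (f : nat -> prog T) :
    prog (nat -> T) :=
  if n is n'.+1 then
    let* v := tabulate x0 n' f in
    let* x := f n in
    Ret (fun i => if i == n then x else v i)
  else Ret (fun _ => x0).

Fixpoint foldp (S : Type) (f : nat -> S -> prog S) (l : seq nat) (x : S) :
    prog S :=
  if l is i :: l' then let* y := f i x in foldp f l' y else Ret x.

Section Semantics.
Variable R : realType.

(* The law of the random m x m blocks (listed row by row), for each m. *)
Definition block_law :=
  forall m : nat, probability ((m * m).-tuple (measurableTypeR R)) R.

(* Lebesgue measure on R^n, by slicing along the first coordinate. *)
Fixpoint lebesgue_tuple (n : nat) :
    set (n.-tuple (measurableTypeR R)) -> \bar R :=
  match n with
  | 0 => fun A => \d_([tuple] : 0.-tuple (measurableTypeR R)) A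
  | n'.+1 => fun A => (\int[lebesgue_measure]_(x in setT)
      lebesgue_tuple [set t : n'.-tuple (measurableTypeR R)
                     | A [tuple of x :: t]])%E
  end.

Definition absolutely_continuous (mu : block_law) : Prop :=
  forall (m : nat) (A : set ((m * m).-tuple (measurableTypeR R))),
    measurable A -> lebesgue_tuple A = 0%E -> mu m A = 0%E.

Definition eval_arith (o : arith) (x y : R) : option R :=
  match o with
  | Add => Some (x + y)
  | Sub => Some (x - y)
  | Mul => Some (x * y)
  | Div => if y == 0 then None else Some (x / y)
  end.

Definition eval_comparison (o : comparison) (x y : R) : bool :=
  match o with Eq => x == y | Le => x <= y end.

(* [expect mu p env n f] is the expectation of [f o env' n'] over the runs of
   [p] from memory [env] with n operations already performed, where [o] is the
   outcome ([None] after [Stop] or a division by zero), [env'] is the final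
   memory and [n'] is the total number of operations.  Drawing an m x m block
   counts as m * m operations; the draws are independent since the law used at
   a [Draw] does not depend on the past. *)
Fixpoint expect (mu : block_law) (T : Type) (p : prog T) (env : seq R) (n : nat)
    (f : option T -> seq R -> nat -> \bar R) {struct p} : \bar R :=
  match p with
  | Ret x => f (Some x) env n
  | Stop => f None env n
  | Const c k => expect mu (k (size env)) (rcons env c%:~R) n f
  | Arith o a b k =>
      if eval_arith o env`_a env`_b is Some v
      then expect mu (k (size env)) (rcons env v) n.+1 f
      else f None env n.+1
  | Cbrt a k => expect mu (k (size env)) (rcons env (cbrt env`_a)) n.+1 f
  | Test o a b k => expect mu (k (eval_comparison o env`_a env`_b)) env n.+1 f
  | Draw m k => (\int[mu m]_w
      expect mu (k (fun i j => size env + (i - 1) * m + (j - 1))%N)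
             (env ++ w) (n + m * m) f)%E
  end.

Definition prob (mu : block_law) (T : Type) (p : prog T) (env : seq R)
    (E : T -> seq R -> Prop) : \bar R :=
  expect mu p env 0
    (fun o env' _ => if o is Some x then (`[< E x env' >])%:R%:E else 0%E).

Definition expected_ops (mu : block_law) (T : Type) (p : prog T)
    (env : seq R) : \bar R :=
  expect mu p env 0 (fun _ _ n => n%:R%:E).

Definition holds_vec (env : seq R) (n : nat) (v : rvec) (x : 'cV[R]_n) : Prop :=
  forall i : 'I_n, onth env (v i.+1) = Some (x i 0).

Definition holds_mx (env : seq R) (m n : nat) (A : rmx) (X : 'M[R]_(m, n)) :
    Prop :=
  forall (i : 'I_m) (j : 'I_n), onth env (A i.+1 j.+1) = Some (X i j).

Definition holds_tensor (env : seq R) (d : nat) (T : rtens) (Y : tensor R d) :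
    Prop :=
  forall i j k : 'I_d, onth env (T i.+1 j.+1 k.+1) = Some (Y i j k).

End Semantics.

Record linalg := LinAlg {
  la_congr : nat -> rmx -> rtens -> prog rtens;
  la_mul : nat -> rmx -> rmx -> prog rmx;
  la_inv : nat -> rmx -> prog rmx;
  la_rank : nat -> nat -> rmx -> prog nat;
  la_solve : nat -> nat -> rmx -> rvec -> prog rvec }.

(* Subroutines may be randomized; the registers they return must be allocated
   and hold the right values with probability one, on every input. *)
Definition linalg_correct (R : realType) (mu : block_law R) (L : linalg) :
    Prop :=
  [/\ forall (env : seq R) (d : nat) A T (X : 'M[R]_d) (Y : tensor R d),
        holds_mx env A X -> holds_tensor env T Y ->
        prob mu (la_congr L d A T) env
          (fun T' env' => holds_tensor env' T' (congr_tensor X Y)) = 1%E,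
      forall (env : seq R) (d : nat) A B (X Y : 'M[R]_d),
        holds_mx env A X -> holds_mx env B Y ->
        prob mu (la_mul L d A B) env
          (fun C env' => holds_mx env' C (X *m Y)) = 1%E,
      forall (env : seq R) (d : nat) A (X : 'M[R]_d),
        holds_mx env A X -> X \in unitmx ->
        prob mu (la_inv L d A) env
          (fun C env' => holds_mx env' C (invmx X)) = 1%E,
      forall (env : seq R) (m n : nat) A (X : 'M[R]_(m, n)),
        holds_mx env A X ->
        prob mu (la_rank L m n A) env (fun r _ => r = \rank X) = 1%E
    & forall (env : seq R) (m n : nat) A b (X : 'M[R]_(m, n)) (x : 'cV[R]_n),
        holds_mx env A X -> holds_vec env b (X *m x) -> \rank X = n ->
        prob mu (la_solve L m n A b) env
          (fun v env' => holds_vec env' v x) = 1%E].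

Definition id_prog : prog rmx :=
  let* z := const 0 in let* o := const 1 in
  Ret (fun i j => if i == j then o else z).

Definition lower (s : nat) (y : rvec) : prog rmx :=
  let* I := id_prog in
  Ret (fun i j => if (j == s) && (s < i)%N then y (i - s)%N else I i j).

Definition upper (s : nat) (x : rvec) : prog rmx :=
  let* I := id_prog in
  Ret (fun i j => if (i == s) && (s < j)%N then x (j - s)%N else I i j).

Definition diagonal (s : nat) (h : reg) : prog rmx :=
  let* I := id_prog in let* c := cbrt1 h in
  Ret (fun i j => if (i == s) && (j == s) then c else I i j).

Definition transposition (s t : nat) : prog rmx :=
  let* I := id_prog in
  Ret (fun i j => I (if i == s then t else if i == t then s else i) j).

(* I_d + q E_{a,b}, for a <> b *)
Definition transvection (a b : nat) (q : reg) : prog rmx :=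
  let* I := id_prog in
  Ret (fun i j => if (i == a) && (j == b) then q else I i j).

(* I_(s-1) (+) a random block of size d - s + 1 *)
Definition random_block (d s : nat) : prog rmx :=
  let* I := id_prog in let* w := draw (d - s + 1) in
  Ret (fun i j => if (s <= i)%N && (s <= j)%N
                  then w (i - s + 1)%N (j - s + 1)%N else I i j).

(* The recursion depth of [up_ge4] and [up3] is not bounded a priori: with fuel
  N the programs perform the same operations, but stop without a result when a
  chain of more than N resamplings would be needed. *)

Section Recover.
Variables (L : linalg) (d : nat).

Definition resample (up : rtens -> prog rmx) (s : nat) (G : rtens) : prog rmx :=
  let* W := random_block d s in
  let* G' := la_congr L d W G in
  let* Q := up G' in
  la_mul L d Q W.

(* Row r of the linear system, 1 <= r <= n ^ 2, stands for the pair (a, b) with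
   r = (a - 1) * n + b. *)
Definition row_fst (n r : nat) : nat := ((r - 1) %/ n).+1.
Definition row_snd (n r : nat) : nat := ((r - 1) %% n).+1.

Definition up_ge4_lhs (G : rtens) (s n : nat) : prog rmx :=
  tabulate (fun _ => 0%N) (n * n) (fun r => tabulate 0%N n (fun c =>
    let a := row_fst n r in let b := row_snd n r in
    arith2 Sub (G (a + s) (b + s) (c + s))%N (G (b + s) (a + s) (c + s))%N)).

Definition up_ge4_rhs (G : rtens) (s n : nat) : prog rvec :=
  tabulate 0%N (n * n) (fun r =>
    let a := row_fst n r in let b := row_snd n r in
    arith2 Sub (G (b + s) (a + s) s)%N (G (a + s) (b + s) s)%N).

Fixpoint up_ge4 (N : nat) (s : nat) (G : rtens) : prog rmx :=
  let n := (d - s)%N in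
  let* M := up_ge4_lhs G s n in
  let* B := up_ge4_rhs G s n in
  let* rM := la_rank L (n * n) n M in
  let* rMB := la_rank L (n * n) n.+1
                (fun i j => if (j <= n)%N then M i j else B i) in
  if (rM == n) && (rMB == n) then
    let* x := la_solve L (n * n) n M B in upper s x
  else if N is N'.+1 then resample (up_ge4 N' s) s G else Stop.

Definition quotient (a1 a2 b1 b2 : reg) : prog reg :=
  let* a := arith2 Sub a1 a2 in
  let* b := arith2 Sub b1 b2 in
  arith2 Div a b.

Fixpoint up3 (N : nat) (G : rtens) : prog rmx :=
  let d1 := (d - 1)%N in let d2 := (d - 2)%N in
  let retry := if N is N'.+1 then resample (up3 N') d2 G else Stop in
  let* t1 := test Eq (G d1 d d) (G d d1 d) in
  if t1 then retry else
  let* q1 := quotient (G d d1 d1) (G d1 d d1) (G d1 d d) (G d d1 d) in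
  let* Q1 := transvection d1 d q1 in
  let* G1 := la_congr L d Q1 G in
  let* q2 := quotient (G1 d d1 d2) (G1 d1 d d2) (G1 d1 d d) (G1 d d1 d) in
  let* Q2 := transvection d2 d q2 in
  let* G2 := la_congr L d Q2 G1 in
  let* t2 := test Eq (G2 d2 d1 d1) (G2 d1 d2 d1) in
  if t2 then retry else
  let* q3 := quotient (G2 d1 d2 d2) (G2 d2 d1 d2) (G2 d2 d1 d1) (G2 d1 d2 d1) in
  let* Q3 := transvection d2 d1 q3 in
  let* G3 := la_congr L d Q3 G2 in
  let* z := const 0 in
  let* t3 := test Eq (G3 d2 d2 d2) z in
  if t3 then retry else
  let* Q32 := la_mul L d Q3 Q2 in
  la_mul L d Q32 Q1.

Definition up2 (G : rtens) : prog rmx :=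
  let d1 := (d - 1)%N in
  let* t := test Eq (G d1 d d) (G d d1 d) in
  if t then transposition d1 d else
  let* x := quotient (G d d1 d1) (G d1 d d1) (G d1 d d) (G d d1 d) in
  upper d1 (fun _ => x).

Definition up (N : nat) (s : nat) (G : rtens) : prog rmx :=
  if (s <= d - 3)%N then up_ge4 N s G
  else if (s == d - 2)%N then up3 N G
  else up2 G.

Definition stage (N : nat) (s : nat) (GQ : rtens * rmx) : prog (rtens * rmx) :=
  let: (G, Q) := GQ in
  let* Qup := up N s G in
  let* H := la_congr L d Qup G in
  let* o := const 1 in
  let* h := arith2 Div o (H s s s) in
  let* m := const (- 1) in
  let* mh := arith2 Mul m h in
  let* y := tabulate 0%N (d - s) (fun i => arith2 Mul mh (H s (s + i)%N s)) in
  let* Ds := diagonal s h in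
  let* Ls := lower s y in
  let* Qdlow := la_mul L d Ds Ls in
  let* G' := la_congr L d Qdlow H in
  let* Q' := la_mul L d Qup Q in
  let* Q'' := la_mul L d Qdlow Q' in
  Ret (G', Q'').

Definition recover (N : nat) (G : rtens) : prog rmx :=
  let* I := id_prog in
  let* GQ := foldp (stage N) (iota 1 (d - 1)) (G, I) in
  let: (G', Q) := GQ in
  let* Qi := la_inv L d Q in
  let* Dd := diagonal d (G' d d d) in
  la_mul L d Qi Dd.

End Recover.

(* Both quantities are nondecreasing in the fuel N; their suprema are those of
   the algorithm without a bound on the recursion depth. *)
Definition recover_success (R : realType) (mu : block_law R) (L : linalg)
    (d : nat) (env : seq R) (T : rtens) (G : tensor R d) : \bar R :=
  ereal_sup [set prob mu (recover L d N T) env (fun Q env' =>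
    exists A : 'M[R]_d, [/\ holds_mx env' Q A, A \in unitmx
                          & G = congr_tensor A (core R d)]) | N in setT].

Definition recover_ops (R : realType) (mu : block_law R) (L : linalg)
    (d : nat) (env : seq R) (T : rtens) : \bar R :=
  ereal_sup [set expected_ops mu (recover L d N T) env | N in setT].

(* Main.v *)
Require Import Defs.
From mathcomp Require Import all_boot all_order all_algebra fingroup perm.
From mathcomp Require Import all_classical all_reals all_analysis.
From mathcomp Require Import measurable_realfun.
From mathcomp Require Import zify ring.

(* Indices of rows and columns count from 0 here: stage s of the algorithm is
   p = s - 1, and it starts from G = A * C with A in I_p (+) GL_(d-p).

   Let tau be the trilinear form of C skew-symmetrized in its first two
   arguments.  For u, v supported on the coordinates >= p, tau u v e_p = 0.
   Hence, for a row vector w, the equations tau A_a A_b w = 0 (a, b > p) hold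
   whenever w is a multiple of e_p; if the linear system of the up-step has
   full rank, its unique solution makes row p of U A a multiple of e_p, and the
   down-step then leaves the trailing block of A.  The last two stages are
   similar: e_p is a combination of the last rows, and the tests let tau
   eliminate all of them but one.

   Without resampling, the block at a later stage is the trailing block of the
   current one, so that the tests of all later stages are polynomial conditions
   on the entries of a random block W.  Each of them holds for some W, hence
   for almost all W: one resampling suffices, and no later stage needs another
   one.  Thus the O(d^4) price of the congruence by a dense matrix is paid at
   most once, and every other stage costs O(d^3): congruences by elementary
   matrices exploit zeros, and the ranks and solutions of n^2 x n systems are
   found in O(n^3) operations with a random test for linear dependence. *)

Set Implicit Arguments.
Unset Strict Implicit.
Unset Printing Implicit Defensive.

Import Order.TTheory GRing.Theory Num.Theory.
Import HBNNSimple.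

Local Open Scope classical_set_scope.
Local Open Scope ring_scope.

(** * Integrals of functions that need not be measurable *)

Section Integral.
Local Open Scope ereal_scope.
Context d (T : measurableType d) (R : realType).
Variable mu : {measure set T -> \bar R}.
Implicit Types f g : T -> \bar R.

(** The subroutines are arbitrary programs, so an outcome need not depend measurably on the draws,
    and probability one is only known as the value of an iterated integral. The integral of a
    nonnegative function is therefore used in its raw form, a supremum over simple functions below
    it; an integral equal to 1 still yields a measurable set of full measure for each draw, and the
    rest is argued with such sets.

    Genericity rests on univariate polynomials alone: restriction to lines suffices both for null
    sets and for conjunctions. A test is generic as soon as one block passes it, since the draw W =
    Y A^-1 reaches every block Y. The identity would be the natural Y, but it fails the rank test:
    coordinate p + 1 is then never the larger index of a pair (a, b), and the unknown with this
    index stays free. Hence the perturbed identity used for that test.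

    Fuel 1 already succeeds almost surely, whereas the bound on operations must hold for every fuel,
    including 0, where a run may stop. *)

Lemma integral_sup_nnsfun f : (forall x, 0 <= f x) ->
  \int[mu]_x f x = ereal_sup [set \int[mu]_x (h x)%:E |
    h in [set h : {nnsfun T >-> R} | forall x, (h x)%:E <= f x]].
Proof.
move=> f0; rewrite ge0_integralTE//; congr ereal_sup.
by apply: eq_imagel => h _; rewrite integral_nnsfun// patch_setT.
Qed.

Lemma le_nonneg_integral f g : (forall x, 0 <= f x) ->
  (forall x, f x <= g x) -> \int[mu]_x f x <= \int[mu]_x g x.
Proof.
move=> f0 fg; have g0 x : 0 <= g x by exact: le_trans (f0 x) (fg x).
rewrite !integral_sup_nnsfun//; apply: le_ereal_sup => _ [h hf <-].
by exists h => // x; exact: le_trans (hf x) (fg x).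
Qed.

(** Only [g] has to be measurable: a simple function below [f] is below [g] off [N], and the almost
    everywhere comparison is applied to that function instead of [f]. *)
Lemma le_integral_offnull (N : set T) f g : measurable N -> mu N = 0 ->
  (forall x, 0 <= f x) -> (forall x, 0 <= g x) -> measurable_fun setT g ->
  (forall x, ~ N x -> f x <= g x) -> \int[mu]_x f x <= \int[mu]_x g x.
Proof.
move=> mN N0 f0 g0 mg fg; rewrite integral_sup_nnsfun//.
apply: ge_ereal_sup => _ [h hf <-].
apply: ae_ge0_le_integral => //.
- by move=> x _; rewrite lee_fin.
- exact/measurable_EFinP.
- exists N; split=> // x /= /not_implyP[_ hx]; apply: contrapT => Nx.
  exact/hx/(le_trans (hf x))/fg.
Qed.

End Integral.

Section ProbabilityIntegral.
Local Open Scope ereal_scope.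
Context d (T : measurableType d) (R : realType).
Variable P : probability T R.
Implicit Types f : T -> \bar R.

Lemma probability_setC1 (A : set T) : measurable A -> P A = 1 -> P (~` A) = 0.
Proof. by move=> mA PA; rewrite probability_setC// PA subee. Qed.

Lemma integral_le_as (A : set T) f (K : R) : measurable A -> P A = 1 ->
  (forall x, 0 <= f x) -> (0 <= K)%R -> (forall x, A x -> f x <= K%:E) ->
  \int[P]_x f x <= K%:E.
Proof.
move=> mA PA f0 K0 fK; rewrite -[leRHS]mule1 -(probability_setT P).
rewrite -integral_cst//; apply: (@le_integral_offnull _ _ _ _ (~` A)) => //.
- exact: measurableC.
- exact: probability_setC1.
- by move=> x /contrapT; exact: fK.
Qed.

(** The indicator of [A] lies below [f] and has integral 1. *)
Lemma integral_ge1_as (A : set T) f : measurable A -> P A = 1 ->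
  (forall x, 0 <= f x) -> (forall x, A x -> 1 <= f x) -> 1 <= \int[P]_x f x.
Proof.
move=> mA PA f0 fA; rewrite -PA -[A in leLHS]setIT -integral_indic//.
apply: le_nonneg_integral => x; first by rewrite lee_fin.
by rewrite indicE; have [/set_mem/fA//|] := boolP (x \in A).
Qed.

(* [f] need not be measurable: the supremum of a sequence of simple functions
   below [f] whose integrals tend to 1 is measurable, and equals 1 almost
   everywhere. *)
Lemma integral_eq1_as f : (forall x, 0 <= f x <= 1) -> \int[P]_x f x = 1 ->
  exists A, [/\ measurable A, P A = 1 & forall x, A x -> f x = 1].
Proof.
move=> f01 If1; have f0 x : 0 <= f x by case/andP: (f01 x).
have f1 x : f x <= 1 by case/andP: (f01 x).
move: If1; rewrite integral_sup_nnsfun//; set S := [set _ | _ in _] => S1.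
have /choice[h hP] n : exists h : {nnsfun T >-> R},
    (forall x, (h x)%:E <= f x) /\ (1 - (n.+1%:R^-1)%:E < \int[P]_x (h x)%:E).
  have n0 : (0 < n.+1%:R^-1 :> R)%R by rewrite invr_gt0.
  have [|_ [h hf <-]] := @ub_ereal_sup_adherent R S _ n0.
    by rewrite S1.
  by rewrite S1 => hn; exists h.
pose g x := esups (fun n => (h n x)%:E) 0%N.
have mg : measurable_fun setT g.
  by apply: measurable_fun_esups => n; exact/measurable_EFinP.
have hg n x : (h n x)%:E <= g x by apply: ereal_sup_ubound; exists n.
have gf x : g x <= f x.
  by apply: ge_ereal_sup => _ [n _ <-]; case: (hP n).
have g0 x : 0 <= g x by apply: le_trans (hg 0%N x); rewrite lee_fin.
have g1 x : g x <= 1 by exact: le_trans (f1 x).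
have gfin x : g x \is a fin_num.
  by rewrite ge0_fin_numE// (le_lt_trans (g1 x))// ltry.
have Ig : \int[P]_x g x = 1.
  apply/eqP; rewrite eq_le; apply/andP; split.
    by apply: (integral_le_as (A := setT)) => //; exact: probability_setT.
  have Ign n : 1 - (n.+1%:R^-1)%:E <= \int[P]_x g x.
    case: (hP n) => _ /ltW/le_trans; apply; apply: le_nonneg_integral => //.
    by move=> x; rewrite lee_fin.
  apply/lee_addgt0Pr => e e0.
  rewrite -leeBlDr//; apply: le_trans (Ign (Num.truncn e^-1)).
  rewrite leeB// lee_fin -[leRHS]invrK lef_pV2 ?posrE ?invr_gt0//.
  by rewrite ltW// truncnS_gt.
have := @ge0_integralD _ _ _ P setT measurableT g (fun x => 1 - g x).
have mg1 : measurable_fun setT (fun x => 1 - g x) by exact: emeasurable_funB.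
have -> : (fun x => g x + (1 - g x)) = cst 1.
  by apply/funext => x; rewrite addeC subeK.
rewrite integral_cst// mul1e Ig.
have PT : P setT = 1 by exact: probability_setT.
move/(_ (fun x _ => g0 x) mg) => I1.
have Ig1 : \int[P]_x `|1 - g x| = 0.
  have -> : (fun x => `|1 - g x|) = (fun x => 1 - g x).
    by apply/funext => x; rewrite gee0_abs// sube_ge0 ?gfin.
  have /I1/(_ mg1) : forall x, setT x -> 0 <= 1 - g x by move=> x _; rewrite sube_ge0 ?gfin.
  move/(congr1 (fun z => z - 1)); rewrite [X in X - _ = _ -> _]PT subee// addeAC subee// add0e.
  by move=> <-.
have [/(_ Ig1) [N [mN N0 NA]] _] := ae_eq_integral_abs P measurableT mg1.
exists (~` N); split; first exact: measurableC.
  by rewrite probability_setC// [P N](N0 : P N = 0) sube0.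
move=> x Nx; apply/eqP; rewrite eq_le f1/=.
have : 1 - g x = 0.
  apply: contrapT => gx; apply: Nx; apply: NA => /= Dx; exact/gx/Dx.
move=> gx; have <- : g x = 1 by rewrite -(subeK 1 (gfin x)) gx add0e.
exact: gf.
Qed.

End ProbabilityIntegral.

(** * Zero sets of polynomial functions *)

Lemma finite_poly_roots (F : fieldType) (p : {poly F}) :
  p != 0 -> finite_set [set x | root p x].
Proof.
have [n] := ubnP (size p); elim: n p => // n IHn p pn p0.
have [[a pa]|noroot] := pselect (exists a, root p a); last first.
  by apply: (sub_finite_set _ (@finite_set0 F)) => x px; apply: noroot; exists x.
move/factor_theorem: pa => [q pE].
have q0 : q != 0 by apply: contraNneq p0 => q0; rewrite pE q0 mul0r.
have qn : (size q < n)%N by move: pn; rewrite pE size_Mmonic ?monicXsubC// size_XsubC addn2.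
apply: (@sub_finite_set _ _ ([set a] `|` [set x | root q x])).
  by move=> x /=; rewrite pE rootM root_XsubC => /orP[|/eqP]; [right|left].
by rewrite finite_setU; split; [exact: finite_set1|exact: IHn].
Qed.

Section Generic.
Variable R : realType.
Local Notation Rtuple n := (n.-tuple (measurableTypeR R)).

Definition line n (a b : Rtuple n) (t : R) : Rtuple n :=
  [tuple tnth a i + t * tnth b i | i < n].

(** A substitute for multivariate polynomials. Lines parallel to the first axis give null sets by
    slicing, and the line joining two points gives a common non-zero of two functions. *)
Definition poly_on_lines n (f : Rtuple n -> R) :=
  forall a b, exists p : {poly R}, forall t, f (line a b t) = p.[t].

Lemma lebesgue_tuple_ge0 n (A : set (Rtuple n)) : (0 <= lebesgue_tuple A)%E.
Proof.
elim: n A => [|n IHn] A /=; first by rewrite diracE lee_fin.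
by apply: integral_ge0 => x _; exact: IHn.
Qed.

(** Slicing and induction on [n]: along the first axis through [t0], [f] is a nonzero polynomial
    [p]. Off the finitely many roots of [p], the slice of [f] does not vanish at the tail of [t0],
    so the slice of the zero set is null by induction. *)
Lemma lebesgue_tuple_zeros n (f : Rtuple n -> R) (t0 : Rtuple n) :
  poly_on_lines f -> f t0 != 0 -> lebesgue_tuple [set t | f t = 0] = 0%E.
Proof.
elim: n f t0 => [|n IHn] f t0 fp ft0.
  by rewrite /= diracE memNset//=; apply/eqP; rewrite -(tuple0 t0).
(* The first coordinate itself is the parameter of this line. *)
have [p pE] := fp [tuple of 0 :: behead t0] [tuple of 1 :: nseq n (0 : R)].
have {}pE x : f [tuple of x :: behead t0] = p.[x].
  rewrite -pE; congr f; apply: eq_from_tnth => i; rewrite tnth_mktuple.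
  rewrite !(tnth_nth 0)/=; case: i => -[|i] ilt /=; first by rewrite add0r mulr1.
  by rewrite nth_nseq if_same mulr0 addr0.
have p0 : p != 0.
  apply: contraNneq ft0 => p0; rewrite (tuple_eta t0).
  by move: (pE (thead t0)); rewrite p0 horner0 => ->.
apply/eqP; rewrite eq_le lebesgue_tuple_ge0 andbT /=.
have finp := finite_poly_roots p0.
rewrite -[leRHS](@integral0 _ (measurableTypeR R) R (@lebesgue_measure R) setT).
apply: (@le_integral_offnull _ (measurableTypeR R) R (@lebesgue_measure R)
  [set x | root p x]) => //.
- exact/countable_measurable/finite_set_countable.
- exact/countable_lebesgue_measure0/finite_set_countable.
- by move=> x; exact: lebesgue_tuple_ge0.
move=> x /negP px; rewrite (IHn (fun t => f [tuple of x :: t]) [tuple of behead t0])//.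
  move=> a b; have [q qE] := fp [tuple of x :: a] [tuple of 0 :: b].
  exists q => t; rewrite -qE; congr f; apply: eq_from_tnth => i.
  rewrite tnth_mktuple !(tnth_nth 0)/=; case: i => -[|i] ilt /=.
    by rewrite mulr0 addr0.
  by rewrite (nth_map (Ordinal (ilt : (i < n)%N))) ?size_enum_ord// !(tnth_nth 0)/= nth_enum_ord.
by rewrite (_ : [tuple of _] = [tuple of x :: behead t0]) ?pE//; apply: val_inj.
Qed.

(** Measurability is carried along because absolute continuity speaks of measurable sets only. *)
Definition polylike n (f : Rtuple n -> R) :=
  measurable_fun setT f /\ poly_on_lines f.

Lemma polylike_cst n (c : R) : polylike (fun _ : Rtuple n => c).
Proof. by split=> // a b; exists c%:P => t; rewrite hornerC. Qed.

Lemma polylike_nth n i : polylike (fun w : Rtuple n => w`_i).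
Proof.
have [ilt|ige] := ltnP i n; last first.
  rewrite (_ : (fun _ => _) = (fun=> 0)); first exact: polylike_cst.
  by apply/funext => w; rewrite nth_default// size_tuple.
split.
  rewrite (_ : (fun _ => _) = (fun w => tnth w (Ordinal ilt))).
    exact: measurable_tnth.
  by apply/funext => w; rewrite (tnth_nth 0).
move=> a b; exists ((a`_i)%:P + 'X * (b`_i)%:P) => t.
rewrite !hornerE -[i in LHS]/(val (Ordinal ilt)) -tnth_nth tnth_mktuple.
by rewrite !(tnth_nth 0).
Qed.

Lemma polylikeD n (f g : Rtuple n -> R) :
  polylike f -> polylike g -> polylike (fun w => f w + g w).
Proof.
move=> [mf fp] [mg gp]; split; first exact: measurable_funD.
move=> a b; have [p pE] := fp a b; have [q qE] := gp a b.
by exists (p + q) => t; rewrite hornerD pE qE.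
Qed.

Lemma polylikeM n (f g : Rtuple n -> R) :
  polylike f -> polylike g -> polylike (fun w => f w * g w).
Proof.
move=> [mf fp] [mg gp]; split; first exact: measurable_funM.
move=> a b; have [p pE] := fp a b; have [q qE] := gp a b.
by exists (p * q) => t; rewrite hornerM pE qE.
Qed.

Lemma polylikeN n (f : Rtuple n -> R) : polylike f -> polylike (fun w => - f w).
Proof.
move=> fp; under eq_fun do rewrite -mulN1r.
by apply: polylikeM => //; exact: polylike_cst.
Qed.

Lemma polylikeB n (f g : Rtuple n -> R) :
  polylike f -> polylike g -> polylike (fun w => f w - g w).
Proof. by move=> fp gp; apply: polylikeD => //; exact: polylikeN. Qed.

Lemma polylike_sum n (I : Type) (r : seq I) (P : pred I) (f : I -> Rtuple n -> R) :
  (forall i, polylike (f i)) -> polylike (fun w => \sum_(i <- r | P i) f i w).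
Proof.
move=> fp; elim: r => [|i r IHr].
  by under eq_fun do rewrite big_nil; exact: polylike_cst.
under eq_fun do rewrite big_cons; case: (P i) => //.
exact: polylikeD.
Qed.

Lemma polylike_prod n (I : Type) (r : seq I) (P : pred I) (f : I -> Rtuple n -> R) :
  (forall i, polylike (f i)) -> polylike (fun w => \prod_(i <- r | P i) f i w).
Proof.
move=> fp; elim: r => [|i r IHr].
  by under eq_fun do rewrite big_nil; exact: polylike_cst.
under eq_fun do rewrite big_cons; case: (P i) => //.
exact: polylikeM.
Qed.

Lemma polylike_det n m (F : Rtuple n -> 'M[R]_m) :
  (forall i j, polylike (fun w => F w i j)) -> polylike (fun w => \det (F w)).
Proof.
move=> Fp; apply: polylike_sum => s; apply: polylikeM.
  exact: polylike_cst.
by apply: polylike_prod.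
Qed.

(** [P] contains the complement of a proper hypersurface. Asking for an inclusion, not an equality,
    allows arbitrary properties [P], such as the success of a whole run of tests. *)
Definition generic n (P : Rtuple n -> Prop) := exists f : Rtuple n -> R,
  [/\ polylike f, exists w, f w != 0 & forall w, f w != 0 -> P w].

Lemma generic_sub n (P Q : Rtuple n -> Prop) :
  (forall w, P w -> Q w) -> generic P -> generic Q.
Proof. by move=> PQ [f [fp f0 fP]]; exists f; split=> // w /fP/PQ. Qed.

Lemma genericT n (P : Rtuple n -> Prop) : (forall w, P w) -> generic P.
Proof.
move=> allP; exists (fun=> 1); split=> //; first exact: polylike_cst.
by exists [tuple of nseq n (0 : R)]; rewrite oner_eq0.
Qed.

(** The two functions are nonzero at different points [a] and [b]. On the line from [a] to [b] both
    are nonzero polynomials, and their product has only finitely many roots. *)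
Lemma generic_and n (P Q : Rtuple n -> Prop) :
  generic P -> generic Q -> generic (fun w => P w /\ Q w).
Proof.
move=> [f [fp [a fa] fP]] [g [gp [b gb] gQ]].
exists (fun w => f w * g w); split; first exact: polylikeM.
  pose c : Rtuple n := [tuple tnth b i - tnth a i | i < n].
  have [p pE] := fp.2 a c; have [q qE] := gp.2 a c.
  have l0 : line a c 0 = a.
    by apply: eq_from_tnth => i; rewrite tnth_mktuple mul0r addr0.
  have l1 : line a c 1 = b.
    by apply: eq_from_tnth => i; rewrite !tnth_mktuple mul1r addrC subrK.
  have p0 : p != 0.
    by apply: contraNneq fa => p0; rewrite -l0 pE p0 horner0.
  have q0 : q != 0.
    by apply: contraNneq gb => q0; rewrite -l1 qE q0 horner0.
  have pq0 : p * q != 0 by rewrite mulf_neq0.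
  have [t pqt] : exists t, (p * q).[t] != 0.
    (* Otherwise the numbers 0, 1, ... below the size of [p * q] would all be roots, more than the
       degree allows. *)
    apply: contrapT => nt.
    have := @max_poly_roots _ _ [seq k%:R | k <- iota 0 (size (p * q)%R)] pq0.
    rewrite size_map size_iota ltnn => /(_ _ _)/notF; apply.
      apply/allP => x _; apply/negPn/negP => xr; apply: nt; exists x.
      by rewrite -rootE.
    by rewrite map_inj_uniq ?iota_uniq// => i j /eqP; rewrite eqr_nat => /eqP.
  by exists (line a c t); rewrite pE qE -hornerM.
by move=> w; rewrite mulf_eq0 negb_or => /andP[/fP ? /gQ ?].
Qed.

Lemma generic_forall_lt n k (P : nat -> Rtuple n -> Prop) :
  (forall i, (i < k)%N -> generic (P i)) ->
  generic (fun w => forall i, (i < k)%N -> P i w).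
Proof.
elim: k => [|k IHk] gP; first exact: genericT.
apply: generic_sub (generic_and (IHk _) (gP k (ltnSn k))).
  by move=> w [H Hk] i; rewrite ltnS leq_eqVlt => /predU1P[->//|/H].
by move=> i ik; apply: gP; rewrite ltnS ltnW.
Qed.

Lemma generic_as (mu : block_law R) m (P : Rtuple (m * m) -> Prop) :
  absolutely_continuous mu -> generic P ->
  exists A, [/\ measurable A, mu m A = 1%E & forall w, A w -> P w].
Proof.
move=> ac [f [[mf fp] [w0 fw0] fP]].
have mZ : measurable [set w | f w = 0].
  by rewrite -[X in measurable X]setTI; exact: (mf measurableT [set 0] (measurable_set1 0)).
exists (~` [set w | f w = 0]); split; first exact: measurableC.
  rewrite probability_setC// [mu m _]ac ?sube0//.
  exact: lebesgue_tuple_zeros fp fw0.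
by move=> w /eqP; exact: fP.
Qed.

End Generic.

(** * Almost sure properties and costs of programs *)

Section AlmostSure.
Variables (R : realType) (mu : block_law R).

(** One set of full measure per draw, chosen after the preceding draws: nesting these sets replaces
    the joint law of all draws and avoids joint measurability. *)
Fixpoint asure (T : Type) (p : prog T) (env : seq R) (n : nat)
    (E : option T -> seq R -> nat -> Prop) {struct p} : Prop :=
  match p with
  | Ret x => E (Some x) env n
  | Stop => E None env n
  | Const c k => asure (k (size env)) (rcons env c%:~R) n E
  | Arith o a b k =>
      if eval_arith o env`_a env`_b is Some v
      then asure (k (size env)) (rcons env v) n.+1 E
      else E None env n.+1
  | Cbrt a k => asure (k (size env)) (rcons env (cbrt env`_a)) n.+1 E
  | Test o a b k => asure (k (eval_comparison o env`_a env`_b)) env n.+1 E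
  | Draw m k => exists A, [/\ measurable A, mu m A = 1%E & forall w, A w ->
      asure (k (fun i j => size env + (i - 1) * m + (j - 1))%N)
             (env ++ w) (n + m * m)%N E]
  end.

Lemma asure_mono T (p : prog T) env n (E F : option T -> seq R -> nat -> Prop) :
  (forall o env' n', E o env' n' -> F o env' n') ->
  asure p env n E -> asure p env n F.
Proof.
move=> EF; elim: p env n => [x||c k IH|o a b k IH|a k IH|o a b k IH|m k IH] env n /=.
- exact: EF.
- exact: EF.
- exact: IH.
- by case: eval_arith => [v|]; [exact: IH|exact: EF].
- exact: IH.
- exact: IH.
- by move=> [A [mA A1 AE]]; exists A; split=> // w /AE; exact: IH.
Qed.

Lemma asure_bind S T (p : prog S) (q : S -> prog T) env n
    (E : option S -> seq R -> nat -> Prop) (F : option T -> seq R -> nat -> Prop) :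
  asure p env n E ->
  (forall x env' n', E (Some x) env' n' -> asure (q x) env' n' F) ->
  (forall env' n', E None env' n' -> F None env' n') ->
  asure (bind p q) env n F.
Proof.
move=> + qF EF; elim: p env n => [x||c k IH|o a b k IH|a k IH|o a b k IH|m k IH] env n /=.
- exact: qF.
- exact: EF.
- exact: IH.
- by case: eval_arith => [v|]; [exact: IH|exact: EF].
- exact: IH.
- exact: IH.
- by move=> [A [mA A1 AE]]; exists A; split=> // w /AE; exact: IH.
Qed.

(** Registers are write-once, so every operation only appends to the memory; values held earlier
    remain readable. *)
Lemma asure_prefix T (p : prog T) env n (E : option T -> seq R -> nat -> Prop) :
  asure p env n E ->
  asure p env n (fun o env' n' => prefix env env' /\ E o env' n').
Proof.
elim: p env n => [x||c k IH|o a b k IH|a k IH|o a b k IH|m k IH] env n /=.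
- by move=> ?; rewrite prefix_refl.
- by move=> ?; rewrite prefix_refl.
- move=> /IH; apply: asure_mono => o env' n' [pre ?]; split=> //.
  exact: prefix_trans (prefix_rcons _ _) pre.
- case: eval_arith => [v|]; last by rewrite prefix_refl.
  move=> /IH; apply: asure_mono => o' env' n' [pre ?]; split=> //.
  exact: prefix_trans (prefix_rcons _ _) pre.
- move=> /IH; apply: asure_mono => o env' n' [pre ?]; split=> //.
  exact: prefix_trans (prefix_rcons _ _) pre.
- exact: IH.
- move=> [A [mA A1 AE]]; exists A; split=> // w /AE/IH.
  apply: asure_mono => o env' n' [pre ?]; split=> //.
  exact: prefix_trans (prefix_prefix _ _) pre.
Qed.

Lemma expect_ge0 T (p : prog T) env n (f : option T -> seq R -> nat -> \bar R) :
  (forall o env' n', 0 <= f o env' n')%E -> (0 <= expect mu p env n f)%E.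
Proof.
move=> f0; elim: p env n => [x||c k IH|o a b k IH|a k IH|o a b k IH|m k IH] env n //=.
- by case: eval_arith.
- by apply: integral_ge0 => w _; exact: IH.
Qed.

Lemma expect_le1 T (p : prog T) env n (f : option T -> seq R -> nat -> \bar R) :
  (forall o env' n', 0 <= f o env' n' <= 1)%E -> (expect mu p env n f <= 1)%E.
Proof.
move=> f01; have f0 o env' n' : (0 <= f o env' n')%E by case/andP: (f01 o env' n').
have f1 o env' n' : (f o env' n' <= 1)%E by case/andP: (f01 o env' n').
elim: p env n => [x||c k IH|o a b k IH|a k IH|o a b k IH|m k IH] env n //=.
- by case: eval_arith.
- apply: (@integral_le_as _ _ _ _ setT) => //; first exact: probability_setT.
  by move=> w; exact: expect_ge0.
Qed.

Lemma asure_expect_le T (p : prog T) env n (K : nat) :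
  asure p env n (fun _ _ n' => n' <= K)%N ->
  (expect mu p env n (fun _ _ n' => n'%:R%:E) <= K%:R%:E)%E.
Proof.
elim: p env n => [x||c k IH|o a b k IH|a k IH|o a b k IH|m k IH] env n //=.
- by rewrite lee_fin ler_nat.
- by rewrite lee_fin ler_nat.
- exact: IH.
- by case: eval_arith => [v|]; [exact: IH|rewrite lee_fin ler_nat].
- exact: IH.
- exact: IH.
- move=> [A [mA A1 AE]]; apply: (integral_le_as mA A1) => //.
    by move=> w; apply: expect_ge0.
  by move=> w /AE; exact: IH.
Qed.

Definition indicator_outcome T (E : T -> seq R -> Prop) (o : option T)
    (env : seq R) (n : nat) : \bar R :=
  if o is Some x then (`[< E x env >])%:R%:E else 0%E.

Lemma indicator_outcome01 T (E : T -> seq R -> Prop) o env n :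
  (0 <= indicator_outcome E o env n <= 1)%E.
Proof. by case: o => [x|] /=; rewrite !lee_fin ?ler01 ?lexx// ler0n lern1 leq_b1. Qed.

(** This direction makes the correctness of an arbitrary subroutine usable: a function bounded by 1
    whose integral is 1 equals 1 on a measurable set of full measure. The counters [n] and [n'] are
    unrelated because the outcome considered ignores them. *)
Lemma expect_asure T (p : prog T) env n (E : T -> seq R -> Prop) n' :
  expect mu p env n (indicator_outcome E) = 1%E ->
  asure p env n' (fun o env' _ => if o is Some x then E x env' else False).
Proof.
have I01 := indicator_outcome01 E.
elim: p env n n' => [x||c k IH|o a b k IH|a k IH|o a b k IH|m k IH] env n n' /=.
- by move=> [] /eqP; rewrite pnatr_eq1 eqb1 => /asboolP.
- by move=> [] /eqP; rewrite eq_sym oner_eq0.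
- exact: IH.
- case: eval_arith => [v|]; first exact: IH.
  by move=> [] /eqP; rewrite eq_sym oner_eq0.
- exact: IH.
- exact: IH.
- move=> /integral_eq1_as[w|A [mA A1 AE]].
    by rewrite expect_ge0 ?expect_le1// => o e i; case/andP: (I01 o e i).
  by exists A; split=> // w /AE; exact: IH.
Qed.

Lemma asure_expect T (p : prog T) env n (E : T -> seq R -> Prop) n' :
  asure p env n' (fun o env' _ => if o is Some x then E x env' else False) ->
  expect mu p env n (indicator_outcome E) = 1%E.
Proof.
have I01 := indicator_outcome01 E.
elim: p env n n' => [x||c k IH|o a b k IH|a k IH|o a b k IH|m k IH] env n n' //=.
- by move=> Ex; rewrite asboolT.
- exact: IH.
- by case: eval_arith => [v|//]; exact: IH.
- exact: IH.
- exact: IH.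
- move=> [A [mA A1 AE]]; apply/eqP; rewrite eq_le; apply/andP; split.
    have := @expect_le1 _ (Draw m k) env n _ I01; exact.
  apply: (integral_ge1_as mA A1) => [w|w /AE/IH->//].
  by apply: expect_ge0 => o e i; case/andP: (I01 o e i).
Qed.

Lemma prob_asureP T (p : prog T) env (E : T -> seq R -> Prop) n :
  prob mu p env E = 1%E <->
  asure p env n (fun o env' _ => if o is Some x then E x env' else False).
Proof. by split=> [/expect_asure|/asure_expect]; exact. Qed.

End AlmostSure.

Section Reads.
Variable R : realType.

Lemma onth_prefix (env env' : seq R) r x :
  prefix env env' -> onth env r = Some x -> onth env' r = Some x.
Proof.
move=> /prefixP[s ->] H; rewrite onth_cat -H.
by have := H; rewrite onthE; case: ltnP => // ?; rewrite nth_default// size_map.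
Qed.

Lemma onth_nth0 (env : seq R) r x : onth env r = Some x -> env`_r = x.
Proof.
rewrite onthE => H; have rs : (r < size env)%N.
  by case: ltnP H => // ?; rewrite nth_default// size_map.
by move: H; rewrite (nth_map 0)// => -[].
Qed.

Lemma onth_rcons_size (env : seq R) x : onth (rcons env x) (size env) = Some x.
Proof. by rewrite onthE map_rcons nth_rcons size_map ltnn eqxx. Qed.

End Reads.

(* Collecting the subtractions of a budget avoids a case split for each of them. *)
Ltac cost_lia := rewrite -?subnDA; lia.

(** * Hoare triples with a cost bound *)

Section Triple.
Variables (R : realType) (mu : block_law R) (counted stops : Prop).

(** The two switches let one analysis serve both halves of the theorem: [counted] is [False] for
    subroutines that are merely correct, whose cost may be unbounded, and [stops] is [True] when the
    fuel may run out. *)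
Definition triple (T : Type) (p : prog T) (env : seq R) (c : nat)
    (Q : T -> seq R -> Prop) : Prop :=
  forall n, asure mu p env n (fun o env' n' =>
    [/\ prefix env env', counted -> (n' <= n + c)%N
      & if o is Some x then Q x env' else stops]).

Lemma triple_ret T (x : T) env c Q : Q x env -> triple (Ret x) env c Q.
Proof. by move=> Qx n; split=> //; rewrite ?prefix_refl// => _; rewrite leq_addr. Qed.

Lemma triple_stop T env c (Q : T -> seq R -> Prop) : stops -> triple Stop env c Q.
Proof. by move=> st n; split=> //; rewrite ?prefix_refl// => _; rewrite leq_addr. Qed.

Lemma triple_weaken T (p : prog T) env c c' (Q Q' : T -> seq R -> Prop) :
  triple p env c Q -> (counted -> (c <= c')%N) ->
  (forall x env', prefix env env' -> Q x env' -> Q' x env') -> triple p env c' Q'.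
Proof.
move=> tp cc' QQ' n; apply: asure_mono (tp n) => -[x|] env' n' [pre cn q]; split=> //.
- by move=> ct; rewrite (leq_trans (cn ct))// leq_add2l cc'.
- exact: QQ'.
- by move=> ct; rewrite (leq_trans (cn ct))// leq_add2l cc'.
Qed.

Lemma triple_cost T (p : prog T) env c c' (Q : T -> seq R -> Prop) :
  triple p env c Q -> (counted -> (c <= c')%N) -> triple p env c' Q.
Proof. by move=> tp cc'; apply: triple_weaken tp cc' _. Qed.

Lemma triple_post T (p : prog T) env c (Q Q' : T -> seq R -> Prop) :
  triple p env c Q ->
  (forall x env', prefix env env' -> Q x env' -> Q' x env') -> triple p env c Q'.
Proof. by move=> tp; apply: triple_weaken tp _. Qed.

(** The whole budget is fixed at the start and the continuation receives what is left; the
    inequality guards the truncated subtraction. *)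
Lemma triple_bind S T (p : prog S) (q : S -> prog T) env c1 c Q1 Q :
  triple p env c1 Q1 -> (counted -> (c1 <= c)%N) ->
  (forall x env', prefix env env' -> Q1 x env' -> triple (q x) env' (c - c1) Q) ->
  triple (bind p q) env c Q.
Proof.
move=> tp c1c tq n; apply: asure_bind (tp n) _ _.
  move=> x env' n' [pre cn Qx].
  apply: asure_mono (tq x env' pre Qx n') => o env2 n2 [pre2 cn2 ?].
  split=> //; first exact: prefix_trans pre pre2.
  by move=> ct; have := cn ct; have := cn2 ct; have := c1c ct; lia.
move=> env' n' [pre cn st]; split=> // ct.
by have := cn ct; have := c1c ct; lia.
Qed.

Lemma triple_seq S T (p : prog S) (q : S -> prog T) env c1 c2 Q1 Q :
  triple p env c1 Q1 ->
  (forall x env', prefix env env' -> Q1 x env' -> triple (q x) env' c2 Q) ->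
  triple (bind p q) env (c1 + c2) Q.
Proof.
move=> tp tq; apply: triple_bind tp _ _ => [_|x env' pre Qx]; first exact: leq_addr.
by rewrite addKn; exact: tq.
Qed.

Lemma triple_const (i : int) env c :
  triple (const i) env c (fun r env' => onth env' r = Some i%:~R).
Proof.
move=> n; split; [exact: prefix_rcons| |exact: onth_rcons_size].
by move=> _; rewrite leq_addr.
Qed.

Definition arith_value (o : arith) (x y : R) : R :=
  match o with Defs.Add => x + y | Defs.Sub => x - y | Defs.Mul => x * y
  | Defs.Div => x / y end.

Lemma triple_arith2 (o : arith) a b x y env :
  onth env a = Some x -> onth env b = Some y -> (o = Defs.Div -> y != 0) ->
  triple (arith2 o a b) env 1
    (fun r env' => onth env' r = Some (arith_value o x y)).
Proof.
move=> /onth_nth0 ax /onth_nth0 bY oy n /=; rewrite ax bY.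
have -> : eval_arith o x y = Some (arith_value o x y).
  by case: o oy => //= /(_ erefl)/negbTE->.
split; [exact: prefix_rcons| |exact: onth_rcons_size].
by rewrite addn1.
Qed.

Lemma triple_cbrt a x env : onth env a = Some x ->
  triple (cbrt1 a) env 1 (fun r env' => onth env' r = Some (cbrt x)).
Proof.
move=> /onth_nth0 ax n /=; rewrite ax.
by split; [exact: prefix_rcons|rewrite addn1|exact: onth_rcons_size].
Qed.

Lemma triple_test o a b x y env : onth env a = Some x -> onth env b = Some y ->
  triple (test o a b) env 1 (fun t _ => t = eval_comparison o x y).
Proof.
move=> /onth_nth0 ax /onth_nth0 bY n /=; rewrite ax bY.
by split=> //; [exact: prefix_refl|rewrite addn1].
Qed.

(** Absolute continuity enters the analysis of programs through this rule: any generic property may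
    be assumed of a drawn block, listed row by row. *)
Lemma triple_draw m env (P : (m * m).-tuple (measurableTypeR R) -> Prop) :
  absolutely_continuous mu -> generic P ->
  triple (draw m) env (m * m) (fun w env' => exists2 t, P t &
    forall i j : 'I_m, onth env' (w i.+1 j.+1) = Some t`_(i * m + j)).
Proof.
move=> ac gP n; have [A [mA A1 AP]] := generic_as ac gP.
exists A; split=> // w /AP Pw; split=> //; first exact: prefix_prefix.
exists w => // i j; rewrite !subn1/= onth_cat -addnA ltnNge leq_addr/=.
rewrite addKn onthE (nth_map 0)// size_tuple.
by case: i j => i im [j jm] /=; nia.
Qed.

(** The property of an entry must be stable under growth of the memory, since it has to survive the
    computation of the later entries. *)
Lemma triple_tabulate T (x0 : T) n (f : nat -> prog T) env (c : 'I_n -> nat)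
    (Q : 'I_n -> T -> seq R -> Prop) :
  (forall i x env1 env2, prefix env1 env2 -> Q i x env1 -> Q i x env2) ->
  (forall (i : 'I_n) env', prefix env env' -> triple (f i.+1) env' (c i) (Q i)) ->
  triple (tabulate x0 n f) env (\sum_(i < n) c i)
    (fun v env' => forall i : 'I_n, Q i (v i.+1) env').
Proof.
elim: n c Q => [|n IHn] c Q Qm tf.
  by apply: triple_ret => -[].
rewrite big_ord_recr/=.
apply: triple_bind (IHn (c \o widen_ord (leqnSn n)) (Q \o widen_ord (leqnSn n)) _ _) _ _.
- by move=> i x e1 e2; exact: Qm.
- by move=> i env' pre; exact: (tf (widen_ord (leqnSn n) i)).
- by move=> _; rewrite leq_addr.
move=> v env1 pre1 Qv; rewrite addKn.
apply: triple_bind (tf ord_max _ pre1) _ _ => // x env2 pre2 Qx.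
apply: triple_ret => i; rewrite eqSS; case: eqVneq => [ie|ine].
  by rewrite (_ : i = ord_max)//; exact: val_inj.
have iltn : (i < n)%N by rewrite ltn_neqAle ine -ltnS ltn_ord.
rewrite (_ : i = widen_ord (leqnSn n) (Ordinal iltn)); last exact: val_inj.
by apply: Qm pre2 _; exact: (Qv (Ordinal iltn)).
Qed.

End Triple.

Arguments triple_ret {R mu counted stops T x env c Q}.
Arguments triple_const {R mu counted stops i env c}.
Arguments triple_arith2 {R mu counted stops o a b x y env}.
Arguments triple_cbrt {R mu counted stops a x env}.
Arguments triple_test {R mu counted stops o a b x y env}.
Arguments triple_draw {R mu counted stops m env P}.
Arguments triple_tabulate {R mu counted stops T x0 n f env c}.

(** The budget [c] is arbitrary since [counted] is [False]: this is how a subroutine known only to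
    be correct enters. *)
Lemma triple_of_prob (R : realType) (mu : block_law R) (stops : Prop) T (p : prog T)
    env c (E : T -> seq R -> Prop) :
  prob mu p env E = 1%E -> triple mu False stops p env c E.
Proof.
move=> p1 n; have /(prob_asureP _ _ _ _ n) := p1 => /asure_prefix.
by apply: asure_mono => -[x|] env' n' [].
Qed.

Lemma prob_of_triple (R : realType) (mu : block_law R) (counted : Prop) T (p : prog T)
    env c (E : T -> seq R -> Prop) :
  triple mu counted False p env c E -> prob mu p env E = 1%E.
Proof.
move=> tp; apply/(prob_asureP _ _ _ _ 0); apply: asure_mono (tp 0%N).
by move=> -[x|] env' n' [].
Qed.

(** * Linear algebra subroutines *)

Section SparseCongruence.
Variable n : nat.

Fixpoint dot_over (l : seq 'I_n) (u v : rvec) : prog reg :=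
  if l is i :: l' then
    let* r := dot_over l' u v in
    let* t := arith2 Defs.Mul (u i.+1) (v i.+1) in
    arith2 Defs.Add r t
  else const 0.

Fixpoint nonzeros (l : seq 'I_n) (z : reg) (u : rvec) : prog (seq 'I_n) :=
  if l is i :: l' then
    let* s := nonzeros l' z u in
    let* b := test Eq (u i.+1) z in
    Ret (if b then s else i :: s)
  else Ret [::].

(** Only the first index is contracted; three calls with cyclically rotated arguments give the
    congruence. This factorization brings the price down to the number of nonzero entries of the
    matrix times n^2. *)
Definition mode_mul (N : nat -> seq 'I_n) (A : rmx) (T : rtens) : prog rtens :=
  tabulate (fun _ _ => 0%N) n (fun i => tabulate (fun _ => 0%N) n (fun j =>
    tabulate 0%N n (fun k => dot_over (N i) (A i) (fun a => T a j k)))).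

End SparseCongruence.

(* The tests for zero entries make the congruence by an elementary matrix
   cheap, while the program remains correct for every matrix. *)
Definition sparse_congr (n : nat) (A : rmx) (T : rtens) : prog rtens :=
  let* z := const 0 in
  let* N := tabulate [::] n (fun i => nonzeros (enum 'I_n) z (A i)) in
  let* T1 := mode_mul N A T in
  let* T2 := mode_mul N A (fun j k i => T1 i j k) in
  let* T3 := mode_mul N A (fun k i j => T2 j k i) in
  Ret (fun i j k => T3 k i j).

Definition matrix_mul (n : nat) (A B : rmx) : prog rmx :=
  tabulate (fun _ => 0%N) n (fun i => tabulate 0%N n (fun j =>
    dot_over (enum 'I_n) (A i) (fun k => B k j))).

(* Rows of the system are processed one by one.  The state holds a projection
   onto the common kernel of the rows seen so far, the image of a random vector
   under this projection, a solution of the equations seen so far, and their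
   rank.  Almost surely, a row depends on the previous ones if and only if it
   annihilates the image of the random vector: this test takes only O(n)
   operations, and there are at most n updates of the projection. *)
Definition elim_state : Type := rmx * rvec * rvec * nat.

Definition elim_pivot (n : nat) (z : reg) (row : rvec) (b t : reg)
    (st : elim_state) : prog elim_state :=
  let: (P, v, x, k) := st in
  let* q := tabulate 0%N n (fun j => dot_over (enum 'I_n) row (fun i => P i j)) in
  let* s := nonzeros (enum 'I_n) z q in
  if s is j :: _ then
    let* e := tabulate 0%N n (fun i => arith2 Defs.Div (P i j.+1) (q j.+1)) in
    let* P' := tabulate (fun _ => 0%N) n (fun i => tabulate 0%N n (fun l =>
      let* u := arith2 Defs.Mul (e i) (q l) in arith2 Defs.Sub (P i l) u)) in
    let* v' := tabulate 0%N n (fun i =>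
      let* u := arith2 Defs.Mul (e i) t in arith2 Defs.Sub (v i) u) in
    let* y := dot_over (enum 'I_n) row x in
    let* w := arith2 Defs.Sub b y in
    let* x' := tabulate 0%N n (fun i =>
      let* u := arith2 Defs.Mul (e i) w in arith2 Defs.Add (x i) u) in
    Ret (P', v', x', k.+1)
  else Ret st.

Fixpoint elim_rows (m n : nat) (z : reg) (A : rmx) (b : rvec) (l : seq 'I_m)
    (st : elim_state) : prog elim_state :=
  if l is i :: l' then
    let* t := dot_over (enum 'I_n) (A i.+1) st.1.1.2 in
    let* c := test Eq t z in
    if c then elim_rows n z A b l' st
    else
      let* st' := elim_pivot n z (A i.+1) (b i.+1) t st in
      elim_rows n z A b l' st'
  else Ret st.

(** The random vector is the first column of a square block, the only shape that [Draw] provides;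
    its n^2 operations fit the budget. The right-hand side may refer to the register of zero, which
    serves the rank computation. *)
Definition elimination (m n : nat) (A : rmx) (b : reg -> rvec) : prog elim_state :=
  let* z := const 0 in
  let* w := draw n in
  let* I := id_prog in
  elim_rows n z A (b z) (enum 'I_m) (I, w^~ 1%N, fun=> z, 0%N).

Definition fast_rank (m n : nat) (A : rmx) : prog nat :=
  let* st := elimination m n A (fun z _ => z) in Ret st.2.

Definition fast_solve (m n : nat) (A : rmx) (b : rvec) : prog rvec :=
  let* st := elimination m n A (fun=> b) in Ret st.1.2.

(** One solve per column costs O(n^4), affordable because the algorithm inverts a single matrix. *)
Definition solve_inv (n : nat) (A : rmx) : prog rmx :=
  let* I := id_prog in
  let* C := tabulate (fun _ => 0%N) n (fun j => fast_solve n n A (I^~ j)) in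
  Ret (fun i j => C j i).

Definition fast_linalg : linalg :=
  LinAlg sparse_congr matrix_mul solve_inv fast_rank fast_solve.

Lemma col_mulmx (R : nzRingType) m n p (A : 'M[R]_(m, n)) (B : 'M[R]_(n, p)) j :
  col j (A *m B) = A *m col j B.
Proof. by rewrite !colE mulmxA. Qed.

(** * Incremental elimination with a random test vector *)

Section Elimination.
Variables (R : realType) (n : nat).
Implicit Types (P S : 'M[R]_n) (r : 'rV[R]_n) (y : 'cV[R]_n).

(** A vector e in the column space of [P] with r e = 1. It is annihilated by the rows already
    processed, so moving along it adjusts the new equation without spoiling the old ones. The value
    0 for r P = 0 makes every update trivial. *)
Definition pivot_dir P r : 'cV[R]_n :=
  if [seq j <- enum 'I_n | (r *m P) 0 j != 0] is j :: _
  then ((r *m P) 0 j)^-1 *: col j P else 0.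

Definition elim_mx P r : 'M[R]_n := P - pivot_dir P r *m (r *m P).

Definition kernel_proj S P :=
  S *m P = 0 /\ forall y, S *m y = 0 -> P *m y = y.

Lemma mul_pivot_dir S P r : S *m P = 0 -> S *m pivot_dir P r = 0.
Proof.
move=> SP; rewrite /pivot_dir; case: (seq.filter _ _) => [|j _]; first by rewrite mulmx0.
by rewrite -scalemxAr -col_mulmx SP col0 scaler0.
Qed.

Lemma mul_pivot_dir1 P r : r *m P != 0 -> r *m pivot_dir P r = 1%:M.
Proof.
move=> rP; rewrite /pivot_dir; case E: (seq.filter _ _) => [|j s].
  case/rV0Pn: rP => j rPj; have : j \in [seq j <- enum 'I_n | (r *m P) 0 j != 0].
    by rewrite mem_filter rPj mem_enum.
  by rewrite E.
have : j \in [seq j <- enum 'I_n | (r *m P) 0 j != 0] by rewrite E mem_head.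
rewrite mem_filter => /andP[rPj _].
rewrite -scalemxAr -col_mulmx; apply/matrixP => a b.
by rewrite !ord1 !mxE eqxx/= mulVf//; move: rPj; rewrite mxE.
Qed.

Lemma elim_mx_id P r : r *m P = 0 -> elim_mx P r = P.
Proof. by move=> rP; rewrite /elim_mx rP mulmx0 subr0. Qed.

Lemma adds_mul0 S r m (B : 'M[R]_(n, m)) : (S + r)%MS *m B = 0 <-> S *m B = 0 /\ r *m B = 0.
Proof.
split=> [/sub_kermxP|[/sub_kermxP SB /sub_kermxP rB]].
  by rewrite addsmx_sub => /andP[/sub_kermxP ? /sub_kermxP ?].
by apply/sub_kermxP; rewrite addsmx_sub SB.
Qed.

(** Double annihilator: the columns of [cokermx S] lie in the kernel of [S] and are fixed by [P], so
    r P = 0 forces [r] to vanish on them. *)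
Lemma kernel_proj_sub S P r : kernel_proj S P -> (r *m P == 0) = (r <= S)%MS.
Proof.
move=> [SP Py]; apply/eqP/idP => [rP|/submxP[D ->]]; last by rewrite -mulmxA SP mulmx0.
rewrite submxE; apply/eqP/matrixP => i j; rewrite [RHS]mxE.
have Sc : S *m col j (cokermx S) = 0 by rewrite -col_mulmx mulmx_coker col0.
transitivity ((r *m col j (cokermx S)) i 0); first by rewrite -col_mulmx [RHS]mxE.
by rewrite -(Py _ Sc) mulmxA rP mul0mx mxE.
Qed.

Lemma kernel_proj_adds S P r :
  kernel_proj S P -> kernel_proj (S + r)%MS (elim_mx P r).
Proof.
move=> [SP Py]; split.
  apply/adds_mul0; split.
    by rewrite /elim_mx mulmxBr SP (mulmxA S) mul_pivot_dir// mul0mx subr0.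
  have [rP|rP] := eqVneq (r *m P) 0; first by rewrite elim_mx_id.
  by rewrite /elim_mx mulmxBr (mulmxA r) mul_pivot_dir1// mul1mx subrr.
move=> y /adds_mul0[Sy ry].
by rewrite /elim_mx mulmxBl -!mulmxA Py// ry mulmx0 subr0.
Qed.

Lemma kernel_proj_rank S P r : kernel_proj S P ->
  \rank (S + r)%MS = (\rank S + (r *m P != 0)%R)%N.
Proof.
move=> SP; rewrite (kernel_proj_sub r SP).
have [rS|rS] := boolP (r <= S)%MS.
  by rewrite addn0 (addsmx_idPl rS).
have := mxrank_sum_cap S r.
have -> : \rank (S :&: r)%MS = 0%N.
  apply/eqP; rewrite -leqn0 -ltnS ltnNge; apply: contra rS => cap1.
  apply: submx_trans (capmxSl S r).
  by rewrite -(geq_leqif (mxrank_leqif_sup (capmxSr S r))) (leq_trans (rank_leq_row r)).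
have -> : \rank r = 1%N.
  by rewrite rank_rV; case: eqP rS => // ->; rewrite sub0mx.
by rewrite addn0.
Qed.

Lemma kernel_proj0 : kernel_proj 0 1%:M.
Proof. by split=> [|y _]; rewrite ?mul0mx ?mul1mx. Qed.

(** If [r] is independent of [S], the move along the pivot direction is of the right length. If it
    is dependent, agreement with [xs] on [S] already implies agreement on [r]. *)
Lemma solution_step S P r (x xs : 'cV[R]_n) b : kernel_proj S P -> r *m xs = b ->
  S *m (xs - x) = 0 -> (S + r)%MS *m (xs - (x + pivot_dir P r *m (b - r *m x))) = 0.
Proof.
move=> SPk rb Sx; have [SP _] := SPk; rewrite opprD addrA.
have Sdir c : S *m (pivot_dir P r *m c) = 0 by rewrite mulmxA mul_pivot_dir// mul0mx.
apply/adds_mul0; split; first by rewrite mulmxBr Sx Sdir subr0.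
have [/eqP rP|rP] := eqVneq (r *m P) 0; last first.
  by rewrite mulmxBr (mulmxA r) mul_pivot_dir1// mul1mx mulmxBr rb subrr.
have /submxP[D rE] : (r <= S)%MS by rewrite -(kernel_proj_sub r SPk) rP.
by rewrite [in X in X *m _]rE -mulmxA mulmxBr Sx Sdir subr0 mulmx0.
Qed.

Variables (m : nat) (X : 'M[R]_(m, n)).

(** The projections met along the way do not depend on [g]. They are fixed before the draw, so this
    is a finite conjunction of conditions, each asking that a given nonzero linear form does not
    vanish at [g]. *)
Fixpoint separating P (l : seq 'I_m) (g : 'cV[R]_n) : Prop :=
  if l is i :: l' then
    (row i X *m P != 0 -> row i X *m P *m g != 0) /\
    separating (elim_mx P (row i X)) l' g
  else True.

Definition draw_vec (w : (n * n).-tuple (measurableTypeR R)) : 'cV[R]_n :=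
  \col_i w`_(i * n).

Lemma generic_separating P l : generic (fun w => separating P l (draw_vec w)).
Proof.
elim: l P => [|i l IHl] P /=; first exact: genericT.
apply: generic_and (IHl _); set q := row i X *m P.
have [q0|qN0] := eqVneq q 0; first by apply: genericT.
exists (fun w => (q *m draw_vec w) 0 0); split.
- under eq_fun do rewrite mxE.
  apply: polylike_sum => j; apply: polylikeM; first exact: polylike_cst.
  by under eq_fun do rewrite mxE; exact: polylike_nth.
- have /rV0Pn[j qj] := qN0.
  have n0 : (0 < n)%N by exact: leq_trans (ltn_ord j).
  (* A single 1 in row [j] of the first column: the vector read off this block is e_j, where the
     form takes the value q_j. *)
  exists [tuple ((k : nat) == j * n)%N%:R | k < n * n]; rewrite mxE (bigD1 j)//=.
  have nth_w k : (k < n * n)%N ->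
      [tuple ((k : nat) == j * n)%N%:R : R | k < n * n]`_k = (k == j * n)%N%:R.
    by move=> kn; rewrite -[k]/(val (Ordinal kn)) -tnth_nth tnth_mktuple.
  have lt_n (k : 'I_n) : (k * n < n * n)%N by rewrite ltn_pmul2r.
  rewrite big1 ?addr0 => [|k kj]; first by rewrite [draw_vec _ _ _]mxE nth_w// eqxx mulr1.
  by rewrite [draw_vec _ _ _]mxE nth_w// eqn_pmul2r// (negbTE kj : (k : nat) == j = false) mulr0.
- move=> w qw _; apply: contraNneq qw => ->; by rewrite mxE.
Qed.

End Elimination.

(** * Correctness and cost of the subroutines *)

Section ProgramSpecs.
Variables (R : realType) (mu : block_law R) (counted stops : Prop).
Local Notation triple := (triple mu counted stops).

Lemma triple_tabulate_vec n (f : nat -> prog reg) env c (x : 'I_n -> R) :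
  (forall (i : 'I_n) env', prefix env env' ->
    triple (f i.+1) env' c (fun r env2 => onth env2 r = Some (x i))) ->
  triple (tabulate 0%N n f) env (n * c)
    (fun v env' => forall i : 'I_n, onth env' (v i.+1) = Some (x i)).
Proof.
move=> tf; have := @triple_tabulate _ mu counted stops _ 0%N n f env (fun=> c)
  (fun i r env2 => onth env2 r = Some (x i)).
rewrite sum_nat_const card_ord; apply=> // i r e1 e2; exact: onth_prefix.
Qed.

Lemma triple_tabulate_mx m n (f : nat -> nat -> prog reg) env (c : 'I_m -> nat)
    (x : 'I_m -> 'I_n -> R) :
  (forall (i : 'I_m) (j : 'I_n) env', prefix env env' ->
    triple (f i.+1 j.+1) env' (c i) (fun r env2 => onth env2 r = Some (x i j))) ->
  triple (tabulate (fun _ => 0%N) m (fun i => tabulate 0%N n (f i))) env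
    (\sum_(i < m) n * c i)
    (fun v env' => forall (i : 'I_m) (j : 'I_n), onth env' (v i.+1 j.+1) = Some (x i j)).
Proof.
move=> tf; apply: (triple_tabulate (fun i v env2 =>
  forall j : 'I_n, onth env2 (v j.+1) = Some (x i j))) => [i v e1 e2 pre H j|i e pre].
  exact: onth_prefix pre (H j).
by apply: triple_tabulate_vec => j e' pre'; apply: tf; exact: prefix_trans pre'.
Qed.

Lemma triple_dot_over n (l : seq 'I_n) (u v : rvec) env (x y : 'I_n -> R) :
  (forall i : 'I_n, onth env (u i.+1) = Some (x i)) ->
  (forall i : 'I_n, onth env (v i.+1) = Some (y i)) ->
  triple (dot_over l u v) env (2 * size l)
    (fun r env' => onth env' r = Some (\sum_(i <- l) x i * y i)).
Proof.
move=> ux vy; elim: l => [|i l IHl].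
  by apply: triple_post triple_const _ => r e _; rewrite big_nil.
apply: triple_bind IHl _ _ => [_|r e1 pre1 Hr]; first by rewrite leq_mul.
apply: triple_bind (triple_arith2 (onth_prefix pre1 (ux i))
  (onth_prefix pre1 (vy i)) _) _ _ => // [_|t e2 pre2 Ht]; first by rewrite /=; lia.
apply: triple_weaken (triple_arith2 (onth_prefix pre2 Hr) Ht _) _ _ => //.
  by move=> _ /=; lia.
by move=> s e3 _ ->; rewrite big_cons addrC.
Qed.

Lemma triple_dot n (u v : rvec) env (x y : 'I_n -> R) :
  (forall i : 'I_n, onth env (u i.+1) = Some (x i)) ->
  (forall i : 'I_n, onth env (v i.+1) = Some (y i)) ->
  triple (dot_over (enum 'I_n) u v) env (2 * n)
    (fun r env' => onth env' r = Some (\sum_(i < n) x i * y i)).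
Proof.
move=> ux vy; apply: triple_weaken (triple_dot_over _ ux vy) _ _.
  by rewrite size_enum_ord.
by move=> r e _ ->; rewrite big_enum.
Qed.

Lemma triple_nonzeros n (l : seq 'I_n) z (u : rvec) env (x : 'I_n -> R) :
  onth env z = Some 0 -> (forall i : 'I_n, onth env (u i.+1) = Some (x i)) ->
  triple (nonzeros l z u) env (size l)
    (fun s env' => s = [seq i <- l | x i != 0]).
Proof.
move=> z0 ux; elim: l => [|i l IHl]; first exact: triple_ret.
apply: triple_bind IHl _ _ => [_ //=|s e1 pre1 ->].
apply: triple_bind (triple_test (onth_prefix pre1 (ux i)) (onth_prefix pre1 z0)) _ _.
  by move=> _ /=; lia.
by move=> b e2 _ -> /=; apply: triple_ret; case: eqP.
Qed.

Definition nnz n (X : 'M[R]_n) : nat := (\sum_(i < n) \sum_(j < n) (X i j != 0)%R)%N.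

Lemma triple_mode_mul n N A T env (X : 'M[R]_n) (Y : tensor R n) :
  (forall i : 'I_n, N i.+1 = [seq j <- enum 'I_n | X i j != 0]) ->
  holds_mx env A X -> holds_tensor env T Y ->
  triple (mode_mul N A T) env (2 * nnz X * n ^ 2)
    (fun T' env' => holds_tensor env' T' (fun i j k => \sum_(a < n) X i a * Y a j k)).
Proof.
move=> NX AX TY; pose c (i : 'I_n) := (n * (n * (2 * \sum_(j < n) (X i j != 0)%R)))%N.
apply: (triple_cost (c := \sum_(i < n) c i)) => [|_]; last first.
  rewrite /c /nnz -big_distrr -big_distrr -big_distrr /=; set s := bigop _ _ _.
  by rewrite -mulnn; nia.
apply: (triple_tabulate (fun i v env2 => forall j k : 'I_n,
  onth env2 (v j.+1 k.+1) = Some (\sum_(a < n) X i a * Y a j k))).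
  by move=> i v e1 e2 pre H j k; exact: onth_prefix pre (H j k).
move=> i e pre.
have := @triple_tabulate_mx n n (fun j k => dot_over (N i.+1) (A i.+1)
  (fun a => T a j k)) e (fun=> 2 * \sum_(j < n) (X i j != 0)%R)%N
  (fun j k => \sum_(a < n) X i a * Y a j k).
rewrite sum_nat_const card_ord; apply=> j k e' pre'.
have pre2 := prefix_trans pre pre'.
apply: triple_weaken (triple_dot_over _ (fun a => onth_prefix pre2 (AX i a))
  (fun a => onth_prefix pre2 (TY a j k))) _ _.
  move=> _; rewrite NX size_filter -sum1_count big_enum_cond/= big_mkcond/=.
  by rewrite leq_mul2l/=; apply: leq_sum => a _; case: (X i a != 0)%R.
move=> r e2 _ ->; rewrite NX big_filter big_enum_cond/= big_mkcond/=.
congr Some; apply: eq_bigr => a _; by case: eqP => //= ->; rewrite mul0r.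
Qed.

(** Three contractions at 2 [nnz X] n^2 each; the summand [n] pays for the n^2 tests for zero. *)
Lemma triple_sparse_congr n A T env (X : 'M[R]_n) (Y : tensor R n) :
  holds_mx env A X -> holds_tensor env T Y ->
  triple (sparse_congr n A T) env (6 * (nnz X + n) * n ^ 2)
    (fun T' env' => holds_tensor env' T' (congr_tensor X Y)).
Proof.
move=> AX TY; apply: triple_bind (triple_const (c := 0)) _ _ => // z e1 pre1 Hz.
have tN := @triple_tabulate _ mu counted stops _ [::] n
  (fun i => nonzeros (enum 'I_n) z (A i)) e1 (fun=> n)
  (fun i s _ => s = [seq j <- enum 'I_n | X i j != 0]).
apply: (triple_bind (c1 := n * n) (Q1 := fun N e => forall i : 'I_n,
   N i.+1 = [seq j <- enum 'I_n | X i j != 0])) => //.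
- rewrite sum_nat_const card_ord in tN; apply: tN => // i e' pre'.
  have pre := prefix_trans pre1 pre'.
  apply: triple_cost (triple_nonzeros _ (onth_prefix pre' Hz)
    (fun j => onth_prefix pre (AX i j))) _.
  by rewrite size_enum_ord.
- by move=> _; rewrite expnS expn1; nia.
move=> N e2 pre2 HN; have pre02 := prefix_trans pre1 pre2.
have AX2 : holds_mx e2 A X by move=> i j; exact: onth_prefix pre02 (AX i j).
have TY2 : holds_tensor e2 T Y by move=> i j k; exact: onth_prefix pre02 (TY i j k).
apply: triple_bind (triple_mode_mul HN AX2 TY2) _ _.
  by move=> _; rewrite -mulnn; nia.
move=> T1 e3 pre3 HT1.
have AX3 : holds_mx e3 A X by move=> i j; exact: onth_prefix pre3 (AX2 i j).
apply: triple_bind (triple_mode_mul HN AX3 (fun j k i => HT1 i j k)) _ _.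
  by move=> _; rewrite -mulnn; nia.
move=> T2 e4 pre4 HT2.
have AX4 : holds_mx e4 A X by move=> i j; exact: onth_prefix pre4 (AX3 i j).
apply: triple_bind (triple_mode_mul HN AX4 (fun k i j => HT2 j k i)) _ _.
  by move=> _; rewrite -mulnn; nia.
move=> T3 e5 pre5 HT3; apply: triple_ret => i j k; rewrite HT3; congr Some.
rewrite /congr_tensor; under [RHS]eq_bigr do rewrite exchange_big/=.
rewrite [RHS]exchange_big/=; apply: eq_bigr => c _.
rewrite [RHS]exchange_big/= big_distrr/=; apply: eq_bigr => b _.
by rewrite !big_distrr/=; apply: eq_bigr => a _; ring.
Qed.

Lemma triple_matrix_mul n A B env (X Y : 'M[R]_n) :
  holds_mx env A X -> holds_mx env B Y ->
  triple (matrix_mul n A B) env (2 * n ^ 3) (fun C env' => holds_mx env' C (X *m Y)).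
Proof.
move=> AX BY; apply: (triple_cost (c := \sum_(i < n) n * (2 * n))).
  apply: triple_tabulate_mx => i j e pre.
  apply: triple_post (triple_dot (fun k => onth_prefix pre (AX i k))
    (fun k => onth_prefix pre (BY k j))) _.
  by move=> r e' _ ->; rewrite mxE.
by move=> _; rewrite sum_nat_const card_ord !expnS; nia.
Qed.

End ProgramSpecs.

Arguments triple_tabulate_vec {R mu counted stops n f env c x}.
Arguments triple_tabulate_mx {R mu counted stops m n f env c x}.
Arguments triple_dot {R mu counted stops n u v env x y}.
Arguments triple_nonzeros {R mu counted stops n l z u env x}.
Arguments triple_sparse_congr {R mu counted stops n A T env X Y}.
Arguments triple_matrix_mul {R mu counted stops n A B env X Y}.

Lemma mul_cV_11 (R : pzSemiRingType) n (y : 'cV[R]_n) (c : 'M[R]_1) i :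
  (y *m c) i 0 = y i 0 * c 0 0.
Proof. by rewrite mxE big_ord1. Qed.

Lemma mxB_E (R : pzRingType) m n (A B : 'M[R]_(m, n)) i j :
  (A - B) i j = A i j - B i j.
Proof. by rewrite !mxE. Qed.

Section EliminationSpec.
Variables (R : realType) (mu : block_law R) (counted stops : Prop).
Hypothesis ac : absolutely_continuous mu.
Local Notation triple := (triple mu counted stops).

Lemma triple_id_prog env c : triple id_prog env c
  (fun I env' => forall i j : nat, onth env' (I i j) = Some (i == j)%:R).
Proof.
apply: triple_bind (triple_const (c := 0)) _ _ => // z e1 pre1 Hz.
apply: triple_bind (triple_const (c := 0)) _ _ => // o e2 pre2 Ho.
apply: triple_ret => i j; case: eqP => _; first by rewrite Ho.
exact: onth_prefix pre2 Hz.
Qed.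

Lemma holds_mx_prefix (env env' : seq R) m n A (X : 'M[R]_(m, n)) :
  prefix env env' -> holds_mx env A X -> holds_mx env' A X.
Proof. by move=> pre H i j; exact: onth_prefix pre (H i j). Qed.

Lemma holds_vec_prefix (env env' : seq R) n v (x : 'cV[R]_n) :
  prefix env env' -> holds_vec env v x -> holds_vec env' v x.
Proof. by move=> pre H i; exact: onth_prefix pre (H i). Qed.

Lemma holds_tensor_prefix (env env' : seq R) n T (Y : tensor R n) :
  prefix env env' -> holds_tensor env T Y -> holds_tensor env' T Y.
Proof. by move=> pre H i j k; exact: onth_prefix pre (H i j k). Qed.

Definition holds_state n (env : seq R) (st : elim_state) (P : 'M[R]_n)
    (v x : 'cV[R]_n) (k : nat) : Prop :=
  [/\ holds_mx env st.1.1.1 P, holds_vec env st.1.1.2 v,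
      holds_vec env st.1.2 x & st.2 = k].

Lemma holds_state_prefix n (env env' : seq R) st (P : 'M[R]_n) v x k :
  prefix env env' -> holds_state env st P v x k -> holds_state env' st P v x k.
Proof.
move=> pre [HP Hv Hx Hk]; split=> //; [exact: holds_mx_prefix pre _|
  exact: holds_vec_prefix pre _|exact: holds_vec_prefix pre _].
Qed.

Definition pivot_cost n := (4 * n ^ 2 + 8 * n + 1)%N.

Lemma triple_elim_pivot n env z row b t st (P : 'M[R]_n) v x k (r : 'rV[R]_n) beta :
  onth env z = Some 0 -> (forall j : 'I_n, onth env (row j.+1) = Some (r 0 j)) ->
  onth env b = Some beta -> onth env t = Some ((r *m v) 0 0) ->
  holds_state env st P v x k -> r *m P != 0 ->
  triple (elim_pivot n z row b t st) env (pivot_cost n)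
    (fun st' env' => holds_state env' st' (elim_mx P r)
      (v - pivot_dir P r *m (r *m v))
      (x + pivot_dir P r *m (beta%:M - r *m x)) k.+1).
Proof.
move=> Hz Hr Hb Ht; case: st => [[[Pr vr] xr] kr] [/= HP Hv Hx ->] rP.
(* One summand per instruction: q, its tests for zero, e, the new projection, the new v, the product
   of the row with x, the residual, the new x. *)
apply: (triple_cost (c := n * (2 * n) + (n + (n * 1 + (n * n * 2 + (n * 2 + (2 * n +
  (1 + (n * 2 + 0))))))))); last first.
  by move=> _; rewrite /pivot_cost !expnS expn0 muln1 !mulnA; clear; lia.
have tq : triple (tabulate 0%N n (fun j => dot_over (enum 'I_n) row (fun i => Pr i j)))
    env (n * (2 * n)) (fun q env' =>
      forall j : 'I_n, onth env' (q j.+1) = Some ((r *m P) 0 j)).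
  apply: triple_tabulate_vec => j e pre.
  apply: triple_post (triple_dot (fun i => onth_prefix pre (Hr i))
    (fun i => onth_prefix pre (HP i j))) _.
  by move=> s e' _ ->; rewrite mxE.
apply: triple_seq tq _ => q e1 pre1 Hq.
have tz := triple_nonzeros (l := enum 'I_n) (mu := mu) (counted := counted)
  (stops := stops) (onth_prefix pre1 Hz) Hq.
rewrite size_enum_ord in tz; apply: triple_seq tz _ => s e2 pre2 ->.
have dirE : pivot_dir P r = if [seq j <- enum 'I_n | (r *m P) 0 j != 0] is j :: _
  then ((r *m P) 0 j)^-1 *: col j P else 0 by [].
case E: [seq _ <- _ | _] => [|j s'].
  case/rV0Pn: rP => j rPj; have : j \in [seq j <- enum 'I_n | (r *m P) 0 j != 0].
    by rewrite mem_filter rPj mem_enum.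
  by rewrite E.
have : j \in [seq j <- enum 'I_n | (r *m P) 0 j != 0] by rewrite E mem_head.
rewrite mem_filter => /andP[qj _].
rewrite {}E in dirE.
have pre02 := prefix_trans pre1 pre2.
have {}Hq : forall i : 'I_n, onth e2 (q i.+1) = Some ((r *m P) 0 i).
  by move=> i; exact: onth_prefix pre2 (Hq i).
have {}HP := holds_mx_prefix pre02 HP; have {}Hv := holds_vec_prefix pre02 Hv.
have {}Hx := holds_vec_prefix pre02 Hx; have {}Hb := onth_prefix pre02 Hb.
have {}Ht := onth_prefix pre02 Ht.
have {}Hr : forall i : 'I_n, onth e2 (row i.+1) = Some (r 0 i).
  by move=> i; exact: onth_prefix pre02 (Hr i).
have te : triple (tabulate 0%N n (fun i => arith2 Defs.Div (Pr i j.+1) (q j.+1)))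
    e2 (n * 1) (fun e env' =>
      forall i : 'I_n, onth env' (e i.+1) = Some (pivot_dir P r i 0)).
  apply: triple_tabulate_vec => i e pre.
  apply: triple_post (triple_arith2 (onth_prefix pre (HP i j)) (onth_prefix pre (Hq j)) _) _.
    by [].
  by move=> a e' _ ->; rewrite dirE !mxE mulrC.
apply: triple_seq te _ => e e3 pre3 He.
have {}HP := holds_mx_prefix pre3 HP; have {}Hv := holds_vec_prefix pre3 Hv.
have {}Hx := holds_vec_prefix pre3 Hx; have {}Hb := onth_prefix pre3 Hb.
have {}Ht := onth_prefix pre3 Ht.
have {}Hr : forall i : 'I_n, onth e3 (row i.+1) = Some (r 0 i).
  by move=> i; exact: onth_prefix pre3 (Hr i).
have {}Hq : forall i : 'I_n, onth e3 (q i.+1) = Some ((r *m P) 0 i).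
  by move=> i; exact: onth_prefix pre3 (Hq i).
have tP : triple (tabulate (fun _ => 0%N) n (fun i => tabulate 0%N n (fun l =>
      let* u := arith2 Defs.Mul (e i) (q l) in arith2 Defs.Sub (Pr i l) u)))
    e3 (n * n * 2)
    (fun P' env' => forall i l : 'I_n, onth env' (P' i.+1 l.+1) = Some (elim_mx P r i l)).
  have -> : (n * n * 2 = \sum_(i < n) n * 2)%N by rewrite sum_nat_const card_ord mulnA.
  apply: triple_tabulate_mx => i l e' pre.
  apply: triple_bind (triple_arith2 (onth_prefix pre (He i)) (onth_prefix pre (Hq l)) _) _ _ => //.
  move=> u e'' pre' Hu.
  apply: triple_post (triple_arith2 (onth_prefix (prefix_trans pre pre') (HP i l)) Hu _) _ => //.
  by move=> a e4 _ ->; rewrite !mxE big_ord1 mxE.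
have upd (op : arith) (y : rvec) (w : reg) (yv : 'cV[R]_n) (wv : R) e0 :
    op <> Defs.Div -> prefix e3 e0 -> holds_vec e0 y yv -> onth e0 w = Some wv ->
    triple (tabulate 0%N n (fun i =>
      let* u := arith2 Defs.Mul (e i) w in arith2 op (y i) u)) e0 (n * 2)
    (fun y' env' => forall i : 'I_n, onth env' (y' i.+1) =
      Some (arith_value op (yv i 0) (pivot_dir P r i 0 * wv))).
  move=> opD pre0 Hy Hw; apply: triple_tabulate_vec => i e' pre.
  apply: triple_bind (triple_arith2 (onth_prefix (prefix_trans pre0 pre) (He i))
    (onth_prefix pre Hw) _) _ _ => // u e'' pre' Hu.
  by apply: triple_arith2 (onth_prefix (prefix_trans pre pre') (Hy i)) Hu _.
apply: triple_seq tP _ => P' e4 pre4 HP'.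
apply: triple_seq (upd Defs.Sub _ _ _ _ _ _ pre4 (holds_vec_prefix pre4 Hv)
  (onth_prefix pre4 Ht)) _ => // v' e5 pre5 Hv'.
have pre35 := prefix_trans pre4 pre5.
apply: triple_seq (triple_dot (fun i => onth_prefix pre35 (Hr i))
  (fun i => onth_prefix pre35 (Hx i))) _ => y e6 pre6 Hy.
have pre36 := prefix_trans pre35 pre6.
apply: triple_seq (triple_arith2 (onth_prefix pre36 Hb) Hy _) _ => // w e7 pre7 Hw.
have pre37 := prefix_trans pre36 pre7.
apply: triple_seq (upd Defs.Add _ _ _ _ _ _ pre37 (holds_vec_prefix pre37 Hx) Hw) _ => //.
move=> x' e8 pre8 Hx'; have pre48 := prefix_trans (prefix_trans pre5 pre6) (prefix_trans pre7 pre8).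
apply: triple_ret; split=> /=.
- by move=> i l; exact: onth_prefix pre48 (HP' i l).
- move=> i; rewrite (onth_prefix (prefix_trans pre6 (prefix_trans pre7 pre8)) (Hv' i)).
  by congr Some; rewrite /= mxB_E mul_cV_11.
- move=> i; rewrite Hx' /= [in RHS]mxE mul_cV_11 mxB_E.
  have -> : (beta%:M : 'M[R]_1) 0 0 = beta by rewrite mxE eqxx mulr1n.
  by rewrite [(r *m x) 0 0]mxE.
- by [].
Qed.

Definition span_rows m n (X : 'M[R]_(m, n)) (S : 'M[R]_n) (l : seq 'I_m) : 'M[R]_n :=
  foldl (fun S i => (S + row i X)%MS) S l.

Lemma span_rows_sup m n (X : 'M[R]_(m, n)) S l :
  (S <= span_rows X S l)%MS /\ (forall i, i \in l -> (row i X <= span_rows X S l)%MS).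
Proof.
elim: l S => [|i l IHl] S /=; first by rewrite submx_refl.
have [SS rS] := IHl (S + row i X)%MS.
split=> [|j]; first exact: submx_trans (addsmxSl _ _) SS.
rewrite inE => /predU1P[->|/rS//]; exact: submx_trans (addsmxSr _ _) SS.
Qed.

Lemma span_rows_sub m n (X : 'M[R]_(m, n)) S l : (span_rows X S l <= S + X)%MS.
Proof.
elim: l S => [|i l IHl] S /=; first exact: addsmxSl.
apply: submx_trans (IHl _) _.
by rewrite !addsmx_sub addsmxSl addsmxSr (submx_trans (row_sub i X) (addsmxSr S X)).
Qed.

Lemma span_rows_all m n (X : 'M[R]_(m, n)) : (span_rows X 0 (enum 'I_m) :=: X)%MS.
Proof.
apply/eqmxP/andP; split.
  by apply: submx_trans (span_rows_sub _ _ _) _; rewrite addsmx_sub sub0mx submx_refl.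
apply/row_subP => i; have [_] := span_rows_sup X 0 (enum 'I_m); apply.
by rewrite mem_enum.
Qed.

(** Every update raises the rank of [S], so at most [n - \rank S] of them are still to come. The
    invariant on [x] is quantified over all solutions [xs]: it is void for inconsistent systems, for
    which the rank is still correct. *)
Lemma triple_elim_rows m n env z A b (l : seq 'I_m) st (X : 'M[R]_(m, n)) bv
    (g : 'cV[R]_n) P S x :
  onth env z = Some 0 -> holds_mx env A X -> holds_vec env b bv ->
  holds_state env st P (P *m g) x (\rank S) ->
  kernel_proj S P -> separating X P l g ->
  (forall xs, X *m xs = bv -> S *m (xs - x) = 0) ->
  triple (elim_rows n z A b l st) env
    (size l * (2 * n + 1) + (n - \rank S) * pivot_cost n)
    (fun st' env' => exists x', [/\ holds_vec env' st'.1.2 x',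
      st'.2 = \rank (span_rows X S l) &
      forall xs, X *m xs = bv -> span_rows X S l *m (xs - x') = 0]).
Proof.
elim: l env st P S x => [|i l IHl] env st P S x Hz HA Hb Hst SP sep sol.
  by apply: triple_ret; exists x; case: Hst.
move: sep => [sepi sepl]; set r := row i X in sepi sepl *.
have Hr (j : 'I_n) : onth env (A i.+1 j.+1) = Some (r 0 j) by rewrite mxE.
have [_ Hv _ _] := Hst.
have rgE : \sum_(j < n) r 0 j * (P *m g) j 0 = (r *m (P *m g)) 0 0 by rewrite mxE.
apply: triple_bind (triple_dot Hr Hv) _ _ => [_|t e1 pre1]; first by rewrite /=; lia.
rewrite rgE => Ht.
apply: triple_bind (triple_test Ht (onth_prefix pre1 Hz)) _ _ => [_|c e2 pre2 ->].
  by rewrite /=; lia.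
have pre := prefix_trans pre1 pre2.
have {}Hz := onth_prefix pre Hz; have {}HA := holds_mx_prefix pre HA.
have {}Hb := holds_vec_prefix pre Hb; have {}Hst := holds_state_prefix pre Hst.
have {}Hr (j : 'I_n) : onth e2 (A i.+1 j.+1) = Some (r 0 j).
  exact: onth_prefix pre (Hr j).
have {}Ht := onth_prefix pre2 Ht.
have SPr := kernel_proj_adds r SP; have rkr := kernel_proj_rank r SP.
have step xs : X *m xs = bv ->
    (S + r)%MS *m (xs - (x + pivot_dir P r *m ((bv i 0)%:M - r *m x))) = 0.
  move=> Xxs; apply: solution_step SP _ (sol _ Xxs).
  by rewrite -row_mul Xxs; apply/matrixP => a j; rewrite !ord1 !mxE.
have rPg : r *m (P *m g) = ((r *m (P *m g)) 0 0)%:M by exact: mx11_scalar.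
rewrite [eval_comparison _ _ _]/=.
have [rP|rP] := eqVneq (r *m P) 0.
  rewrite {1}mulmxA rP mul0mx mxE eqxx.
  have dir0 : pivot_dir P r = 0.
    rewrite /pivot_dir rP (eq_filter (a2 := pred0)) ?filter_pred0//.
    by move=> j; rewrite mxE eqxx.
  rewrite (elim_mx_id rP) in sepl SPr; rewrite rP eqxx addn0 in rkr.
  apply: triple_cost (IHl e2 st P (S + r)%MS x Hz HA Hb _ SPr sepl _) _.
  - by rewrite rkr.
  - by move=> xs /step; rewrite dir0 mul0mx addr0.
  - by move=> _; rewrite rkr /=; lia.
have rg : r *m P *m g != 0 by exact: sepi.
have rg0 : (r *m (P *m g)) 0 0 != 0.
  apply: contraNneq rg => rg0; rewrite -mulmxA rPg rg0.
  by apply/eqP/matrixP => a j; rewrite !mxE mul0rn.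
rewrite (negbTE rg0); rewrite rP addn1 in rkr.
have rkn : (\rank S < n)%N by rewrite -rkr rank_leq_row.
apply: triple_bind (triple_elim_pivot Hz Hr (Hb i) Ht Hst rP) _ _.
  move=> _; apply: (@leq_trans ((n - \rank S) * pivot_cost n)); last by rewrite /=; lia.
  by rewrite leq_pmull// subn_gt0.
move=> st' e3 pre3 Hst'.
apply: triple_cost (IHl e3 st' (elim_mx P r) (S + r)%MS _ (onth_prefix pre3 Hz)
  (holds_mx_prefix pre3 HA) (holds_vec_prefix pre3 Hb) _ SPr sepl step) _.
  rewrite rkr; have -> // : elim_mx P r *m g = P *m g - pivot_dir P r *m (r *m (P *m g)).
  by rewrite /elim_mx mulmxBl !mulmxA.
move=> _; rewrite rkr /= -(subnSK rkn); nia.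
Qed.

Definition elim_cost m n := (n * n + m * (2 * n + 1) + n * pivot_cost n)%N.

Lemma triple_elimination m n env A b (X : 'M[R]_(m, n)) bv :
  holds_mx env A X ->
  (forall z env', prefix env env' -> onth env' z = Some 0 -> holds_vec env' (b z) bv) ->
  triple (elimination m n A b) env (elim_cost m n)
    (fun st env' => exists x', [/\ holds_vec env' st.1.2 x', st.2 = \rank X &
      forall xs, X *m xs = bv -> X *m (xs - x') = 0]).
Proof.
move=> HA Hb; apply: triple_bind (triple_const (c := 0)) _ _ => // z e1 pre1 Hz.
apply: triple_bind (triple_draw ac (generic_separating X 1%:M (enum 'I_m))) _ _.
  by move=> _; rewrite /elim_cost; lia.
move=> w e2 pre2 [t sep Hw].
apply: triple_bind (triple_id_prog _ 0) _ _ => // I e3 pre3 HI.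
have pre13 := prefix_trans pre2 pre3; have pre03 := prefix_trans pre1 pre13.
have Hz3 := onth_prefix pre13 Hz.
have E := span_rows_all X.
apply: triple_weaken (triple_elim_rows (S := 0) (x := 0) (P := 1%:M)
  Hz3 (holds_mx_prefix pre03 HA) (Hb z e3 pre03 Hz3) _ (kernel_proj0 R n) sep _) _ _.
- split=> /=; last by rewrite mxrank0.
  + by move=> i j; rewrite HI mxE eqSS.
  + rewrite mul1mx => i; rewrite mxE.
    have n0 : (0 < n)%N by exact: leq_trans (ltn_ord i).
    by rewrite (onth_prefix pre3 (Hw i (Ordinal n0))) addn0.
  + by move=> i; rewrite Hz3 mxE.
- by move=> xs _; rewrite mul0mx.
- by move=> _; rewrite size_enum_ord mxrank0 /elim_cost; nia.
move=> st e4 _ [x' [Hx' -> sol]]; exists x'; rewrite E; split=> // xs /sol H.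
by apply/sub_kermxP; rewrite -E; apply/sub_kermxP.
Qed.

End EliminationSpec.

(** The interface between the subroutines and the algorithm. With [counted] [False] the prices are
    void and any correct library satisfies it. The price of a congruence depends on the number of
    nonzero entries, which separates elementary from dense matrices. *)
Record linalg_spec (R : realType) (mu : block_law R) (counted stops : Prop)
    (K : nat) (L : linalg) : Prop := LinAlgSpec {
  spec_congr : forall (env : seq R) (n : nat) A T (X : 'M[R]_n) (Y : tensor R n),
    holds_mx env A X -> holds_tensor env T Y ->
    triple mu counted stops (la_congr L n A T) env (K * (nnz X + n) * n ^ 2)
      (fun T' env' => holds_tensor env' T' (congr_tensor X Y));
  spec_mul : forall (env : seq R) (n : nat) A B (X Y : 'M[R]_n),
    holds_mx env A X -> holds_mx env B Y ->
    triple mu counted stops (la_mul L n A B) env (K * n ^ 3)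
      (fun C env' => holds_mx env' C (X *m Y));
  spec_inv : forall (env : seq R) (n : nat) A (X : 'M[R]_n),
    holds_mx env A X -> X \in unitmx ->
    triple mu counted stops (la_inv L n A) env (K * n ^ 4)
      (fun C env' => holds_mx env' C (invmx X));
  spec_rank : forall (env : seq R) (m n : nat) A (X : 'M[R]_(m, n)),
    holds_mx env A X ->
    triple mu counted stops (la_rank L m n A) env (K * (m * n.+1 + n ^ 3))
      (fun r _ => r = \rank X);
  spec_solve : forall (env : seq R) (m n : nat) A b (X : 'M[R]_(m, n)) (x : 'cV[R]_n),
    holds_mx env A X -> holds_vec env b (X *m x) -> \rank X = n ->
    triple mu counted stops (la_solve L m n A b) env (K * (m * n.+1 + n ^ 3))
      (fun v env' => holds_vec env' v x) }.

Lemma linalg_correct_spec (R : realType) (mu : block_law R) (stops : Prop) K L :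
  linalg_correct mu L -> linalg_spec mu False stops K L.
Proof.
move=> [Lcongr Lmul Linv Lrank Lsolve]; split=> *; apply: triple_of_prob.
- exact: Lcongr.
- exact: Lmul.
- exact: Linv.
- exact: Lrank.
- exact: Lsolve.
Qed.

Lemma spec_linalg_correct (R : realType) (mu : block_law R) (counted : Prop) K L :
  linalg_spec mu counted False K L -> linalg_correct mu L.
Proof.
move=> [Lcongr Lmul Linv Lrank Lsolve]; split=> *; apply: prob_of_triple.
- exact: Lcongr.
- exact: Lmul.
- exact: Linv.
- exact: Lrank.
- exact: Lsolve.
Qed.

Lemma elim_cost_le m n : (elim_cost m n <= 20 * (m * n.+1 + n ^ 3))%N.
Proof.
have h1 : (n <= n * n)%N by case: n => // k; rewrite leq_pmulr.
have h2 : (n * n <= n * n * n)%N by case: n h1 => // k _; rewrite leq_pmulr.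
rewrite /elim_cost /pivot_cost !expnS expn0 !muln1 !mulnA; lia.
Qed.

Section FastLinalg.
Variables (R : realType) (mu : block_law R) (counted stops : Prop).
Hypothesis ac : absolutely_continuous mu.
Local Notation triple := (triple mu counted stops).

Lemma triple_fast_rank m n env A (X : 'M[R]_(m, n)) : holds_mx env A X ->
  triple (fast_rank m n A) env (elim_cost m n) (fun r _ => r = \rank X).
Proof.
move=> HA.
apply: triple_bind (triple_elimination (b := fun z _ => z) (bv := 0) counted stops ac HA _) _ _.
- by move=> z e _ Hz i; rewrite Hz mxE.
- by [].
by move=> st e _ [x' [_ -> _]]; exact: triple_ret.
Qed.

Lemma triple_fast_solve m n env A b (X : 'M[R]_(m, n)) (x : 'cV[R]_n) :
  holds_mx env A X -> holds_vec env b (X *m x) -> \rank X = n ->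
  triple (fast_solve m n A b) env (elim_cost m n)
    (fun v env' => holds_vec env' v x).
Proof.
move=> HA Hb rX.
apply: triple_bind (triple_elimination (b := fun=> b) (bv := X *m x) counted stops ac HA _) _ _.
- by move=> z e pre _; exact: holds_vec_prefix pre Hb.
- by [].
move=> st e _ [x' [Hx' _ /(_ x erefl) Xx]]; apply: triple_ret.
have /row_fullP[B BX] : row_full X by rewrite /row_full rX.
suff -> : x = x' by [].
by apply/eqP; rewrite -subr_eq0 -[x - x']mul1mx -BX -mulmxA Xx mulmx0.
Qed.

Lemma triple_solve_inv n env A (X : 'M[R]_n) :
  holds_mx env A X -> X \in unitmx ->
  triple (solve_inv n A) env (60 * n ^ 4) (fun C env' => holds_mx env' C (invmx X)).
Proof.
move=> HA uX; apply: triple_bind (triple_id_prog _ _ _ _ 0) _ _ => // I e1 pre1 HI.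
have := @triple_tabulate _ mu counted stops _ (fun _ => 0%N) n
  (fun j => fast_solve n n A (I^~ j)) e1 (fun=> elim_cost n n)
  (fun j v e => holds_vec e v (col j (invmx X))) _ _.
rewrite sum_nat_const card_ord => tC.
apply: triple_bind (tC _ _) _ _.
- by move=> j v e1' e2' pre; exact: holds_vec_prefix.
- move=> j e2 pre2; have pre := prefix_trans pre1 pre2.
  apply: triple_fast_solve; first exact: holds_mx_prefix pre HA.
    move=> i; rewrite -col_mulmx mulmxV// !mxE.
    by rewrite (onth_prefix pre2 (HI _ _)) eqSS.
  by rewrite mxrank_unit.
(* Each of the [n] systems costs at most 20 (n (n + 1) + n^3), hence at most 60 n^3: the origin of
   the constant 60. *)
- move=> _; apply: leq_trans (leq_mul (leqnn n) (elim_cost_le n n)) _.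
  have h1 : (n <= n * n)%N by case: (n) => // k; rewrite leq_pmulr.
  rewrite !expnS expn0 !muln1 mulnA; set a := (n * n)%N in h1 *; nia.
move=> C e2 pre2 HC; apply: triple_ret => i j.
by rewrite (HC j i) mxE.
Qed.

Lemma fast_linalg_spec : linalg_spec mu counted stops 60 fast_linalg.
Proof.
split=> [env n A T X Y HA HT|env n A B X Y HA HB|env n A X HA uX|env m n A X HA
  |env m n A b X x HA Hb rX].
- apply: triple_cost (triple_sparse_congr HA HT) _ => _.
  by rewrite !leq_mul2r orbC/=; nia.
- apply: triple_cost (triple_matrix_mul HA HB) _ => _.
  by rewrite leq_mul2r orbT.
- exact: triple_solve_inv HA uX.
- apply: triple_cost (triple_fast_rank HA) _ => _.
  by apply: leq_trans (elim_cost_le m n) _; rewrite leq_mul2r orbT.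
- apply: triple_cost (triple_fast_solve HA Hb rX) _ => _.
  by apply: leq_trans (elim_cost_le m n) _; rewrite leq_mul2r orbT.
Qed.

End FastLinalg.

(** * Tensors and block matrices *)

Section Skew.
Variables (R : realType) (d : nat).
Implicit Types (A B : 'M[R]_d) (T : tensor R d) (u v w : 'rV[R]_d).

Lemma congr_tensor_mul A B T :
  congr_tensor (A *m B) T = congr_tensor A (congr_tensor B T).
Proof.
apply/funext => i; apply/funext => j; apply/funext => k; rewrite /congr_tensor.
transitivity (\sum_(a < d) \sum_(b < d) \sum_(c < d) \sum_(x < d) \sum_(y < d)
    \sum_(z < d) T a b c * B x a * B y b * B z c * (A i x * A j y * A k z)).
  apply: eq_bigr => a _; apply: eq_bigr => b _; apply: eq_bigr => c _.
  rewrite !mxE -!mulrA [X in _ * X]big_distrl/= big_distrr/=; apply: eq_bigr => x _.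
  rewrite [X in _ * (_ * X)]big_distrl/= !big_distrr/=; apply: eq_bigr => y _.
  by rewrite !big_distrr/=; apply: eq_bigr => z _; ring.
transitivity (\sum_(x < d) \sum_(y < d) \sum_(z < d) \sum_(a < d) \sum_(b < d)
    \sum_(c < d) T a b c * B x a * B y b * B z c * (A i x * A j y * A k z)).
  under eq_bigr do (under eq_bigr do rewrite exchange_big/=).
  under eq_bigr do rewrite exchange_big/=.
  rewrite exchange_big/=; apply: eq_bigr => x _.
  under eq_bigr do (under eq_bigr do rewrite exchange_big/=).
  under eq_bigr do rewrite exchange_big/=.
  rewrite exchange_big/=; apply: eq_bigr => y _.
  under eq_bigr do (under eq_bigr do rewrite exchange_big/=).
  under eq_bigr do rewrite exchange_big/=.
  by rewrite exchange_big/=.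
apply: eq_bigr => x _; apply: eq_bigr => y _; apply: eq_bigr => z _.
rewrite -!mulrA big_distrl/=; apply: eq_bigr => a _.
rewrite big_distrl/=; apply: eq_bigr => b _.
by rewrite big_distrl/=; apply: eq_bigr => c _; ring.
Qed.

Lemma congr_tensor1 T : congr_tensor 1%:M T = T.
Proof.
apply/funext => i; apply/funext => j; apply/funext => k; rewrite /congr_tensor.
rewrite (bigD1 i)//= [X in _ + X]big1 ?addr0 => [|a ai]; last first.
  rewrite big1// => b _; rewrite big1// => c _.
  by rewrite [_ i a]mxE eq_sym (negbTE ai) mulr0 !mul0r.
rewrite (bigD1 j)//= [X in _ + X]big1 ?addr0 => [|b bj]; last first.
  by rewrite big1// => c _; rewrite [_ j b]mxE eq_sym (negbTE bj) mulr0 !mul0r.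
rewrite (bigD1 k)//= [X in _ + X]big1 ?addr0 => [|c ck]; last first.
  by rewrite [_ k c]mxE eq_sym (negbTE ck) mulr0.
by rewrite !mxE !eqxx !mulr1.
Qed.

Definition tau u v w : R := \sum_(a < d) \sum_(b < d) \sum_(c < d)
  core R d a b c * (u 0 a * v 0 b - v 0 a * u 0 b) * w 0 c.

Lemma congr_core_skew A i j k :
  congr_tensor A (core R d) i j k - congr_tensor A (core R d) j i k =
  tau (row i A) (row j A) (row k A).
Proof.
rewrite /congr_tensor /tau -sumrB; apply: eq_bigr => a _.
rewrite -sumrB; apply: eq_bigr => b _; rewrite -sumrB; apply: eq_bigr => c _.
by rewrite !mxE; ring.
Qed.

Lemma tauC u v w : tau v u w = - tau u v w.
Proof.
rewrite /tau -sumrN; apply: eq_bigr => a _; rewrite -sumrN; apply: eq_bigr => b _.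
by rewrite -sumrN; apply: eq_bigr => c _; ring.
Qed.

Lemma tauuu u w : tau u u w = 0.
Proof.
by rewrite /tau big1// => a _; rewrite big1// => b _; rewrite big1// => c _; ring.
Qed.

Lemma tauP1 c u1 u2 v w : tau (u1 + c *: u2) v w = tau u1 v w + c * tau u2 v w.
Proof.
rewrite /tau big_distrr -big_split/=; apply: eq_bigr => i _.
rewrite big_distrr -big_split/=; apply: eq_bigr => j _.
rewrite big_distrr -big_split/=; apply: eq_bigr => k _.
by rewrite !mxE; ring.
Qed.

Lemma tauP3 c u v w1 w2 : tau u v (w1 + c *: w2) = tau u v w1 + c * tau u v w2.
Proof.
rewrite /tau big_distrr -big_split/=; apply: eq_bigr => i _.
rewrite big_distrr -big_split/=; apply: eq_bigr => j _.
rewrite big_distrr -big_split/=; apply: eq_bigr => k _.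
by rewrite !mxE; ring.
Qed.

Lemma tauP2 c u v1 v2 w : tau u (v1 + c *: v2) w = tau u v1 w + c * tau u v2 w.
Proof. by rewrite tauC tauP1 tauC [tau v2 _ _]tauC; ring. Qed.

Lemma tau03 u v : tau u v 0 = 0.
Proof.
by rewrite /tau big1// => a _; rewrite big1// => b _; rewrite big1// => c _; rewrite mxE mulr0.
Qed.

Lemma tau01 v w : tau 0 v w = 0.
Proof. by rewrite -[0](addrN w) -scaleN1r tauP1 mulN1r; rewrite addrN. Qed.

Lemma tauZ1 c u v w : tau (c *: u) v w = c * tau u v w.
Proof. by rewrite -[c *: u]add0r tauP1 tau01 add0r. Qed.

Lemma tauZ2 c u v w : tau u (c *: v) w = c * tau u v w.
Proof. by rewrite tauC tauZ1 tauC; ring. Qed.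

Lemma tauZ3 c u v w : tau u v (c *: w) = c * tau u v w.
Proof. by rewrite -[c *: w]add0r tauP3 tau03 add0r. Qed.

Lemma tau_sum3 (I : Type) (r : seq I) (P : pred I) (c : I -> R) (w : I -> 'rV[R]_d) u v :
  tau u v (\sum_(i <- r | P i) c i *: w i) = \sum_(i <- r | P i) c i * tau u v (w i).
Proof.
elim: r => [|i r IHr]; first by rewrite !big_nil tau03.
by rewrite !big_cons; case: (P i) => //; rewrite addrC tauP3 IHr addrC.
Qed.

(** The entries C_{b,a,c} vanish for a < b, so only the C_{a,b,c} remain: 3 for c = b and 6 for c >
    b. The value is independent of [a]. *)
Lemma tau_delta (a b : 'I_d) w : (a < b)%N ->
  tau (delta_mx 0 a) (delta_mx 0 b) w = 3 * w 0 b + 6 * \sum_(c < d | (b < c)%N) w 0 c.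
Proof.
move=> ab; have aNb : (a == b) = false by apply/negbTE; rewrite neq_ltn ab.
transitivity (\sum_(c < d) (core R d a b c - core R d b a c) * w 0 c).
  rewrite /tau (bigD1 a)//= [X in _ + X](bigD1 b)/=; last by rewrite eq_sym aNb.
  rewrite addrA.
  rewrite [X in _ + X]big1 ?addr0 => [|i /andP[ia ib]]; last first.
    rewrite big1// => j _; rewrite big1// => k _.
    by rewrite !mxE (negbTE ia) (negbTE ib) !mul0r subrr mulr0 mul0r.
  rewrite (bigD1 b)//= [X in _ + X + _]big1 ?addr0 => [|j jb]; last first.
    rewrite big1// => k _.
    by rewrite !mxE (negbTE jb) aNb andbF !mulr0 mul0r subrr mulr0 mul0r.
  rewrite [X in _ + X](bigD1 a)//= [X in _ + (_ + X)]big1 ?addr0 => [|j ja]; last first.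
    rewrite big1// => k _.
    by rewrite !mxE (negbTE ja) eq_sym aNb !mul0r !mulr0 subrr mulr0 mul0r.
  rewrite -big_split/=; apply: eq_bigr => c _.
  by rewrite !mxE !eqxx [b == a]eq_sym aNb /=; ring.
rewrite (bigD1 b)//= big_distrr/= [in RHS]big_mkcond/=.
rewrite [in RHS](bigD1 b)//= ltnn add0r; congr (_ + _).
  rewrite /core eqxx aNb ab [b == a]eq_sym aNb /=.
  by rewrite ltnNge (ltnW ab)/= subr0.
apply: eq_bigr => c cb; rewrite /core aNb [b == a]eq_sym aNb [b == c]eq_sym (negbTE cb)/=.
rewrite ab [(b < a)%N]ltnNge (ltnW ab)/= subr0.
by case: ifP; rewrite ?mul0r.
Qed.

Lemma core_eq0 (a b c : 'I_d) : ~~ ((a <= b)%N && (b <= c)%N) -> core R d a b c = 0.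
Proof.
rewrite /core; case: eqVneq => [->|ab]; case: eqVneq => [->|bc] /=;
  rewrite ?leqnn ?ltnn ?andbF ?andbT ?orbF //=.
- by rewrite -ltnNge => cb; rewrite ltnNge (ltnW cb).
- by rewrite -ltnNge => cb; rewrite ltnNge (ltnW cb).
by move=> H; rewrite ifN//; apply: contra H => /andP[/ltnW-> /ltnW->].
Qed.

Definition supp_from (p : nat) u := forall a : 'I_d, (a < p)%N -> u 0 a = 0.

(** C_{a,b,p} is nonzero only for a <= b <= p, and the supports ask for a, b >= p. What remains is a
    = b = p, where the skew-symmetrization vanishes. *)
Lemma tau_first p u v (a0 : 'I_d) : (a0 : nat) = p -> supp_from p u -> supp_from p v ->
  tau u v (delta_mx 0 a0) = 0.
Proof.
move=> a0p up vp; rewrite /tau big1// => a _; rewrite big1// => b _; rewrite big1// => c _.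
have [cE|ca0] := eqVneq c a0; last by rewrite !mxE (negbTE ca0) andbF mulr0.
have [apl|pa] := ltnP a p; first by rewrite (up a apl) (vp a apl) !mul0r subrr mulr0 mul0r.
have [bpl|pb] := ltnP b p; first by rewrite (up b bpl) (vp b bpl) !mulr0 subrr mulr0 mul0r.
have [abc|/core_eq0->] := boolP ((a <= b)%N && (b <= c)%N); last by rewrite !mul0r.
have -> : b = a by apply: val_inj => /=; move: abc; rewrite cE a0p; lia.
by rewrite [v 0 a * _]mulrC subrr mulr0 mul0r.
Qed.

End Skew.

(** * Block matrices and pure rows *)

Section Blocks.
Variables (R : realType) (d : nat).
Implicit Types (A B U : 'M[R]_d).

(** The block shape is stated entrywise so that all stages share one type of matrices and no casts
    between block sizes arise. *)
Definition block_from (p : nat) A :=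
  forall i j : 'I_d, ((i < p) || (j < p))%N -> A i j = (i == j)%:R.

Lemma block_from_le p q A : (q <= p)%N -> block_from p A -> block_from q A.
Proof.
move=> qp Ap i j ij; apply: Ap.
by case/orP: ij => /leq_trans/(_ qp)->; rewrite ?orbT.
Qed.

Lemma block_from_mul p A B : block_from p A -> block_from p B -> block_from p (A *m B).
Proof.
move=> Ap Bp i j ij; rewrite mxE; have [ip|ip] := ltnP i p.
  rewrite (bigD1 i)//= big1 ?addr0 => [|k ki].
    by rewrite Ap ?ip// eqxx mul1r Bp ?ip.
  by rewrite Ap ?ip// eq_sym (negbTE ki) mul0r.
have jp : (j < p)%N by case/orP: ij => //; rewrite ltnNge ip.
rewrite (bigD1 j)//= big1 ?addr0 => [|k kj].
  by rewrite [B j j]Bp ?jp ?orbT// eqxx mulr1 Ap ?jp ?orbT.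
by rewrite [B k j]Bp ?jp ?orbT// (negbTE kj) mulr0.
Qed.

Lemma block_from_rowl p A (u : 'rV[R]_d) : block_from p A -> forall j : 'I_d, (j < p)%N ->
  (u *m A) 0 j = u 0 j :> R.
Proof.
move=> Ap j jp; rewrite mxE (bigD1 j)//= big1 ?addr0 => [|k kj].
  by rewrite Ap ?jp// eqxx mulr1.
by rewrite Ap ?jp ?orbT// (negbTE kj) mulr0.
Qed.

Lemma block_from_inv p A : A \in unitmx -> block_from p A -> block_from p (invmx A).
Proof.
move=> uA Ap i j ij; have AV : invmx A *m A = 1%:M by exact: mulVmx.
have VA : A *m invmx A = 1%:M by exact: mulmxV.
have [jp|jp] := ltnP j p.
  have := block_from_rowl (row i (invmx A)) Ap jp.
  by rewrite -row_mul AV !mxE => ->.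
have ip : (i < p)%N by case/orP: ij => //; rewrite ltnNge jp.
have := congr1 (fun M : 'M[R]_d => M i j) VA; rewrite !mxE (bigD1 i)//= big1 ?addr0.
  by rewrite Ap ?ip// eqxx mul1r.
by move=> k ki; rewrite Ap ?ip// eq_sym (negbTE ki) mul0r.
Qed.

Lemma block_from_supp p A (i : 'I_d) : block_from p A -> (p <= i)%N -> supp_from p (row i A).
Proof.
move=> Ap pi a ap; rewrite mxE Ap ?ap ?orbT//; case: eqP => // ia.
by move: ap; rewrite -ia ltnNge pi.
Qed.

(** The coordinates are those of e_p A^-1, and the first [p] of them vanish because A^-1 has the
    same block shape. *)
Lemma first_vector_coords p A (a0 : 'I_d) : (a0 : nat) = p ->
  A \in unitmx -> block_from p A -> exists x : 'I_d -> R,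
    (forall i : 'I_d, (i < p)%N -> x i = 0) /\
    delta_mx 0 a0 = \sum_(i < d) x i *: row i A.
Proof.
move=> a0p uA Ap; pose x : 'rV[R]_d := delta_mx 0 a0 *m invmx A; exists (x 0); split=> [i ip|].
  have := @block_from_rowl p A x Ap i ip.
  rewrite /x -mulmxA mulVmx// mulmx1 => <-; rewrite mxE eqxx/=.
  by case: eqP => // ia; move: ip; rewrite ia a0p ltnn.
by rewrite -mulmx_sum_row /x -mulmxA mulVmx// mulmx1.
Qed.

Definition first_row_pure (p : nat) A := forall i j : 'I_d, (i : nat) = p -> j != i -> A i j = 0.

Lemma first_row_pureP p A (a0 : 'I_d) (t : R) : (a0 : nat) = p ->
  row a0 A = t *: delta_mx 0 a0 -> first_row_pure p A.
Proof.
move=> a0p rA i j ip ji; have ia : i = a0 by apply: val_inj; rewrite /= ip a0p.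
by have := congr1 (fun r : 'rV[R]_d => r 0 j) rA; rewrite !mxE ia -ia (negbTE ji) andbF mulr0.
Qed.

Lemma pure_row_neq0 p A (a0 : 'I_d) : (a0 : nat) = p -> A \in unitmx ->
  first_row_pure p A -> A a0 a0 != 0.
Proof.
move=> a0p uA Ap; apply/negP => /eqP A0; move: uA; rewrite unitmxE unitfE.
rewrite (expand_det_row A a0) big1 ?eqxx// => j _.
by have [->|ja] := eqVneq j a0; [rewrite A0 mul0r|rewrite Ap ?mul0r].
Qed.

End Blocks.

(** * The linear system of the up-step *)

Section UpperFour.
Variables (R : realType) (D p : nat).
Hypothesis pD : (p < D)%N.
Local Notation d := D.+1.
Local Notation n := (D - p)%N.
Local Notation core := (core R d).
Implicit Types (A : 'M[R]_d) (Y : tensor R d).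

Definition shift_ord (k : nat) : 'I_d := inord (p.+1 + k).
Definition first_ord : 'I_d := inord p.

Lemma val_shift_ord k : (k < n)%N -> shift_ord k = (p.+1 + k)%N :> nat.
Proof. by move=> kn; rewrite /shift_ord inordK//; lia. Qed.

Lemma val_first_ord : first_ord = p :> nat.
Proof. by rewrite /first_ord inordK//; lia. Qed.

Lemma sum_shift_ord (V : zmodType) (F : 'I_d -> V) :
  \sum_(j < d | (p < j)%N) F j = \sum_(k < n) F (shift_ord k).
Proof.
transitivity (\sum_(j < d | (p < j)%N) F (inord j)).
  by apply: eq_bigr => j _; rewrite inord_val.
rewrite -(big_geq_mkord p.+1 d xpredT (fun j => F (inord j))) -{1}[p.+1]add0n big_addn subSS.
by rewrite big_mkord; apply: eq_bigr => k _; rewrite addnC.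
Qed.

Definition pair_fst (r : 'I_(n * n)) := shift_ord (r %/ n).
Definition pair_snd (r : 'I_(n * n)) := shift_ord (r %% n).

Lemma pair_fst_gt r : (p < pair_fst r)%N.
Proof.
rewrite /pair_fst val_shift_ord; first by rewrite ltn_addr.
by rewrite ltn_divLR ?ltn_ord// subn_gt0.
Qed.

Lemma pair_snd_gt r : (p < pair_snd r)%N.
Proof.
rewrite /pair_snd val_shift_ord; first by rewrite ltn_addr.
by rewrite ltn_mod subn_gt0.
Qed.

Definition up_lhs Y : 'M[R]_(n * n, n) := \matrix_(r, c)
  (Y (pair_fst r) (pair_snd r) (shift_ord c) - Y (pair_snd r) (pair_fst r) (shift_ord c)).

Definition up_rhs Y : 'cV[R]_(n * n) := \col_r
  (Y (pair_snd r) (pair_fst r) first_ord - Y (pair_fst r) (pair_snd r) first_ord).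

Lemma up_lhs_mul A (c : 'cV[R]_n) r :
  (up_lhs (congr_tensor A core) *m c) r 0 =
  tau (row (pair_fst r) A) (row (pair_snd r) A) (\sum_k c k 0 *: row (shift_ord k) A).
Proof.
rewrite mxE tau_sum3; apply: eq_bigr => k _.
by rewrite mxE congr_core_skew mulrC.
Qed.

Lemma up_lhs_ker A (c : 'cV[R]_n) : up_lhs (congr_tensor A core) *m c = 0 <->
  (forall a b : 'I_d, (p < a)%N -> (p < b)%N ->
    tau (row a A) (row b A) (\sum_k c k 0 *: row (shift_ord k) A) = 0).
Proof.
split=> [H a b pa pb|H]; last first.
  apply/matrixP => r j; rewrite ord1 up_lhs_mul mxE; apply: H.
    exact: pair_fst_gt.
  exact: pair_snd_gt.
have an : (a - p.+1 < n)%N by have := ltn_ord a; lia.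
have bn : (b - p.+1 < n)%N by have := ltn_ord b; lia.
have rn : ((a - p.+1) * n + (b - p.+1) < n * n)%N by nia.
have := congr1 (fun M : 'cV[R]_(n * n) => M (Ordinal rn) 0) H.
rewrite up_lhs_mul mxE /pair_fst /pair_snd /= modnMDl modn_small// divnMDl; last lia.
rewrite divn_small// addn0 (_ : shift_ord (a - p.+1) = a); last first.
  by apply: val_inj; rewrite /= val_shift_ord//; lia.
rewrite (_ : shift_ord (b - p.+1) = b)//.
by apply: val_inj; rewrite /= val_shift_ord//; lia.
Qed.

Lemma tau_supported A (a b : 'I_d) (w : 'rV[R]_d) : block_from p A -> (p < a)%N -> (p < b)%N ->
  (forall j, j != first_ord -> w 0 j = 0) -> tau (row a A) (row b A) w = 0.
Proof.
move=> Ap pa pb w0; have -> : w = w 0 first_ord *: delta_mx 0 first_ord.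
  apply/rowP => j; rewrite !mxE eqxx/=; have [->|/w0->] := eqVneq j first_ord.
    by rewrite mulr1.
  by rewrite mulr0.
by rewrite tauZ3 (tau_first val_first_ord) ?mulr0//; apply: block_from_supp => //; exact: ltnW.
Qed.

(** Full rank makes the block [B] of rows and columns beyond [p] invertible: a row vector c with c B
    = 0 would combine the rows beyond [p] into a multiple of e_p and so solve the homogeneous
    system. With [B] one can clear row [p] beyond its diagonal entry, and the coefficients of this
    elimination solve the system. *)
Lemma up4_solution A : A \in unitmx -> block_from p A ->
  \rank (up_lhs (congr_tensor A core)) = n ->
  exists (x : 'cV[R]_n) (t : R),
    up_lhs (congr_tensor A core) *m x = up_rhs (congr_tensor A core) /\
    row first_ord A + \sum_k x k 0 *: row (shift_ord k) A = t *: delta_mx 0 first_ord.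
Proof.
move=> uA Ap rk.
have inj c : up_lhs (congr_tensor A core) *m c = 0 -> c = 0 :> 'cV[R]_n.
  have /row_fullP[B BM] : row_full (up_lhs (congr_tensor A core)) by rewrite /row_full rk.
  by move=> Mc; rewrite -[c]mul1mx -BM -mulmxA Mc mulmx0.
have low (w : 'I_n -> R) (j : 'I_d) : (j < p)%N ->
    (\sum_k w k *: row (shift_ord k) A) 0 j = 0.
  move=> jp; rewrite summxE big1// => k _; rewrite !mxE Ap ?jp ?orbT//.
  case: eqP => [kj|]; last by rewrite mulr0.
  by move: jp; rewrite -kj val_shift_ord//; lia.
pose B := \matrix_(k < n, l < n) A (shift_ord k) (shift_ord l).
have entry (w : 'rV[R]_n) (j : 'I_d) : (p < j)%N -> exists l : 'I_n,
    j = shift_ord l /\ (\sum_k w 0 k *: row (shift_ord k) A) 0 j = (w *m B) 0 l.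
  move=> pj; have ln : (j - p.+1 < n)%N by have := ltn_ord j; lia.
  have jE : j = shift_ord (Ordinal ln).
    by apply: val_inj; rewrite /= val_shift_ord//=; lia.
  exists (Ordinal ln); split=> //; rewrite summxE mxE; apply: eq_bigr => k _.
  by rewrite !mxE -jE.
have uB : B \in unitmx.
  rewrite unitmxE unitfE; apply/negP => /det0P[c c0 cB]; move/negP: c0; apply.
  rewrite -[c]trmxK (inj c^T) ?trmx0//; apply/up_lhs_ker => a b pa pb.
  apply: tau_supported => // j; rewrite -val_eqE/= val_first_ord neq_ltn => /orP[jp|pj].
    exact: low.
  have [l [_ H]] := entry c j pj; under eq_bigr do rewrite mxE.
  by rewrite H cB mxE.
pose u : 'rV[R]_n := \row_l A first_ord (shift_ord l).
pose x := (- u *m invmx B)^T.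
pose rho := row first_ord A + \sum_k x k 0 *: row (shift_ord k) A.
have rho0 j : j != first_ord -> rho 0 j = 0.
  rewrite -val_eqE/= val_first_ord mxE neq_ltn => /orP[jp|pj].
    rewrite low// mxE Ap ?jp ?orbT// addr0; case: eqP => // jE.
    by move: jp; rewrite -jE val_first_ord ltnn.
  have [l [jl H]] := entry x^T j pj.
  have -> : \sum_k x k 0 *: row (shift_ord k) A = \sum_k x^T 0 k *: row (shift_ord k) A.
    by apply: eq_bigr => k _; rewrite [x^T _ _]mxE.
  by rewrite H trmxK -mulmxA mulVmx// mulmx1 !mxE -jl subrr.
exists x, (rho 0 first_ord); split; last first.
  apply/rowP => j; rewrite -/rho [RHS]mxE [delta_mx _ _ _ _]mxE eqxx/=.
  by have [->|/rho0->] := eqVneq j first_ord; rewrite ?mulr1 ?mulr0.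
apply/matrixP => r j; rewrite ord1 up_lhs_mul [RHS]mxE.
rewrite -opprB congr_core_skew; set s := \sum_k _.
have := tau_supported Ap (pair_fst_gt r) (pair_snd_gt r) rho0; rewrite /rho -/s.
by rewrite -[X in _ + X]scale1r tauP3 mul1r => /eqP; rewrite addrC addr_eq0 => /eqP.
Qed.

(* For rows a < b < D of the block, the equation reads kappa b = 0, where
   kappa b = 3 w_b + 6 sum_(c > b) w_c; for a < b = D it reads
   kappa D = kappa a.  Three rows are enough to make every kappa vanish. *)
Lemma up4_example : (p + 3 <= D)%N ->
  \rank (up_lhs (congr_tensor (1%:M + delta_mx ord_max first_ord) core)) = n.
Proof.
move=> p3; set A := _ + _; suff inj c : up_lhs (congr_tensor A core) *m c = 0 -> c = 0 :> 'cV[R]_n.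
  apply/eqP; rewrite -mxrank_tr; apply/row_freeP.
  suff /row_fullP[B BM] : row_full (up_lhs (congr_tensor A core)).
    by exists B^T; rewrite -trmx_mul BM trmx1.
  rewrite -sub1mx submxE; apply/eqP; rewrite mul1mx; apply/matrixP => i j.
  have /inj/(congr1 (fun M : 'cV[R]_n => M i 0)) :
      up_lhs (congr_tensor A core) *m col j (cokermx (up_lhs (congr_tensor A core))) = 0.
    by rewrite !colE mulmxA mulmx_coker mul0mx.
  by rewrite !mxE.
move=> /up_lhs_ker; set w := \sum_k _ => H.
have maxE : (ord_max : 'I_d) = D :> nat by [].
have rowA (a : 'I_d) : a != ord_max -> row a A = delta_mx 0 a.
  by move=> am; apply/rowP => j; rewrite !mxE eqxx (negbTE am)/= addr0 eq_sym.
have rowM : row ord_max A = delta_mx 0 ord_max + 1 *: delta_mx 0 first_ord.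
  by apply/rowP => j; rewrite !mxE !eqxx/= mul1r eq_sym.
pose kappa (b : 'I_d) := 3 * w 0 b + 6 * \sum_(c < d | (b < c)%N) w 0 c.
have neq_max (a : 'I_d) : (a < D)%N -> a != ord_max.
  by move=> aD; rewrite -val_eqE/= neq_ltn aD.
have k0 (b : 'I_d) : (p.+1 < b < D)%N -> kappa b = 0.
  move=> /andP[pb bD]; have ad : (p.+1 < d)%N by lia.
  have := H (Ordinal ad) b (ltnSn p) (ltnW pb).
  by rewrite !rowA ?tau_delta// neq_max//=; lia.
have kD (a : 'I_d) : (p < a < D)%N -> kappa ord_max = kappa a.
  move=> /andP[pa aD]; have := H a ord_max pa pD.
  rewrite rowM rowA ?neq_max// tauP2 mul1r tau_delta//.
  rewrite tauC tau_delta; last by rewrite val_first_ord.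
  by move=> /eqP; rewrite subr_eq0 => /eqP.
have kall (a : 'I_d) : (p < a)%N -> kappa a = 0.
  have qd : (p.+2 < d)%N by lia.
  have kq : kappa ord_max = 0.
    by rewrite (kD (Ordinal qd)) ?k0//=; lia.
  have [aD pa|aD _] := ltnP a D; first by rewrite -kD// pa.
  by rewrite (_ : a = ord_max)//; apply: val_inj => /=; have := ltn_ord a; lia.
have w0 (a : 'I_d) : (p < a)%N -> w 0 a = 0.
  have [m] := ubnP (D - a); elim: m a => // m IHm a am pa.
  have := kall a pa; rewrite /kappa big1 ?mulr0 ?addr0.
    by move=> /eqP; rewrite mulf_eq0 pnatr_eq0/= => /eqP.
  by move=> e ae; apply: IHm; have := ltn_ord e; lia.
apply/matrixP => l j; rewrite ord1 [RHS]mxE.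
have := w0 (shift_ord l); rewrite val_shift_ord// => /(_ ltac:(lia)) <-.
have Ash (k : 'I_n) : A (shift_ord k) (shift_ord l) = (k == l)%:R.
  have lN0 : (shift_ord l == first_ord) = false.
    by apply/negbTE; rewrite -val_eqE/= val_shift_ord// val_first_ord gtn_eqF//; lia.
  have kl : (shift_ord k == shift_ord l) = (k == l).
    by rewrite -val_eqE/= !val_shift_ord// eqn_add2l.
  by rewrite !mxE lN0 andbF addr0 kl.
rewrite summxE (bigD1 l)//= big1 ?addr0 => [|k kl].
  by rewrite mxE [row _ _ _ _]mxE Ash eqxx mulr1.
by rewrite mxE [row _ _ _ _]mxE Ash (negbTE kl) mulr0.
Qed.

End UpperFour.

Lemma cbrt_cube (R : realType) (t : R) : cbrt (t ^+ 3) = t.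
Proof.
rewrite /cbrt normrX sgrX -(powR_mulrn 3 (normr_ge0 t)) -powRrM mulfV ?pnatr_eq0//.
rewrite powRr1 ?normr_ge0//; have [->|t0] := eqVneq t 0.
  by rewrite sgr0 expr0n mul0r.
by rewrite exprS sqr_sg t0 mulr1 -numEsg.
Qed.

(** * Elementary matrices and the down-step *)

Section RowOperations.
Variables (R : realType) (d : nat).
Implicit Types (A B X : 'M[R]_d) (a b : 'I_d) (f : 'I_d -> R).

(** One shape for U^(s,x) and for the transvections of [up3], where [f] is supported on a single
    index. *)
Definition row_op a f : 'M[R]_d :=
  \matrix_(i, j) if (i == a) && (a < j)%N then f j else (i == j)%:R.

Lemma row_row_op_neq a f A i : i != a -> row i (row_op a f *m A) = row i A.
Proof.
move=> ia; rewrite row_mul (_ : row i _ = row i 1%:M) -?row_mul ?mul1mx//.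
by apply/rowP => j; rewrite !mxE (negbTE ia).
Qed.

Lemma row_row_op a f A :
  row a (row_op a f *m A) = row a A + \sum_(j < d | (a < j)%N) f j *: row j A.
Proof.
rewrite row_mul mulmx_sum_row (bigID (fun j : 'I_d => (a < j)%N))/= addrC.
congr (_ + _); last first.
  by apply: eq_bigr => j aj; rewrite !mxE eqxx aj.
rewrite (bigD1 a) ?ltnn//= big1 ?addr0 => [|j /andP[/negbTE aj ja]].
  by rewrite !mxE ltnn andbF eqxx scale1r.
by rewrite !mxE aj andbF eq_sym (negbTE ja) scale0r.
Qed.

Lemma row_op_unit a f : row_op a f \in unitmx.
Proof.
rewrite -unitmx_tr unitmxE det_trig.
  rewrite big1 ?unitr1// => i _; rewrite !mxE eqxx.
  by case: eqP => [->|//]; rewrite ltnn.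
apply/is_trig_mxP => i j ij; rewrite !mxE [j == i]gt_eqF//; case: eqP => [<-|//].
by rewrite ltnNge (ltnW ij).
Qed.

Lemma row_op_block p a f : (p <= a)%N -> block_from p (row_op a f).
Proof.
move=> pa i j ij; rewrite mxE; case: eqP => //= ia; case: ltnP => //= aj.
by case/orP: ij; rewrite ?ia; lia.
Qed.

Definition transvection_mx a b q : 'M[R]_d := row_op a (fun j => q *+ (j == b)).

Lemma row_transvection a b q A : (a < b)%N ->
  row a (transvection_mx a b q *m A) = row a A + q *: row b A.
Proof.
move=> ab; rewrite row_row_op; congr (_ + _); rewrite (bigD1 b)//= big1 ?addr0.
  by rewrite eqxx mulr1n.
by move=> j /andP[_ /negbTE->]; rewrite mulr0n scale0r.
Qed.

(** The diagonal and two full rows. Two rows are what the product of the three transvections of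
    [up3] and the transposition of [up2] occupy. *)
Lemma nnz_rows a b X : (forall i j, X i j != 0 -> [|| i == j, i == a | i == b]) ->
  (nnz X <= 3 * d)%N.
Proof.
move=> H; apply: (@leq_trans (\sum_(i < d) \sum_(j < d) ((i == j) + (i == a) + (i == b))%N)).
  apply: leq_sum => i _; apply: leq_sum => j _.
  have := H i j; case: eqP => //= _ /(_ isT).
  by case: (i == j); case: (i == a); case: (i == b).
have sum1 (c : 'I_d) : (\sum_(i < d) (i == c) = 1)%N.
  by rewrite (bigD1 c)//= eqxx big1 ?addn0// => i /negbTE->.
under eq_bigr do rewrite !big_split/= !sum_nat_const !card_ord.
rewrite !big_split/= -!big_distrr/= !sum1 exchange_big/=.
by under eq_bigr do rewrite sum1; rewrite sum_nat_const card_ord; lia.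
Qed.

Lemma nnz_col a X : (forall i j, X i j != 0 -> (i == j) || (j == a)) ->
  (nnz X <= 3 * d)%N.
Proof.
move=> H; rewrite (_ : nnz X = nnz X^T).
  by apply: (@nnz_rows a a) => i j; rewrite mxE => /H; rewrite eq_sym orbb.
by rewrite /nnz exchange_big/=; under [RHS]eq_bigr do (under eq_bigr do rewrite mxE).
Qed.

Lemma nnz_le X : (nnz X <= d ^ 2)%N.
Proof.
apply: (@leq_trans (\sum_(i < d) \sum_(j < d) 1)%N); last first.
  by rewrite !sum_nat_const !card_ord muln1.
by apply: leq_sum => i _; apply: leq_sum => j _; exact: leq_b1.
Qed.

Definition scale_first a (c : R) : 'M[R]_d :=
  \matrix_(i, j) if (i == a) && (j == a) then c else (i == j)%:R.

Definition clear_col a f : 'M[R]_d :=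
  \matrix_(i, j) if (j == a) && (a < i)%N then f i else (i == j)%:R.

Lemma scale_first_mul a c A i j :
  (scale_first a c *m A) i j = if i == a then c * A a j else A i j.
Proof.
rewrite mxE (bigD1 i)//= big1 ?addr0 => [|k ki].
  by rewrite !mxE eqxx; case: eqP => [->|_]; rewrite ?mul1r.
rewrite !mxE [i == k]eq_sym (negbTE ki); case: eqP => [ia|_]; rewrite ?mul0r//=.
by rewrite -ia (negbTE ki) mul0r.
Qed.

Lemma clear_col_mul a f A i j :
  (clear_col a f *m A) i j = if (a < i)%N then f i * A a j + A i j else A i j.
Proof.
rewrite mxE; have [ai|ia] := boolP (a < i)%N; last first.
  rewrite (bigD1 i)//= big1 ?addr0 => [|k ki].
    by rewrite !mxE (negbTE ia) andbF eqxx mul1r.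
  by rewrite !mxE (negbTE ia) andbF eq_sym (negbTE ki) mul0r.
have iNa : i != a by rewrite -val_eqE/= gtn_eqF.
rewrite (bigD1 a)//= (bigD1 i)//= big1 ?addr0 => [|k /andP[ka ki]].
  by rewrite !mxE eqxx ai/= (negbTE iNa) eqxx mul1r.
by rewrite !mxE (negbTE ka) eq_sym (negbTE ki) mul0r.
Qed.

Lemma scale_first_unit a c : c != 0 -> scale_first a c \in unitmx.
Proof.
move=> c0; have trig : is_trig_mx (scale_first a c).
  apply/is_trig_mxP => i j ij; rewrite mxE [i == j]lt_eqF//.
  by case: andP => // -[/eqP ia /eqP ja]; move: ij; rewrite ia ja ltnn.
rewrite unitmxE det_trig// unitfE; apply/prodf_neq0 => i _; rewrite mxE eqxx.
by case: ifP => _; rewrite ?oner_eq0.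
Qed.

Lemma clear_col_unit a f : clear_col a f \in unitmx.
Proof.
have trig : is_trig_mx (clear_col a f).
  apply/is_trig_mxP => i j ij; rewrite mxE [i == j]lt_eqF//.
  by case: andP => // -[/eqP <-]; rewrite ltnNge (ltnW ij).
rewrite unitmxE det_trig// big1 ?unitr1// => i _; rewrite mxE eqxx.
by case: andP => // -[/eqP ->]; rewrite ltnn.
Qed.

(* This is D^(s,h) L^(s,y) for h = t^-3 and the vector y computed from A * C,
   when row s of A is t e_s. *)
Definition down_mx a (t : R) (A : 'M[R]_d) : 'M[R]_d :=
  scale_first a t^-1 *m clear_col a (fun i => - (t ^+ 3)^-1 * (t ^+ 2 * A i a)).

Lemma down_mx_unit a t A : t != 0 -> down_mx a t A \in unitmx.
Proof. by move=> t0; rewrite unitmx_mul scale_first_unit ?invr_neq0// clear_col_unit. Qed.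

Lemma down_mx_nnz a t A : (nnz (down_mx a t A) <= 3 * d)%N.
Proof.
apply: (@nnz_col a) => i j; rewrite scale_first_mul.
have [_|ja] := eqVneq j a; rewrite ?orbT// orbF.
have [->|ia] := eqVneq i a; rewrite mxE (negbTE ja)/=.
  by have [//|aj] := eqVneq a j; rewrite mulr0 eqxx.
by have [//|ij] := eqVneq i j; rewrite eqxx.
Qed.

Variables (p : nat) (a : 'I_d).
Hypothesis ap : (a : nat) = p.

(** Row [a] is pure, so adding multiples of it changes column [a] only. The trailing block survives,
    and the tests of later stages can be read off the current matrix. *)
Lemma down_mxE A i j : A \in unitmx -> block_from p A -> first_row_pure p A ->
  (down_mx a (A a a) A *m A) i j =
  if (p < i)%N then (if j == a then 0 else A i j) else (i == j)%:R.
Proof.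
move=> uA Ap Aa; have t0 := pure_row_neq0 ap uA Aa.
rewrite -mulmxA scale_first_mul !clear_col_mul ltnn ap.
have [->|ia] := eqVneq i a.
  rewrite ap ltnn; have [->|ja] := eqVneq j a; first by rewrite ?eqxx mulVf.
  by rewrite (Aa a j ap ja) mulr0.
have [pi|ip] := ltnP p i.
  have [->|ja] := eqVneq j a; last by rewrite (Aa a j ap ja) mulr0 add0r.
  by field.
by rewrite Ap// ltn_neqAle ip andbT -ap (ia : (i : nat) != a).
Qed.

Lemma down_mx_block A : A \in unitmx -> block_from p A -> first_row_pure p A ->
  block_from p.+1 (down_mx a (A a a) A *m A).
Proof.
move=> uA Ap Aa i j ij; rewrite down_mxE//.
have [pi|//] := ltnP p i; have jp : (j <= p)%N by move: ij; lia.
have ij' : (i == j) = false by apply/negbTE; rewrite -val_eqE/= gtn_eqF//; lia.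
rewrite ij'; case: eqP => [//|/eqP ja]; rewrite Ap ?ij'//.
by apply/orP; right; rewrite ltn_neqAle jp andbT -ap.
Qed.

(** Purity of row [a] leaves only the entries C_{a,k,a}, which vanish unless k = a since C is
    supported on weakly increasing indices. For j = a the value is the cube of the diagonal
    entry. *)
Lemma congr_core_first A j : first_row_pure p A ->
  congr_tensor A (core R d) a j a = A a a ^+ 2 * A j a.
Proof.
move=> Aa; rewrite /congr_tensor (bigD1 a)//= [X in _ + X]big1 ?addr0; last first.
  move=> i ia; rewrite big1// => k _; rewrite big1// => l _.
  by rewrite (Aa a i ap ia) mulr0 !mul0r.
rewrite (bigD1 a)//= [X in _ + X]big1 ?addr0; last first.
  move=> k ka; rewrite big1// => l _; have [->|la] := eqVneq l a; last first.
    by rewrite (Aa a l ap la) mulr0.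
  rewrite core_eq0 ?mul0r//; apply: contra ka => /andP[ak kl].
  by rewrite -val_eqE/= eqn_leq kl ak.
rewrite (bigD1 a)//= [X in _ + X]big1 ?addr0; last first.
  by move=> l la; rewrite (Aa a l ap la) mulr0.
by rewrite {1}/core !eqxx/= mul1r; ring.
Qed.

End RowOperations.

(** * The last two up-steps *)

Section LastStages.
Variables (R : realType) (D : nat).
Local Notation d := D.+1.
Local Notation core := (core R d).
Implicit Types (A : 'M[R]_d).

Lemma sum_last (V : zmodType) p (F : 'I_d -> V) : (p <= D)%N ->
  (forall i : 'I_d, (i < p)%N -> F i = 0) ->
  \sum_(i < d) F i = F (inord p) + \sum_(k < D - p) F (inord (p.+1 + k)).
Proof.
move=> pD F0; have [pE|pltD] := eqVneq p D.
  rewrite pE subnn big_ord0 addr0 (bigD1 (inord D))//= big1 ?addr0// => i iD.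
  apply: F0; move: iD; rewrite -val_eqE/= inordK// pE => iD.
  by rewrite ltn_neqAle iD -ltnS ltn_ord.
have ltD : (p < D)%N by rewrite ltn_neqAle pltD.
rewrite (bigID (fun i : 'I_d => (p < i)%N))/= addrC sum_shift_ord; congr (_ + _).
rewrite (bigD1 (inord p))/=; last by rewrite inordK ?ltnn.
rewrite big1 ?addr0// => i; rewrite -leqNgt -val_eqE/= inordK// => /andP[ip iNp].
by apply: F0; rewrite ltn_neqAle iNp.
Qed.

Definition last_ord (k : nat) : 'I_d := inord (D - k).
Local Notation o0 := (last_ord 2).
Local Notation o1 := (last_ord 1).
Local Notation o2 := (last_ord 0).

Lemma val_last_ord k : last_ord k = (D - k)%N :> nat.
Proof. by rewrite /last_ord inordK// ltnS leq_subr. Qed.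

Lemma last_vector2 A : (1 <= D)%N -> A \in unitmx -> block_from (D - 1) A ->
  exists x0 x1, delta_mx 0 o1 = x0 *: row o1 A + x1 *: row o2 A.
Proof.
move=> D1 uA Ap; have [x [x0 xE]] := first_vector_coords (val_last_ord 1) uA Ap.
exists (x o1), (x o2); rewrite xE (@sum_last _ (D - 1)) ?leq_subr//; last first.
  by move=> i ip; rewrite x0 ?scale0r.
rewrite subKn// big_ord1 /= (_ : (D - 1).+1 + 0 = D)%N; last lia.
by rewrite /last_ord subn0.
Qed.

Lemma last_vector3 A : (2 <= D)%N -> A \in unitmx -> block_from (D - 2) A ->
  exists x0 x1 x2, delta_mx 0 o0 = x0 *: row o0 A + x1 *: row o1 A + x2 *: row o2 A.
Proof.
move=> D2 uA Ap; have [x [x0 xE]] := first_vector_coords (val_last_ord 2) uA Ap.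
exists (x o0), (x o1), (x o2); rewrite xE (@sum_last _ (D - 2)) ?leq_subr//; last first.
  by move=> i ip; rewrite x0 ?scale0r.
rewrite subKn// 2!big_ord_recl big_ord0 addr0 addrA /= /bump /=.
rewrite /last_ord subn0 (_ : (D - 2).+1 + 0 = D - 1)%N; last lia.
by rewrite (_ : (D - 2).+1 + (1 + 0) = D)%N//; lia.
Qed.

Lemma delta_neq0 (a : 'I_d) : delta_mx 0 a != 0 :> 'rV[R]_d.
Proof. by apply/rV0Pn; exists a; rewrite mxE !eqxx oner_eq0. Qed.

Lemma pure_of_multiple A (a : 'I_d) p x : (a : nat) = p ->
  delta_mx 0 a = x *: row a A -> first_row_pure p A.
Proof.
move=> ap E; apply: (first_row_pureP (t := x^-1) ap); rewrite E scalerA mulVf ?scale1r//.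
by apply: contraNneq (delta_neq0 a) => x0; rewrite E x0 scale0r.
Qed.

Lemma tau_last A (i j : 'I_d) p (a : 'I_d) : (a : nat) = p -> block_from p A ->
  (p <= i)%N -> (p <= j)%N -> tau (row i A) (row j A) (delta_mx 0 a) = 0.
Proof.
by move=> ap Ap pi pj; apply: tau_first ap _ _; exact: block_from_supp.
Qed.

(** Write e_p as a combination of the last three rows r0, r1, r2. The form tau r1 r2 kills e_p, r0
    and r1 but not r2, so r2 has coefficient 0; then tau r0 r1 does the same for r1. *)
Lemma up3_pure A : (2 <= D)%N -> A \in unitmx -> block_from (D - 2) A ->
  tau (row o1 A) (row o2 A) (row o0 A) = 0 ->
  tau (row o1 A) (row o2 A) (row o1 A) = 0 ->
  tau (row o1 A) (row o2 A) (row o2 A) != 0 ->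
  tau (row o0 A) (row o1 A) (row o0 A) = 0 ->
  tau (row o0 A) (row o1 A) (row o1 A) != 0 ->
  first_row_pure (D - 2) A.
Proof.
move=> D2 uA Ap t0 t1 t2 s0 s1; have [x0 [x1 [x2 E]]] := last_vector3 D2 uA Ap.
have x2E : x2 = 0.
  have := tau_last (val_last_ord 2) Ap (i := o1) (j := o2).
  rewrite !val_last_ord E -[x0 *: _]add0r !tauP3 tau03 t0 t1 !mulr0 !add0r => H.
  by apply/eqP; rewrite -(mulIr_eq0 _ (mulIf t2)) H//; lia.
have x1E : x1 = 0.
  have := tau_last (val_last_ord 2) Ap (i := o0) (j := o1).
  rewrite !val_last_ord E x2E scale0r addr0 -[x0 *: _]add0r !tauP3 tau03 s0 !mulr0 !add0r => H.
  by apply/eqP; rewrite -(mulIr_eq0 _ (mulIf s1)) H//; lia.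
apply: (pure_of_multiple (x := x0) (val_last_ord 2)).
by rewrite E x1E x2E !scale0r !addr0.
Qed.

Lemma up2_pure A : (1 <= D)%N -> A \in unitmx -> block_from (D - 1) A ->
  tau (row o1 A) (row o2 A) (row o1 A) = 0 ->
  tau (row o1 A) (row o2 A) (row o2 A) != 0 ->
  first_row_pure (D - 1) A.
Proof.
move=> D1 uA Ap t1 t2; have [x0 [x1 E]] := last_vector2 D1 uA Ap.
have x1E : x1 = 0.
  have := tau_last (val_last_ord 1) Ap (i := o1) (j := o2).
  rewrite !val_last_ord E -[x0 *: _]add0r !tauP3 tau03 t1 !mulr0 !add0r => H.
  by apply/eqP; rewrite -(mulIr_eq0 _ (mulIf t2)) H//; lia.
apply: (pure_of_multiple (x := x0) (val_last_ord 1)).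
by rewrite E x1E !scale0r !addr0.
Qed.

Lemma tau_example (a b : 'I_d) : (a < b)%N -> tau (delta_mx 0 a) (delta_mx 0 b) (delta_mx 0 b) = 3 :> R.
Proof.
move=> ab; rewrite tau_delta// mxE !eqxx mulr1 big1 ?mulr0 ?addr0// => c bc.
by rewrite mxE eqxx/= gt_eqF.
Qed.

(** Why a swap suffices when the test fails: if row [o1] took part in e_{o1}, then tau would vanish
    identically on the span of the last two rows, which contains e_{o1} and e_{o2}. But tau takes
    the value 3 at e_{o1}, e_{o2}, e_{o2}. *)
Lemma up2_swap A : (1 <= D)%N -> A \in unitmx -> block_from (D - 1) A ->
  tau (row o1 A) (row o2 A) (row o2 A) = 0 ->
  exists x, delta_mx 0 o1 = x *: row o2 A.
Proof.
move=> D1 uA Ap t2; have [x0 [x1 E]] := last_vector2 D1 uA Ap.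
have t1 : x0 * tau (row o1 A) (row o2 A) (row o1 A) = 0.
  have := tau_last (val_last_ord 1) Ap (i := o1) (j := o2).
  rewrite !val_last_ord E -[x0 *: _]add0r !tauP3 tau03 t2 !mulr0 !add0r addr0.
  by apply; lia.
have [x0E|x0N] := eqVneq x0 0; first by exists x1; rewrite E x0E scale0r add0r.
have t10 : tau (row o1 A) (row o2 A) (row o1 A) = 0.
  by move/eqP: t1; rewrite mulf_eq0 (negbTE x0N)/= => /eqP.
have uA' : invmx A *m A = 1%:M by exact: mulVmx.
have bI := block_from_inv uA Ap.
have e2E : delta_mx 0 o2 =
    invmx A o2 o1 *: row o1 A + invmx A o2 o2 *: row o2 A :> 'rV[R]_d.
  have -> : delta_mx 0 o2 = row o2 (invmx A) *m A.
    by rewrite -row_mul uA'; apply/rowP => j; rewrite !mxE eqxx eq_sym.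
  rewrite mulmx_sum_row (@sum_last _ (D - 1)) ?leq_subr//; last first.
    move=> i ip; rewrite mxE bI ?ip ?orbT//; case: eqP => [ie|]; last by rewrite scale0r.
    by move: ip; rewrite -ie val_last_ord; lia.
  rewrite subKn// big_ord1 /= (_ : (D - 1).+1 + 0 = D)%N; last lia.
  by rewrite ![row _ (invmx A) _ _]mxE /last_ord subn0.
have all0 w u v (c1 c2 : R) : tau (row o1 A) (row o2 A) w = 0 ->
    u = c1 *: row o1 A + c2 *: row o2 A ->
    forall e1 e2 : R, v = e1 *: row o1 A + e2 *: row o2 A -> tau u v w = 0.
  move=> w0 -> e1 e2 ->; rewrite tauP1 tauZ1 !tauP2 !tauZ2 !tauuu.
  by rewrite [tau (row o2 A) _ _]tauC w0; ring.
have := @tau_example o1 o2; rewrite !val_last_ord (all0 _ _ _ _ _ _ E _ _ e2E).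
  by move=> /(_ ltac:(lia))/eqP; rewrite eq_sym pnatr_eq0.
by rewrite e2E -[invmx A o2 o1 *: _]add0r !tauP3 tau03 t10 t2 !mulr0 !addr0.
Qed.

Definition up3_q1 A := - tau (row o1 A) (row o2 A) (row o1 A) /
  tau (row o1 A) (row o2 A) (row o2 A).
Definition up3_Q1 A := transvection_mx o1 o2 (up3_q1 A).
Definition up3_q2 A := - tau (row o1 A) (row o2 A) (row o0 A) /
  tau (row o1 A) (row o2 A) (row o2 A).
Definition up3_Q2 A := transvection_mx o0 o2 (up3_q2 A).
Definition up3_q3 A := - tau (row o0 A) (row o1 A) (row o0 A) /
  tau (row o0 A) (row o1 A) (row o1 A).
Definition up3_Q3 A := transvection_mx o0 o1 (up3_q3 A).

Definition up3_A1 A := up3_Q1 A *m A.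
Definition up3_A2 A := up3_Q2 (up3_A1 A) *m up3_A1 A.

(** Two clauses for three tests: once they hold, row [o0] of the transformed matrix is pure, and the
    entry examined by the third test is the cube of a nonzero number. *)
Definition pass3 A := tau (row o1 A) (row o2 A) (row o2 A) != 0 /\
  tau (row o0 (up3_A2 A)) (row o1 (up3_A2 A)) (row o1 (up3_A2 A)) != 0.

Section UpThree.
Hypothesis D2 : (2 <= D)%N.

Let o01 : (o0 < o1)%N. Proof. by rewrite !val_last_ord; lia. Qed.
Let o12 : (o1 < o2)%N. Proof. by rewrite !val_last_ord; lia. Qed.
Let o02 : (o0 < o2)%N. Proof. by rewrite !val_last_ord; lia. Qed.
Let neq_ord (a b : 'I_d) : (a < b)%N -> b != a.
Proof. by move=> ab; rewrite -val_eqE/= gtn_eqF. Qed.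
Let n10 : o1 != o0. Proof. exact: neq_ord. Qed.
Let n20 : o2 != o0. Proof. exact: neq_ord. Qed.
Let n21 : o2 != o1. Proof. exact: neq_ord. Qed.
Let n01 : o0 != o1. Proof. by rewrite eq_sym. Qed.

Lemma up3_A1_row1 A : row o1 (up3_A1 A) = row o1 A + up3_q1 A *: row o2 A.
Proof. exact: row_transvection. Qed.
Lemma up3_A1_row2 A : row o2 (up3_A1 A) = row o2 A.
Proof. exact: row_row_op_neq. Qed.
Lemma up3_A1_row0 A : row o0 (up3_A1 A) = row o0 A.
Proof. exact: row_row_op_neq. Qed.

Lemma up3_A2_row0 A :
  row o0 (up3_A2 A) = row o0 A + up3_q2 (up3_A1 A) *: row o2 A.
Proof. by rewrite row_transvection// up3_A1_row0 up3_A1_row2. Qed.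
Lemma up3_A2_row1 A : row o1 (up3_A2 A) = row o1 A + up3_q1 A *: row o2 A.
Proof. by rewrite row_row_op_neq ?up3_A1_row1//. Qed.
Lemma up3_A2_row2 A : row o2 (up3_A2 A) = row o2 A.
Proof. by rewrite row_row_op_neq ?up3_A1_row2//. Qed.

(** Adding a multiple of one argument to the other does not change a skew form; so the test value
    and the second quotient can be read off [A] itself. *)
Lemma up3_A1_tau A w :
  tau (row o1 (up3_A1 A)) (row o2 (up3_A1 A)) w = tau (row o1 A) (row o2 A) w.
Proof. by rewrite up3_A1_row1 up3_A1_row2 tauP1 tauuu mulr0 addr0. Qed.

Lemma up3_q2E A : up3_q2 (up3_A1 A) = up3_q2 A.
Proof. by rewrite /up3_q2 !up3_A1_tau up3_A1_row0 up3_A1_row2. Qed.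

Definition up3_mx A := up3_Q3 (up3_A2 A) *m up3_Q2 (up3_A1 A) *m up3_Q1 A.

Lemma up3_mx_unit A : up3_mx A \in unitmx.
Proof. by rewrite !unitmx_mul !row_op_unit. Qed.

Lemma up3_mx_block A : block_from (D - 2) (up3_mx A).
Proof.
by rewrite /up3_mx; do 2?apply: block_from_mul; apply: row_op_block;
  rewrite val_last_ord//; lia.
Qed.

Lemma up3_mxE A : up3_mx A *m A = up3_Q3 (up3_A2 A) *m up3_A2 A.
Proof. by rewrite -!mulmxA. Qed.

Lemma up3_mx_nnz A : (nnz (up3_mx A) <= 3 * d)%N.
Proof.
apply: (@nnz_rows _ _ o0 o1) => i j; have [//|i0] := eqVneq i o0; rewrite ?orbT//.
have [//|i1] := eqVneq i o1; rewrite ?orbT// orbF.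
have -> : up3_mx A i j = row i (up3_mx A) 0 j by rewrite [RHS]mxE.
rewrite /up3_mx -!mulmxA !row_row_op_neq// -[X in row i X]mulmx1 row_row_op_neq//.
by rewrite !mxE; have [//|ij] := eqVneq i j; rewrite eqxx.
Qed.

(** Each quotient is the root of a linear equation in the third argument of tau. By skew-symmetry
    the pairs in the first two arguments keep their forms, so an equation once solved stays
    solved. *)
Lemma up3_mx_pure A : A \in unitmx -> block_from (D - 2) A -> pass3 A ->
  first_row_pure (D - 2) (up3_mx A *m A).
Proof.
move=> uA Ap [de0 de1]; set A3 := up3_mx A *m A.
have A3E : A3 = up3_Q3 (up3_A2 A) *m up3_A2 A by exact: up3_mxE.
have r0 : row o0 A3 = row o0 (up3_A2 A) + up3_q3 (up3_A2 A) *: row o1 (up3_A2 A).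
  by rewrite A3E row_transvection.
have r1 : row o1 A3 = row o1 (up3_A2 A) by rewrite A3E row_row_op_neq//.
have r2 : row o2 A3 = row o2 (up3_A2 A) by rewrite A3E row_row_op_neq//.
have t12 w : tau (row o1 A3) (row o2 A3) w = tau (row o1 A) (row o2 A) w.
  by rewrite r1 r2 up3_A2_row1 up3_A2_row2 tauP1 tauuu mulr0 addr0.
have t01 w : tau (row o0 A3) (row o1 A3) w =
    tau (row o0 (up3_A2 A)) (row o1 (up3_A2 A)) w.
  by rewrite r0 r1 tauP1 tauuu mulr0 addr0.
have t1 : tau (row o1 A) (row o2 A) (row o1 A3) = 0.
  by rewrite r1 up3_A2_row1 tauP3 /up3_q1 mulfVK// subrr.
apply: up3_pure => //.
- by rewrite unitmx_mul up3_mx_unit.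
- by apply: block_from_mul => //; exact: up3_mx_block.
- rewrite t12 r0 tauP3 -r1 t1 mulr0 addr0 up3_A2_row0 tauP3 up3_q2E /up3_q2.
  by rewrite mulfVK// subrr.
- by rewrite t12 t1.
- by rewrite t12 r2 up3_A2_row2.
- by rewrite t01 r0 tauP3 /up3_q3 mulfVK// subrr.
- by rewrite t01 r1.
Qed.

(* [pass3] with its denominators cleared: [pass3_poly A] is [delta3 A ^+ 3] times
   the value tested by the second condition. *)
Definition delta3 A := tau (row o1 A) (row o2 A) (row o2 A).
Definition pass3_poly A :=
  tau (delta3 A *: row o0 A - tau (row o1 A) (row o2 A) (row o0 A) *: row o2 A)
      (delta3 A *: row o1 A - tau (row o1 A) (row o2 A) (row o1 A) *: row o2 A)
      (delta3 A *: row o1 A - tau (row o1 A) (row o2 A) (row o1 A) *: row o2 A).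

Lemma pass3_of_poly A : delta3 A != 0 -> pass3_poly A != 0 -> pass3 A.
Proof.
move=> de0 po0; split=> //; apply: contraNneq po0; rewrite /pass3_poly.
have -> : delta3 A *: row o0 A - tau (row o1 A) (row o2 A) (row o0 A) *: row o2 A =
    delta3 A *: row o0 (up3_A2 A).
  rewrite up3_A2_row0 scalerDr scalerA up3_q2E /up3_q2 mulrC -mulrA mulVf//.
  by rewrite mulr1 scaleNr.
have -> : delta3 A *: row o1 A - tau (row o1 A) (row o2 A) (row o1 A) *: row o2 A =
    delta3 A *: row o1 (up3_A2 A).
  rewrite up3_A2_row1 scalerDr scalerA /up3_q1 mulrC -mulrA mulVf//.
  by rewrite mulr1 scaleNr.
by rewrite tauZ1 tauZ2 tauZ3 => ->; rewrite !mulr0.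
Qed.

Lemma pass3_example : delta3 1%:M != 0 /\ pass3_poly 1%:M != 0.
Proof.
have row1E (a : 'I_d) : row a (1%:M : 'M[R]_d) = delta_mx 0 a.
  by apply/rowP => j; rewrite !mxE eqxx eq_sym.
have de : delta3 1%:M = 3 by rewrite /delta3 !row1E tau_example.
have t0 (a : 'I_d) : (a < o2)%N -> tau (delta_mx 0 o1) (delta_mx 0 o2) (delta_mx 0 a) = 0 :> R.
  move=> a2; rewrite tau_delta// mxE (negbTE (neq_ord a2)) andbF mulr0 add0r big1 ?mulr0//.
  by move=> c c2; rewrite mxE (negbTE (neq_ord (ltn_trans a2 c2))) andbF.
rewrite /pass3_poly de !row1E !t0// !scale0r !subr0 tauZ1 tauZ2 tauZ3 tau_example// !mulf_neq0 ?pnatr_eq0.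
Qed.

End UpThree.
End LastStages.

(** * One random block makes all remaining stages pass *)

Section Resampling.
Variables (R : realType) (D : nat).
Local Notation d := D.+1.
Local Notation core := (core R d).
Local Notation Rtuple n := (n.-tuple (measurableTypeR R)).
Implicit Types (A : 'M[R]_d).

(** This makes the block of a later stage a function of the current matrix, with entries polynomial
    in those of a random factor, before any intermediate stage is executed. *)
Definition trunc_block p A : 'M[R]_d :=
  \matrix_(i, j) if (p <= i)%N && (p <= j)%N then A i j else (i == j)%:R.

Lemma trunc_block_id p A : block_from p A -> trunc_block p A = A.
Proof.
move=> Ap; apply/matrixP => i j; rewrite mxE; case: ifP => // /negbT.
by rewrite negb_and -!ltnNge => /Ap.
Qed.

Definition pass4 p A := \rank (up_lhs p (congr_tensor A core)) = (D - p)%N.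

(* A stage that does not resample replaces the block by its trailing block;
   after [up3] there is nothing left to resample. *)
Definition no_resampling p A :=
  (forall q, (p <= q)%N -> (q + 3 <= D)%N -> pass4 q (trunc_block q A)) /\
  ((2 <= D)%N -> (p <= D - 2)%N -> pass3 (trunc_block (D - 2) A)).

Lemma no_resampling_ext p A A' : no_resampling p A ->
  (forall i j : 'I_d, (p <= i)%N -> (p <= j)%N -> A' i j = A i j) ->
  no_resampling p A'.
Proof.
move=> [n4 n3] AA'.
have tE q : (p <= q)%N -> trunc_block q A' = trunc_block q A.
  move=> pq; apply/matrixP => i j; rewrite !mxE; case: ifP => // /andP[qi qj].
  by rewrite AA'// (leq_trans pq).
by split=> [q pq q3|D2 pD]; rewrite tE//; [exact: n4|exact: n3].
Qed.

Lemma no_resamplingS p A : no_resampling p A -> no_resampling p.+1 A.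
Proof.
by move=> [n4 n3]; split=> [q pq|D2 pD]; [exact/n4/ltnW|exact/n3/ltnW].
Qed.

Variables (p m : nat).
Hypotheses (pD : (p <= D)%N) (mE : m = (d - p)%N).

Definition block_of_draw (w : Rtuple (m * m)) : 'M[R]_d :=
  \matrix_(i, j) if (p <= i)%N && (p <= j)%N
    then w`_((i - p) * m + (j - p)) else (i == j)%:R.

Lemma block_of_draw_from w : block_from p (block_of_draw w).
Proof.
by move=> i j; rewrite mxE => /orP[]; rewrite ltnNge => /negbTE->; rewrite ?andbF.
Qed.

Lemma block_of_draw_surj (Y : 'M[R]_d) : block_from p Y -> exists w, block_of_draw w = Y.
Proof.
move=> Yp; exists [tuple Y (inord (p + k %/ m)) (inord (p + k %% m)) | k < m * m].
apply/matrixP => i j; rewrite mxE; case: ifP => [/andP[pi pj]|/negbT]; last first.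
  by rewrite negb_and -!ltnNge => /Yp.
have im : (i - p < m)%N by have := ltn_ord i; lia.
have jm : (j - p < m)%N by have := ltn_ord j; lia.
have km : ((i - p) * m + (j - p) < m * m)%N by nia.
rewrite -[X in _`_X]/(val (Ordinal km)) -tnth_nth tnth_mktuple /=.
rewrite modnMDl modn_small// divnMDl ?(leq_ltn_trans _ im)// divn_small// addn0.
by rewrite !subnKC// !inord_val.
Qed.

Variable A : 'M[R]_d.
Hypotheses (uA : A \in unitmx) (Ap : block_from p A).

Lemma polylike_block i j : polylike (fun w => (block_of_draw w *m A) i j).
Proof.
under eq_fun do rewrite mxE.
apply: polylike_sum => k; apply: polylikeM; last exact: polylike_cst.
rewrite (_ : (fun w => _) = fun w : Rtuple (m * m) => if (p <= i)%N && (p <= k)%N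
    then w`_((i - p) * m + (k - p)) else (i == k)%:R); last first.
  by apply/funext => w; rewrite mxE.
by case: (_ && _); [exact: polylike_nth|exact: polylike_cst].
Qed.

Lemma polylike_trunc q i j :
  polylike (fun w => trunc_block q (block_of_draw w *m A) i j).
Proof.
rewrite (_ : (fun w => _) = fun w : Rtuple (m * m) => if (q <= i)%N && (q <= j)%N
    then (block_of_draw w *m A) i j else (i == j)%:R); last first.
  by apply/funext => w; rewrite mxE.
by case: (_ && _); [exact: polylike_block|exact: polylike_cst].
Qed.

Lemma polylike_tau n (u v z : Rtuple n -> 'rV[R]_d) :
  (forall j, polylike (fun w => u w 0 j)) -> (forall j, polylike (fun w => v w 0 j)) ->
  (forall j, polylike (fun w => z w 0 j)) -> polylike (fun w => tau (u w) (v w) (z w)).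
Proof.
move=> up vp zp; apply: polylike_sum => a; apply: polylike_sum => b.
apply: polylike_sum => c; apply: polylikeM => //; apply: polylikeM.
  exact: polylike_cst.
by apply: polylikeB; apply: polylikeM.
Qed.

Lemma polylike_row n (F : Rtuple n -> 'M[R]_d) i j :
  (forall i j, polylike (fun w => F w i j)) -> polylike (fun w => row i (F w) 0 j).
Proof. by move=> Fp; under eq_fun do rewrite mxE. Qed.

(** The draw W = Y A^-1 turns the block into [Y], so one example [Y] serves for every [A]. *)
Lemma generic_nonzero (F : 'M[R]_d -> R) (Y : 'M[R]_d) :
  polylike (fun w => F (block_of_draw w *m A)) -> block_from p Y -> F Y != 0 ->
  generic (fun w => F (block_of_draw w *m A) != 0).
Proof.
move=> Fp Yp FY; exists (fun w => F (block_of_draw w *m A)); split=> //.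
have [w wE] := block_of_draw_surj (block_from_mul Yp (block_from_inv uA Ap)).
by exists w; rewrite wE -mulmxA mulVmx// mulmx1.
Qed.

Lemma generic_unit : generic (fun w => block_of_draw w *m A \in unitmx).
Proof.
have b1 : block_from p (1%:M : 'M[R]_d) by move=> i j _; rewrite mxE.
have := @generic_nonzero (fun M => \det M) 1%:M; rewrite det1 => g1.
apply: generic_sub (g1 _ b1 (oner_neq0 _)) => [w|].
  by rewrite unitmxE unitfE.
by apply: polylike_det => i j; exact: polylike_block.
Qed.

(** Full rank is certified by one polynomial: with [B] a left inverse of the system matrix of the
    example, the determinant of [B] times the system matrix is 1 at the example, and where it is
    nonzero the rank is full. *)
Lemma generic_pass4 q : (p <= q)%N -> (q + 3 <= D)%N ->
  generic (fun w => pass4 q (trunc_block q (block_of_draw w *m A))).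
Proof.
move=> pq q3; have qD : (q < D)%N by lia.
pose E : 'M[R]_d := 1%:M + delta_mx ord_max (inord q).
have Eq : block_from q E.
  move=> i j ij; rewrite !mxE [(_ && _)](_ : _ = false) ?addr0//.
  apply/negbTE; apply: contraL ij => /andP[/eqP-> /eqP->] /=.
  by rewrite inordK//; lia.
have rkE : row_full (up_lhs q (congr_tensor E core)).
  by rewrite /row_full up4_example.
have [B BE] := row_fullP rkE.
pose F M := \det (B *m up_lhs q (congr_tensor (trunc_block q M) core)).
apply: generic_sub (@generic_nonzero F E _ (block_from_le pq Eq) _).
- move=> w; rewrite /F -unitfE -unitmxE => uB; apply/eqP.
  rewrite -[_ == _]/(row_full _); rewrite -sub1mx.
  by apply: submx_trans (submxMl B _); rewrite sub1mx row_full_unit.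
- apply: polylike_det => i j; under eq_fun do rewrite mxE.
  apply: polylike_sum => r; apply: polylikeM; first exact: polylike_cst.
  under eq_fun do rewrite mxE congr_core_skew.
  by apply: polylike_tau => k; apply: polylike_row => *; exact: polylike_trunc.
- by rewrite /F trunc_block_id// BE det1 oner_eq0.
Qed.

Lemma generic_pass3 : (2 <= D)%N -> (p <= D - 2)%N ->
  generic (fun w => pass3 (trunc_block (D - 2) (block_of_draw w *m A))).
Proof.
move=> D2 pD2; have b1 q : block_from q (1%:M : 'M[R]_d) by move=> i j _; rewrite mxE.
have [ex1 ex2] := @pass3_example R D D2.
have Trow k j : polylike (fun w =>
    row (last_ord D k) (trunc_block (D - 2) (block_of_draw w *m A)) 0 j).
  by apply: polylike_row => *; exact: polylike_trunc.
have Ttau a b c : polylike (fun w => let M := trunc_block (D - 2) (block_of_draw w *m A) in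
    tau (row (last_ord D a) M) (row (last_ord D b) M) (row (last_ord D c) M)).
  by apply: polylike_tau => k; exact: Trow.
have g1 : generic (fun w => delta3 (trunc_block (D - 2) (block_of_draw w *m A)) != 0).
  apply: (@generic_nonzero (fun M => delta3 (trunc_block (D - 2) M)) 1%:M) => //.
    exact: Ttau.
  by rewrite trunc_block_id.
have Tlin a c j : polylike (fun w => let M := trunc_block (D - 2) (block_of_draw w *m A) in
    (delta3 M *: row (last_ord D a) M -
     tau (row (last_ord D 1) M) (row (last_ord D 0) M) (row (last_ord D c) M) *:
       row (last_ord D 0) M) 0 j).
  rewrite (_ : (fun w => _) = fun w =>
      let M := trunc_block (D - 2) (block_of_draw w *m A) in
      delta3 M * row (last_ord D a) M 0 j -
      tau (row (last_ord D 1) M) (row (last_ord D 0) M) (row (last_ord D c) M) *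
        row (last_ord D 0) M 0 j); last by apply/funext => w; rewrite /= !mxE.
  apply: polylikeB.
    by apply: polylikeM; [exact: (Ttau 1 0 0)%N|exact: Trow].
  by apply: polylikeM; [exact: (Ttau 1 0 c)%N|exact: Trow].
have g2 : generic (fun w => pass3_poly (trunc_block (D - 2) (block_of_draw w *m A)) != 0).
  apply: (@generic_nonzero (fun M => pass3_poly (trunc_block (D - 2) M)) 1%:M) => //.
    by apply: polylike_tau => k; [exact: (Tlin 2 2)%N|exact: (Tlin 1 1)%N|exact: (Tlin 1 1)%N].
  by rewrite trunc_block_id.
by apply: generic_sub (generic_and g1 g2) => w []; exact: pass3_of_poly.
Qed.

Lemma generic_no_resampling : generic (fun w =>
  block_of_draw w \in unitmx /\ no_resampling p (block_of_draw w *m A)).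
Proof.
have g4 : generic (fun w => forall q, (q < D)%N -> (p <= q)%N -> (q + 3 <= D)%N ->
    pass4 q (trunc_block q (block_of_draw w *m A))).
  apply: (@generic_forall_lt _ _ _ (fun q w => (p <= q)%N -> (q + 3 <= D)%N ->
    pass4 q (trunc_block q (block_of_draw w *m A)))) => q _.
  have [pq|pq] := leqP p q; last by apply: genericT.
  have [q3|q3] := leqP (q + 3) D; last by apply: genericT.
  by apply: generic_sub (generic_pass4 pq q3).
have g3 : generic (fun w => (2 <= D)%N -> (p <= D - 2)%N ->
    pass3 (trunc_block (D - 2) (block_of_draw w *m A))).
  have [D2|D2] := leqP 2 D; last by apply: genericT.
  have [pD2|pD2] := leqP p (D - 2); last by apply: genericT.
  by apply: generic_sub (generic_pass3 D2 pD2).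
apply: generic_sub (generic_and generic_unit (generic_and g4 g3)) => w [].
rewrite unitmx_mul => /andP[uw _] [n4 n3]; split=> //; split=> // q pq q3.
by apply: n4 => //; lia.
Qed.

End Resampling.

(** * Execution of the algorithm *)

(* These products are kept folded so that [lia] treats them as atoms. *)
Definition cost3 (K D : nat) : nat := (K * D.+1 ^ 3)%N.
Definition cost4 (K D : nat) : nat := (K * D.+1 ^ 4)%N.

Section Execution.
Variables (R : realType) (mu : block_law R) (counted stops : Prop).
Variables (K : nat) (L : linalg) (D : nat).
Hypothesis ac : absolutely_continuous mu.
Hypothesis Lspec : linalg_spec mu counted stops K L.
Local Notation triple := (triple mu counted stops).
Local Notation d := D.+1.
Local Notation core := (core R d).
Implicit Types (A X : 'M[R]_d) (env : seq R) (G : rtens) (Y : tensor R d).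

Local Notation d3 := (cost3 1 D).
Local Notation k3 := (cost3 K D).
Local Notation d4 := (cost4 1 D).
Local Notation k4 := (cost4 K D).

Lemma le_d_d3 : [/\ (1 <= d3)%N, (d <= d3)%N & (d ^ 2 <= d3)%N].
Proof.
rewrite /cost3 mul1n; split; first by rewrite expn_gt0.
  by rewrite -{1}[d]expn1 leq_pexp2l.
by rewrite leq_pexp2l.
Qed.

Lemma le_d3_d4 : (d3 <= d4)%N /\ (k3 <= k4)%N.
Proof. by split; rewrite leq_mul2l leq_pexp2l ?orbT. Qed.

Lemma holds_tensor_at env G Y (i j k : 'I_d) (a b c : nat) : holds_tensor env G Y ->
  a = i.+1 -> b = j.+1 -> c = k.+1 -> onth env (G a b c) = Some (Y i j k).
Proof. by move=> H -> -> ->; exact: H. Qed.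

Lemma triple_congr_sparse env W G X Y : holds_mx env W X -> holds_tensor env G Y ->
  (nnz X <= 3 * d)%N -> triple (la_congr L d W G) env (4 * k3)
    (fun G' env' => holds_tensor env' G' (congr_tensor X Y)).
Proof.
move=> HW HG Xn; apply: triple_cost (spec_congr Lspec HW HG) _ => _.
have -> : (4 * k3 = K * (4 * d) * d ^ 2)%N by rewrite /cost3 expnS; ring.
by rewrite leq_mul2r leq_mul2l; apply/orP; right; apply/orP; right; lia.
Qed.

Lemma triple_congr_dense env W G X Y : holds_mx env W X -> holds_tensor env G Y ->
  triple (la_congr L d W G) env (2 * k4)
    (fun G' env' => holds_tensor env' G' (congr_tensor X Y)).
Proof.
move=> HW HG; apply: triple_cost (spec_congr Lspec HW HG) _ => _.
have -> : (2 * k4 = K * (2 * d ^ 2) * d ^ 2)%N by rewrite /cost4 (expnD d 2 2); ring.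
have := nnz_le X; have : (d <= d ^ 2)%N by rewrite -{1}[d]expn1 leq_pexp2l.
by rewrite leq_mul2r leq_mul2l => ? ?; apply/orP; right; apply/orP; right; lia.
Qed.

Lemma triple_mul env C B X (Z : 'M[R]_d) : holds_mx env C X -> holds_mx env B Z ->
  triple (la_mul L d C B) env k3 (fun W env' => holds_mx env' W (X *m Z)).
Proof. exact: spec_mul. Qed.

Lemma triple_lower p env y (f : 'I_d -> R) : (p <= D)%N ->
  (forall i : 'I_d, (p < i)%N -> onth env (y (i - p)%N) = Some (f i)) ->
  triple (lower p.+1 y) env 0 (fun W env' => holds_mx env' W (clear_col (@inord D p) f)).
Proof.
move=> pD Hy; apply: triple_bind (triple_id_prog _ _ _ _ 0) _ _ => // I e pre HI.
apply: triple_ret => i j; rewrite mxE -val_eqE/= inordK// eqSS ltnS.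
by case: ifP => [/andP[_ pi]|_]; [exact: onth_prefix pre (Hy i pi)|rewrite HI eqSS].
Qed.

Lemma triple_upper p env x (f : 'I_d -> R) : (p <= D)%N ->
  (forall i : 'I_d, (p < i)%N -> onth env (x (i - p)%N) = Some (f i)) ->
  triple (upper p.+1 x) env 0 (fun W env' => holds_mx env' W (row_op (@inord D p) f)).
Proof.
move=> pD Hx; apply: triple_bind (triple_id_prog _ _ _ _ 0) _ _ => // I e pre HI.
apply: triple_ret => i j; rewrite mxE -val_eqE/= inordK// eqSS ltnS.
by case: ifP => [/andP[_ pj]|_]; [exact: onth_prefix pre (Hx j pj)|rewrite HI eqSS].
Qed.

Lemma triple_diagonal p env h (x : R) : (p <= D)%N -> onth env h = Some x ->
  triple (Defs.diagonal p.+1 h) env 1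
    (fun W env' => holds_mx env' W (scale_first (@inord D p) (cbrt x))).
Proof.
move=> pD Hh; apply: triple_bind (triple_id_prog _ _ _ _ 0) _ _ => // I e pre HI.
apply: triple_bind (triple_cbrt (onth_prefix pre Hh)) _ _ => // c e1 pre1 Hc.
apply: triple_ret => i j; rewrite mxE -!val_eqE/= inordK// !eqSS.
by case: ifP => // _; rewrite (onth_prefix pre1 (HI _ _)) eqSS.
Qed.

Lemma triple_transvection (a b : 'I_d) (a1 b1 : nat) env q (x : R) : (a < b)%N ->
  a1 = a.+1 -> b1 = b.+1 -> onth env q = Some x ->
  triple (transvection a1 b1 q) env 0
    (fun W env' => holds_mx env' W (transvection_mx a b x)).
Proof.
move=> ab -> -> Hq; apply: triple_bind (triple_id_prog _ _ _ _ 0) _ _ => // I e pre HI.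
apply: triple_ret => i j; rewrite mxE -!val_eqE/= !eqSS.
case: eqVneq => [ia|_] /=; last by rewrite HI eqSS.
case: eqVneq => [->|jb] /=; first by rewrite ab mulr1n (onth_prefix pre Hq).
by rewrite HI eqSS; case: ifP => // aj; rewrite mulr0n ia lt_eqF.
Qed.

Lemma triple_transposition (a b : 'I_d) (a1 b1 : nat) env :
  a1 = a.+1 -> b1 = b.+1 ->
  triple (transposition a1 b1) env 0
    (fun W env' => holds_mx env' W (tperm_mx a b : 'M[R]_d)).
Proof.
move=> -> ->; apply: triple_bind (triple_id_prog _ _ _ _ 0) _ _ => // I e pre HI.
apply: triple_ret => i j; rewrite !mxE !eqSS.
rewrite -[((i : nat) == a)%N]/(i == a) -[((i : nat) == b)%N]/(i == b).
have -> : (if i == a then b.+1 else if i == b then a.+1 else i.+1) = (tperm a b i).+1.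
  by rewrite permE /=; case: ifP => // _; case: ifP.
by rewrite HI eqSS.
Qed.

Lemma row_tperm_mx (a b : 'I_d) A i : row i (tperm_mx a b *m A) = row (tperm a b i) A.
Proof. by rewrite -xrowE; apply/rowP => j; rewrite !mxE. Qed.

Lemma tperm_mx_block p (a b : 'I_d) : (p <= a)%N -> (p <= b)%N ->
  block_from p (tperm_mx a b : 'M[R]_d).
Proof.
move=> pa pb i j ij; rewrite !mxE; have [ip|pi] := ltnP i p.
  by rewrite tpermD// -val_eqE/= gtn_eqF// (leq_trans ip).
have jp : (j < p)%N by case/orP: ij => //; rewrite ltnNge pi.
have nej (k : 'I_d) : (p <= k)%N -> (k == j) = false.
  by move=> pk; apply/negbTE; rewrite -val_eqE/= gtn_eqF// (leq_trans jp).
rewrite [i == j]nej//; case: tpermP => _; rewrite ?nej//.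
Qed.

Lemma triple_quotient env a1 a2 b1 b2 (x1 x2 y1 y2 : R) :
  onth env a1 = Some x1 -> onth env a2 = Some x2 ->
  onth env b1 = Some y1 -> onth env b2 = Some y2 -> y1 - y2 != 0 ->
  triple (quotient a1 a2 b1 b2) env 3
    (fun r env' => onth env' r = Some ((x1 - x2) / (y1 - y2))).
Proof.
move=> Ha1 Ha2 Hb1 Hb2 y0.
apply: triple_bind (triple_arith2 Ha1 Ha2 _) _ _ => // a e1 pre1 Ha.
apply: triple_bind (triple_arith2 (onth_prefix pre1 Hb1) (onth_prefix pre1 Hb2) _) _ _ => //.
by move=> b e2 pre2 Hb; apply: triple_arith2 (onth_prefix pre2 Ha) Hb _ => _.
Qed.

Lemma triple_random_block p env A : (p <= D)%N -> A \in unitmx -> block_from p A ->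
  triple (random_block d p.+1) env d3 (fun W env' => exists X,
    [/\ holds_mx env' W X, X \in unitmx, block_from p X & no_resampling p (X *m A)]).
Proof.
move=> pD uA Ap; have mE : (d - p.+1 + 1 = d - p)%N by cost_lia.
apply: triple_bind (triple_id_prog _ _ _ _ 0) _ _ => // I e1 pre1 HI.
apply: triple_bind (triple_draw ac (generic_no_resampling pD mE uA Ap)) _ _.
  have [_ _ d2] := le_d_d3.
  by move=> _; rewrite (leq_trans _ d2)// -mulnn leq_mul// mE leq_subr.
move=> w e2 pre2 [t [uW nW] Ht]; apply: triple_ret.
exists (block_of_draw D p t); split=> //; last exact: block_of_draw_from.
move=> i j; rewrite mxE !ltnS; case: ifP => [/andP[pi pj]|_]; last first.
  by rewrite (onth_prefix pre2 (HI _ _)) eqSS.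
have im : (i - p < d - p.+1 + 1)%N by have := ltn_ord i; lia.
have jm : (j - p < d - p.+1 + 1)%N by have := ltn_ord j; lia.
rewrite -(Ht (Ordinal im) (Ordinal jm)) /=; congr (onth _ (w _ _)); lia.
Qed.

(** * The up-steps as programs *)

Section UpPrograms.
Variables (p : nat) (A : 'M[R]_d).
Hypotheses (uA : A \in unitmx) (Ap : block_from p A).

(** One level of the recursion, with the branch after a failed test abstracted as [retry]: one
    analysis covers both the run that passes and the one that resamples. *)
Definition up_ge4_body (retry : prog rmx) (G : rtens) : prog rmx :=
  let s := p.+1 in let n := (d - s)%N in
  let* M := up_ge4_lhs G s n in
  let* B := up_ge4_rhs G s n in
  let* rM := la_rank L (n * n) n M in
  let* rMB := la_rank L (n * n) n.+1
                (fun i j => if (j <= n)%N then M i j else B i) in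
  if (rM == n) && (rMB == n) then
    let* x := la_solve L (n * n) n M B in upper s x
  else retry.

(** The two ranks and the solve take 2, 3 and 2 units of [k3]; forming the matrix and the right-hand
    side takes one [d3] each. *)
Lemma triple_up_ge4_body retry env G c (Q : rmx -> seq R -> Prop) : (p < D)%N ->
  holds_tensor env G (congr_tensor A core) ->
  (~ pass4 p A -> forall env', prefix env env' -> triple retry env' c Q) ->
  (pass4 p A -> forall U env' f, prefix env env' -> holds_mx env' U (row_op (inord p) f) ->
    first_row_pure p (row_op (inord p) f *m A) -> Q U env') ->
  triple (up_ge4_body retry G) env (7 * k3 + 2 * d3 + c) Q.
Proof.
move=> pD HG Qretry Qpass; rewrite /up_ge4_body subSS; set n := (D - p)%N.
set Y := congr_tensor A core in HG *.
have nd : (n.+1 <= d)%N by rewrite /n; lia.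
have fstE (r : 'I_(n * n)) : (row_fst n r.+1 + p.+1)%N = (pair_fst r).+1.
  rewrite /row_fst subn1 val_shift_ord ?addSn ?addnS 1?addnC ?addSn//.
  by rewrite ltn_divLR// subn_gt0.
have sndE (r : 'I_(n * n)) : (row_snd n r.+1 + p.+1)%N = (pair_snd r).+1.
  rewrite /row_snd subn1 val_shift_ord ?addSn ?addnS 1?addnC ?addSn//.
  by rewrite ltn_mod subn_gt0.
have shE (k : 'I_n) : (k.+1 + p.+1)%N = (shift_ord D p k).+1.
  by rewrite val_shift_ord// addSn addnC.
have e3 : (n ^ 3 <= d3)%N by rewrite /cost3 mul1n leq_exp2r// ltnW.
have e3' : (n.+1 ^ 3 <= d3)%N by rewrite /cost3 mul1n leq_exp2r.
have e2 : (n * n * n.+1 <= d3)%N.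
  by rewrite /cost3 mul1n !expnS expn0 muln1 mulnA leq_mul// leq_mul// ltnW.
have e2' : (n * n * n.+2 <= 2 * d3)%N.
  have e2'' : (n * n <= d3)%N by apply: leq_trans e2; rewrite leq_pmulr.
  by rewrite mulnS; lia.
have tl : triple (up_ge4_lhs G p.+1 n) env d3 (fun M env' =>
    holds_mx env' M (up_lhs p Y)).
  apply: triple_cost (triple_tabulate_mx (c := fun=> 1%N) (x := fun i j => up_lhs p Y i j) _) _.
    move=> r c0 e pre; have H := holds_tensor_prefix pre HG.
    apply: triple_post (triple_arith2
      (holds_tensor_at H (fstE r) (sndE r) (shE c0))
      (holds_tensor_at H (sndE r) (fstE r) (shE c0)) _) _ => //.
    by move=> x e' _ ->; rewrite mxE.
  by move=> _; rewrite sum_nat_const card_ord; apply: leq_trans e3; rewrite !expnS expn0 !muln1 mulnA.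
have fE : p.+1 = (first_ord D p).+1 by rewrite val_first_ord.
apply: triple_bind tl _ _ => [_|M e1 pre1 HM]; first by cost_lia.
have tr : triple (up_ge4_rhs G p.+1 n) e1 d3 (fun B env' => holds_vec env' B (up_rhs p Y)).
  apply: triple_cost (triple_tabulate_vec (c := 1%N) (x := fun i => up_rhs p Y i 0) _) _.
    move=> r e pre; have H := holds_tensor_prefix (prefix_trans pre1 pre) HG.
    apply: triple_post (triple_arith2
      (holds_tensor_at H (sndE r) (fstE r) fE)
      (holds_tensor_at H (fstE r) (sndE r) fE) _) _ => //.
    by move=> x e' _ ->; rewrite mxE.
  by move=> _; rewrite muln1; apply: leq_trans e2; rewrite leq_pmulr.
apply: triple_bind tr _ _ => [_|B e2e pre2 HB]; first by cost_lia.
have {}HM := holds_mx_prefix pre2 HM.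
have tk (m0 n0 : nat) (x y z : nat) : (m0 * n0.+1 <= x * d3)%N -> (n0 ^ 3 <= y * d3)%N ->
    (x + y <= z)%N -> (K * (m0 * n0.+1 + n0 ^ 3) <= z * k3)%N.
  move=> h1 h2 h3; have -> : (z * k3 = K * (z * d3))%N by rewrite /cost3; ring.
  rewrite leq_mul2l; apply/orP; right.
  by apply: leq_trans (leq_add h1 h2) _; rewrite -mulnDl leq_mul2r h3 orbT.
apply: triple_bind (triple_cost (c' := (2 * k3)%N) (spec_rank Lspec HM) _) _ _.
- by move=> _; apply: (tk _ _ 1 1)%N; rewrite ?mul1n.
- by move=> _; cost_lia.
move=> rM e4 pre4 ->.
pose MB := \matrix_(i < n * n, j < n.+1)
  (if insub (j : nat) is Some k then up_lhs p Y i k else up_rhs p Y i 0).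
have HMB : holds_mx e4 (fun i j => if (j <= n)%N then M i j else B i) MB.
  move=> i j; rewrite mxE; case: insubP => [k jn kj|jn].
    by rewrite jn -kj (onth_prefix pre4 (HM i k)).
  by rewrite (negbTE jn) (onth_prefix pre4 (HB i)).
apply: triple_bind (triple_cost (c' := (3 * k3)%N) (spec_rank Lspec HMB) _) _ _.
- by move=> _; apply: (tk _ _ 2 1)%N; rewrite ?mul1n.
- by move=> _; cost_lia.
move=> rMB e5 pre5 ->.
have pre05 : prefix env e5.
  exact: prefix_trans (prefix_trans pre1 pre2) (prefix_trans pre4 pre5).
have [p4|np4] := eqVneq (\rank (up_lhs p Y)) n; last first.
  rewrite /=; apply: triple_cost (Qretry _ _ pre05) _; first exact/eqP.
  by move=> _; cost_lia.
have [x [t [xB xt]]] := up4_solution pD uA Ap p4.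
(* The system is consistent, so appending the right-hand side adds no rank: each of the two matrices
   is a multiple of the other. *)
have rMBn : \rank MB = n.
  pose lft : 'M[R]_(n, n.+1) := \matrix_(i, j)
    if insub (j : nat) is Some k then (i == k)%:R else x i 0.
  have MBE : MB = up_lhs p Y *m lft.
    apply/matrixP => i j; rewrite [RHS]mxE; under eq_bigr do rewrite [lft _ _]mxE.
    rewrite [LHS]mxE; case: insubP => [k jn kj|jn].
      by rewrite (bigD1 k)//= eqxx mulr1 big1 ?addr0// => l /negbTE->; rewrite mulr0.
    by rewrite -xB mxE.
  pose rgt : 'M[R]_(n.+1, n) := \matrix_(i, j) ((i : nat) == j)%:R.
  have ME : up_lhs p Y = MB *m rgt.
    apply/matrixP => i j; rewrite [RHS]mxE (bigD1 (widen_ord (leqnSn n) j))//= big1 ?addr0.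
      rewrite [rgt _ _]mxE/= eqxx mulr1 [MB _ _]mxE.
      by case: insubP => [k _ kj|]; [congr (up_lhs _ _ _ _); exact: val_inj|rewrite /= ltn_ord].
    by move=> l lj; rewrite [rgt _ _]mxE (negbTE (lj : (l : nat) != j)) mulr0.
  have le1 : (\rank MB <= \rank (up_lhs p Y))%N by rewrite MBE mxrankM_maxl.
  have le2 : (\rank (up_lhs p Y) <= \rank MB)%N by rewrite {1}ME mxrankM_maxl.
  by apply/eqP; rewrite eqn_leq -[X in (_ <= X)%N && _]p4 le1 -[X in (X <= _)%N]p4.
rewrite rMBn eqxx /=.
rewrite -xB in HB.
have pre25 := prefix_trans pre4 pre5.
apply: triple_bind (triple_cost (c' := (2 * k3)%N)
  (spec_solve Lspec (holds_mx_prefix pre25 HM) (holds_vec_prefix pre25 HB) p4) _) _ _.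
- by move=> _; apply: (tk _ _ 1 1)%N; rewrite ?mul1n.
- by move=> _; cost_lia.
move=> v e6 pre6 Hv.
(* For j <= p the truncated subtraction yields the first entry of [x]; [row_op] reads [f] beyond [p]
   only. *)
pose f (j : 'I_d) := if insub (j - p.+1)%N is Some k then x k 0 else 0.
have fsh (k : 'I_n) : f (shift_ord D p k) = x k 0.
  rewrite /f val_shift_ord// addKn; case: insubP => [k' _ kk'|]; last by rewrite ltn_ord.
  by congr (x _ 0); exact: val_inj.
apply: (triple_cost (c := 0)) => //.
apply: triple_post (triple_upper (f := f) (ltnW pD) _) _.
  move=> i pi; have kn : (i - p.+1 < n)%N by have := ltn_ord i; rewrite /n; lia.
  rewrite (_ : (i - p)%N = (Ordinal kn).+1); last by rewrite /=; lia.
  by rewrite Hv -fsh; congr (Some (f _)); apply: val_inj; rewrite /= val_shift_ord//=; lia.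
move=> U e7 pre7 HU; apply: (Qpass p4 _ _ f) => //.
  exact: prefix_trans pre05 (prefix_trans pre6 pre7).
apply: (first_row_pureP (a0 := inord p) (t := t)); first by rewrite inordK// ltnW.
rewrite row_row_op inordK ?ltnS 1?ltnW// sum_shift_ord -xt; congr (_ + _).
by apply: eq_bigr => k _; rewrite fsh.
Qed.

End UpPrograms.
End Execution.

Arguments triple_quotient {R mu counted stops env a1 a2 b1 b2 x1 x2 y1 y2}.
Arguments triple_transvection {R mu counted stops D a b a1 b1 env q x}.
Arguments triple_upper {R mu counted stops D p env x f}.
Arguments triple_lower {R mu counted stops D p env y f}.
Arguments triple_diagonal {R mu counted stops D p env h x}.
Arguments triple_transposition {R mu counted stops D a b a1 b1 env}.
Arguments triple_random_block {R mu counted stops D} _ {p env A}.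

Section Recovery.
Variables (R : realType) (mu : block_law R) (counted stops : Prop).
Variables (K : nat) (L : linalg) (D : nat).
Hypothesis ac : absolutely_continuous mu.
Hypothesis Lspec : linalg_spec mu counted stops K L.
Local Notation triple := (triple mu counted stops).
Local Notation d := D.+1.
Local Notation core := (core R d).
Implicit Types (A X : 'M[R]_d) (env : seq R) (G : rtens) (Y : tensor R d).

Local Notation d3 := (cost3 1 D).
Local Notation k3 := (cost3 K D).
Local Notation d4 := (cost4 1 D).
Local Notation k4 := (cost4 K D).
Local Notation o0 := (last_ord D 2).
Local Notation o1 := (last_ord D 1).
Local Notation o2 := (last_ord D 0).

Definition up3_body (retry : prog rmx) (G : rtens) : prog rmx :=
  let d1 := (d - 1)%N in let d2 := (d - 2)%N in
  let* t1 := test Eq (G d1 d d) (G d d1 d) in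
  if t1 then retry else
  let* q1 := quotient (G d d1 d1) (G d1 d d1) (G d1 d d) (G d d1 d) in
  let* Q1 := transvection d1 d q1 in
  let* G1 := la_congr L d Q1 G in
  let* q2 := quotient (G1 d d1 d2) (G1 d1 d d2) (G1 d1 d d) (G1 d d1 d) in
  let* Q2 := transvection d2 d q2 in
  let* G2 := la_congr L d Q2 G1 in
  let* t2 := test Eq (G2 d2 d1 d1) (G2 d1 d2 d1) in
  if t2 then retry else
  let* q3 := quotient (G2 d1 d2 d2) (G2 d2 d1 d2) (G2 d2 d1 d1) (G2 d1 d2 d1) in
  let* Q3 := transvection d2 d1 q3 in
  let* G3 := la_congr L d Q3 G2 in
  let* z := const 0 in
  let* t3 := test Eq (G3 d2 d2 d2) z in
  if t3 then retry else
  let* Q32 := la_mul L d Q3 Q2 in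
  la_mul L d Q32 Q1.

Lemma nnz_transvection (a b : 'I_d) (q : R) : (nnz (transvection_mx a b q) <= 3 * d)%N.
Proof.
apply: (@nnz_rows _ _ a a) => i j; rewrite mxE orbb.
by have [|ia] := eqVneq i a; rewrite ?orbT//= orbF; have [//|ij] := eqVneq i j; rewrite eqxx.
Qed.

(** Three sparse congruences at 4 [k3] and two products give 14 [k3]; the three tests and three
    quotients amount to 12 operations. *)
Lemma triple_up3_body A retry env G c (Q : rmx -> seq R -> Prop) : (2 <= D)%N ->
  A \in unitmx -> block_from (D - 2) A ->
  holds_tensor env G (congr_tensor A core) ->
  (~ pass3 A -> forall env', prefix env env' -> triple retry env' c Q) ->
  (pass3 A -> forall U env', prefix env env' -> holds_mx env' U (up3_mx A) -> Q U env') ->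
  triple (up3_body retry G) env (14 * k3 + 14 * d3 + c) Q.
Proof.
move=> D2 uA Ap HG Qretry Qpass; rewrite /up3_body.
have [d31 _ _] := le_d_d3 D.
have o01 : (o0 < o1)%N by rewrite !val_last_ord; lia.
have o12 : (o1 < o2)%N by rewrite !val_last_ord; lia.
have o02 : (o0 < o2)%N by rewrite !val_last_ord; lia.
have E1 : (d - 1 = o1.+1)%N by rewrite val_last_ord; lia.
have E2 : (d - 2 = o0.+1)%N by rewrite val_last_ord; lia.
have E0 : d = o2.+1 by rewrite val_last_ord; lia.
have at_ (e : seq R) G' B (i j k : 'I_d) a b c' : holds_tensor e G' (congr_tensor B core) ->
  a = i.+1 -> b = j.+1 -> c' = k.+1 -> onth e (G' a b c') = Some (congr_tensor B core i j k).
  exact: holds_tensor_at.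
have skew B i j k : congr_tensor B core i j k - congr_tensor B core j i k =
  tau (row i B) (row j B) (row k B) by exact: congr_core_skew.
have skewN B i j k : congr_tensor B core j i k - congr_tensor B core i j k =
  - tau (row i B) (row j B) (row k B) by rewrite -opprB skew.
apply: triple_bind (triple_test (at_ _ _ _ _ _ _ _ _ _ HG E1 E0 E0)
  (at_ _ _ _ _ _ _ _ _ _ HG E0 E1 E0)) _ _ => [_|t1 e1 pre1 ->]; first by (clear -d31; cost_lia).
rewrite [eval_comparison _ _ _]/= -subr_eq0 (skew A o1 o2 o2).
case: ifPn => [t0|nz1].
  apply: triple_cost (Qretry _ _ pre1) _ => [[]|_]; last by (clear -d31; cost_lia).
  by rewrite t0.
have {}HG := holds_tensor_prefix pre1 HG.
apply: triple_bind (triple_quotient (at_ _ _ _ _ _ _ _ _ _ HG E0 E1 E1)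
  (at_ _ _ _ _ _ _ _ _ _ HG E1 E0 E1) (at_ _ _ _ _ _ _ _ _ _ HG E1 E0 E0)
  (at_ _ _ _ _ _ _ _ _ _ HG E0 E1 E0) _) _ _; [by rewrite skew|by (clear -d31; cost_lia)|].
move=> q1 e2 pre2; rewrite (skew A o1 o2 o2) (skewN A o1 o2 o1) -/(up3_q1 A) => Hq1.
apply: triple_bind (triple_transvection o12 E1 E0 Hq1) _ _ => //.
rewrite -/(up3_Q1 A) subn0 => Q1 e3 pre3 HQ1.
have pre13 := prefix_trans pre2 pre3.
apply: triple_bind (triple_congr_sparse Lspec HQ1 (holds_tensor_prefix pre13 HG)
  (nnz_transvection _ _ _)) _ _ => [_|]; first by (clear -d31; cost_lia).
rewrite -congr_tensor_mul -/(up3_A1 A) => G1 e4 pre4 HG1.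
have nz1' : tau (row o1 (up3_A1 A)) (row o2 (up3_A1 A)) (row o2 (up3_A1 A)) != 0.
  by rewrite up3_A1_tau// up3_A1_row2.
apply: triple_bind (triple_quotient (at_ _ _ _ _ _ _ _ _ _ HG1 E0 E1 E2)
  (at_ _ _ _ _ _ _ _ _ _ HG1 E1 E0 E2) (at_ _ _ _ _ _ _ _ _ _ HG1 E1 E0 E0)
  (at_ _ _ _ _ _ _ _ _ _ HG1 E0 E1 E0) _) _ _; [by rewrite skew|by (clear -d31; cost_lia)|].
move=> q2 e5 pre5; rewrite (skew _ o1 o2 o2) (skewN _ o1 o2 o0).
rewrite -/(up3_q2 (up3_A1 A)) => Hq2.
apply: triple_bind (triple_transvection o02 E2 E0 Hq2) _ _ => //.
rewrite -/(up3_Q2 (up3_A1 A)) subn0 => Q2 e6 pre6 HQ2.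
have pre46 := prefix_trans pre5 pre6.
apply: triple_bind (triple_congr_sparse Lspec HQ2 (holds_tensor_prefix pre46 HG1)
  (nnz_transvection _ _ _)) _ _ => [_|]; first by (clear -d31; cost_lia).
rewrite -congr_tensor_mul -/(up3_A2 A) => G2 e7 pre7 HG2.
apply: triple_bind (triple_test (at_ _ _ _ _ _ _ _ _ _ HG2 E2 E1 E1)
  (at_ _ _ _ _ _ _ _ _ _ HG2 E1 E2 E1)) _ _ => [_|t2 e8 pre8 ->]; first by (clear -d31; cost_lia).
have pre18 : prefix env e8.
  apply: prefix_trans (prefix_trans pre1 pre13) (prefix_trans pre4 (prefix_trans pre46 _)).
  exact: prefix_trans pre7 pre8.
rewrite [eval_comparison _ _ _]/= -subr_eq0 (skew _ o0 o1 o1).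
case: ifPn => [t0|nz2].
  apply: triple_cost (Qretry _ _ pre18) _ => [[_]|_]; last by (clear -d31; cost_lia).
  by rewrite t0.
have p3 : pass3 A by split.
have {}HG2 := holds_tensor_prefix pre8 HG2.
apply: triple_bind (triple_quotient (at_ _ _ _ _ _ _ _ _ _ HG2 E1 E2 E2)
  (at_ _ _ _ _ _ _ _ _ _ HG2 E2 E1 E2) (at_ _ _ _ _ _ _ _ _ _ HG2 E2 E1 E1)
  (at_ _ _ _ _ _ _ _ _ _ HG2 E1 E2 E1) _) _ _; [by rewrite skew|by (clear -d31; cost_lia)|].
move=> q3 e9 pre9; rewrite (skew _ o0 o1 o1) (skewN _ o0 o1 o0).
rewrite -/(up3_q3 (up3_A2 A)) => Hq3.
apply: triple_bind (triple_transvection o01 E2 E1 Hq3) _ _ => //.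
rewrite -/(up3_Q3 (up3_A2 A)) subn0 => Q3 e10 pre10 HQ3.
have pre810 := prefix_trans pre9 pre10.
apply: triple_bind (triple_congr_sparse Lspec HQ3 (holds_tensor_prefix pre810 HG2)
  (nnz_transvection _ _ _)) _ _ => [_|]; first by (clear -d31; cost_lia).
rewrite -congr_tensor_mul -up3_mxE => G3 e11 pre11 HG3.
apply: triple_bind (triple_const (c := 0)) _ _ => // z e12 pre12 Hz.
apply: triple_bind (triple_test (at_ _ _ _ _ _ _ _ _ _ (holds_tensor_prefix pre12 HG3) E2 E2 E2)
  Hz) _ _ => [_|t3 e13 pre13' ->]; first by (clear -d31; cost_lia).
(* The third test reads the cube of the diagonal entry of a pure row of an invertible matrix, so it
   cannot fail here. *)
have pure := up3_mx_pure D2 uA Ap p3.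
have v0 : (o0 : nat) = (D - 2)%N by exact: val_last_ord.
have uA3 : up3_mx A *m A \in unitmx by rewrite unitmx_mul up3_mx_unit.
have A00 := pure_row_neq0 v0 uA3 pure.
rewrite [eval_comparison _ _ _]/= (congr_core_first v0)// -exprSr expf_eq0 (negbTE A00) andbF.
have pre813 : prefix e10 e13 by exact: prefix_trans pre11 (prefix_trans pre12 pre13').
have pre613 : prefix e6 e13.
  exact: prefix_trans pre7 (prefix_trans pre8 (prefix_trans pre810 pre813)).
have pre313 : prefix e3 e13 by exact: prefix_trans pre4 (prefix_trans pre46 pre613).
apply: triple_bind (triple_mul Lspec (holds_mx_prefix pre813 HQ3) (holds_mx_prefix pre613 HQ2)) _ _.
  by move=> _; (clear -d31; cost_lia).
move=> Q32 e14 pre14 HQ32.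
apply: triple_weaken (triple_mul Lspec HQ32 (holds_mx_prefix (prefix_trans pre313 pre14) HQ1)) _ _.
  by move=> _; (clear -d31; cost_lia).
move=> U e15 pre15 HU; apply: Qpass => //.
apply: prefix_trans (prefix_trans pre1 pre13) (prefix_trans pre313 _).
exact: prefix_trans pre14 pre15.
Qed.

Definition up_result p A Z (U : rmx) env : Prop :=
  [/\ holds_mx env U Z, Z \in unitmx, block_from p Z & first_row_pure p (Z *m A)].

(** A direct up-matrix is sparse and preserves the later tests. After resampling sparsity is lost,
    but the later tests hold unconditionally, which [up_resampled] records. *)
Definition up_direct p A (U : rmx) env : Prop := exists Z,
  [/\ up_result p A Z U env, (nnz Z <= 3 * d)%N
    & no_resampling p A -> no_resampling p.+1 (Z *m A)].

Definition up_resampled p A (U : rmx) env : Prop := exists Z,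
  up_result p A Z U env /\ no_resampling p.+1 (Z *m A).

(** Almost surely the draw makes the current test and all later ones pass. The inner call is
    therefore analysed only on blocks that pass, and the chain of resamplings has length one. *)
Lemma triple_resample p A (up' : rtens -> prog rmx) env G c : (p <= D)%N ->
  A \in unitmx -> block_from p A -> holds_tensor env G (congr_tensor A core) ->
  (forall B G' env', B \in unitmx -> block_from p B -> no_resampling p B ->
    holds_tensor env' G' (congr_tensor B core) ->
    triple (up' G') env' c (up_direct p B)) ->
  triple (resample L d up' p.+1 G) env (d3 + 2 * k4 + c + k3) (up_resampled p A).
Proof.
move=> pD uA Ap HG Hup; 
apply: triple_bind (triple_random_block ac pD uA Ap) _ _ => [_|W e1 pre1].
  by cost_lia.
move=> [X [HW uX Xp nX]].
apply: triple_bind (triple_congr_dense Lspec HW (holds_tensor_prefix pre1 HG)) _ _ => [_|].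
  by cost_lia.
rewrite -congr_tensor_mul => G' e2 pre2 HG'.
apply: triple_bind (Hup _ _ _ _ _ nX HG') _ _.
- by rewrite unitmx_mul uX.
- exact: block_from_mul.
- by move=> _; cost_lia.
move=> U e3 pre3 [Z [[HU uZ Zp Zpure] _ nZ]].
apply: triple_weaken (triple_mul Lspec HU (holds_mx_prefix (prefix_trans pre2 pre3) HW)) _ _.
  by move=> _; cost_lia.
move=> V e4 _ HV; exists (Z *m X); rewrite /up_result -mulmxA; split; last exact: nZ.
by split=> //; [rewrite unitmx_mul uZ|exact: block_from_mul].
Qed.

Lemma row_op_keeps p A f : (p <= D)%N -> no_resampling p A ->
  no_resampling p.+1 (row_op (inord p) f *m A).
Proof.
move=> pD /no_resamplingS nA; apply: no_resampling_ext nA _ => i j pi pj.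
have := @row_row_op_neq _ _ (inord p) f A i.
rewrite -val_eqE/= inordK// gtn_eqF// => /(_ isT)/rowP/(_ j).
by rewrite !mxE.
Qed.

Lemma no_resampling_late p A : (D < p + 2)%N -> no_resampling p A.
Proof. by move=> pD; split=> [q pq q3|D2 pD2]; exfalso; lia. Qed.

Lemma up_direct_row_op p A U env f : (p <= D)%N -> holds_mx env U (row_op (inord p) f) ->
  first_row_pure p (row_op (inord p) f *m A) -> up_direct p A U env.
Proof.
move=> pD HU pure; exists (row_op (inord p) f); split.
- by split=> //; [exact: row_op_unit|apply: row_op_block; rewrite inordK].
- apply: (@nnz_rows _ _ (inord p) (inord p)) => i j; rewrite mxE orbb.
  by have [|ia] := eqVneq i (inord p); rewrite ?orbT//= orbF;
    have [//|ij] := eqVneq i j; rewrite eqxx.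
- exact: row_op_keeps.
Qed.

Lemma up_ge4_unfold N p G : up_ge4 L d N p.+1 G = up_ge4_body L D p
  (if N is N'.+1 then resample L d (up_ge4 L d N' p.+1) p.+1 G else Stop) G.
Proof. by case: N. Qed.

Lemma up3_unfold N G : up3 L d N G = up3_body
  (if N is N'.+1 then resample L d (up3 L d N') (d - 2) G else Stop) G.
Proof. by case: N. Qed.

Lemma triple_up_ge4 N p A env G : (p + 3 <= D)%N -> A \in unitmx -> block_from p A ->
  pass4 p A -> holds_tensor env G (congr_tensor A core) ->
  triple (up_ge4 L d N p.+1 G) env (14 * k3 + 14 * d3) (up_direct p A).
Proof.
move=> p3 uA Ap p4 HG; rewrite up_ge4_unfold; have pD : (p < D)%N by lia.
apply: triple_cost (triple_up_ge4_body Lspec uA Ap (c := 0) pD HG _ _) _ => [//|_ U e f _|].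
  by apply: up_direct_row_op; exact: ltnW.
by move=> _; cost_lia.
Qed.

Lemma triple_up3 N A env G : (2 <= D)%N -> A \in unitmx -> block_from (D - 2) A ->
  pass3 A -> holds_tensor env G (congr_tensor A core) ->
  triple (up3 L d N G) env (14 * k3 + 14 * d3) (up_direct (D - 2) A).
Proof.
move=> D2 uA Ap p3 HG; rewrite up3_unfold.
apply: triple_cost (triple_up3_body (c := 0) D2 uA Ap HG _ _) _ => [//|_ U e _ HU|].
  exists (up3_mx A); split; last by move=> _; apply: no_resampling_late; lia.
    by split=> //; [exact: up3_mx_unit|exact: up3_mx_block|exact: up3_mx_pure].
  exact: up3_mx_nnz.
by move=> _; cost_lia.
Qed.

Lemma triple_up2 A env G : (1 <= D)%N -> A \in unitmx -> block_from (D - 1) A ->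
  holds_tensor env G (congr_tensor A core) ->
  triple (up2 d G) env (14 * k3 + 14 * d3) (up_direct (D - 1) A).
Proof.
move=> D1 uA Ap HG; rewrite /up2.
have [d31 _ _] := le_d_d3 D.
have o12 : (o1 < o2)%N by rewrite !val_last_ord; lia.
have E1 : (d - 1 = o1.+1)%N by rewrite val_last_ord; lia.
have E0 : d = o2.+1 by rewrite val_last_ord; lia.
have at_ (e : seq R) G' B (i j k : 'I_d) a b c' : holds_tensor e G' (congr_tensor B core) ->
  a = i.+1 -> b = j.+1 -> c' = k.+1 -> onth e (G' a b c') = Some (congr_tensor B core i j k).
  exact: holds_tensor_at.
have skew i j k : congr_tensor A core i j k - congr_tensor A core j i k =
  tau (row i A) (row j A) (row k A) by exact: congr_core_skew.
apply: triple_bind (triple_test (at_ _ _ _ _ _ _ _ _ _ HG E1 E0 E0)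
  (at_ _ _ _ _ _ _ _ _ _ HG E0 E1 E0)) _ _ => [_|t1 e1 pre1 ->]; first by (clear -d31; cost_lia).
have late Z : no_resampling (D - 1).+1 (Z *m A) by apply: no_resampling_late; lia.
rewrite [eval_comparison _ _ _]/= -subr_eq0 (skew o1 o2 o2).
case: ifPn => [/eqP t0|nz1].
  have [x xE] := up2_swap D1 uA Ap t0.
  apply: (triple_cost (c := 0)) => //.
  apply: triple_post (triple_transposition E1 E0) _ => U e2 pre2 HU.
  exists (tperm_mx o1 o2); split=> //.
    split=> //; first exact: unitmx_perm.
      by apply: tperm_mx_block; rewrite val_last_ord; lia.
    apply: (pure_of_multiple (a := o1) (x := x)); first exact: val_last_ord.
    by rewrite row_tperm_mx tpermL.
  apply: (@nnz_rows _ _ o1 o2) => i j; rewrite !mxE.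
  have [_|i1] := eqVneq i o1; first by rewrite !orbT.
  have [_|i2] := eqVneq i o2; first by rewrite !orbT.
  by rewrite tpermD 1?eq_sym//; have [//|_] := eqVneq i j; rewrite eqxx.
have {}HG := holds_tensor_prefix pre1 HG.
apply: triple_bind (triple_quotient (at_ _ _ _ _ _ _ _ _ _ HG E0 E1 E1)
  (at_ _ _ _ _ _ _ _ _ _ HG E1 E0 E1) (at_ _ _ _ _ _ _ _ _ _ HG E1 E0 E0)
  (at_ _ _ _ _ _ _ _ _ _ HG E0 E1 E0) _) _ _; [by rewrite skew|by (clear -d31; cost_lia)|].
move=> q e2 pre2; rewrite (skew o1 o2 o2) -opprB (skew o1 o2 o1) => Hq.
have dE : (d - 1 = (D - 1).+1)%N by lia.
rewrite dE; set x := (_ / _) in Hq.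
apply: (triple_cost (c := 0)) => //.
apply: triple_post (triple_upper (f := fun=> x) (leq_subr 1 D) _) _ => //.
move=> U e3 pre3 HU; apply: up_direct_row_op HU _; first exact: leq_subr.
have rE : row o1 (row_op (inord (D - 1)) (fun=> x) *m A) = row o1 A + x *: row o2 A.
  rewrite -/o1 row_row_op; congr (_ + _); rewrite (bigD1 o2)//= big1 ?addr0// => j.
  rewrite -!val_eqE/= !val_last_ord => /andP[]; have := ltn_ord j; lia.
have r2E : row o2 (row_op (inord (D - 1)) (fun=> x) *m A) = row o2 A.
  by apply: row_row_op_neq; rewrite -/o1 -val_eqE/= gtn_eqF.
have uZ : row_op (inord (D - 1)) (fun=> x) *m A \in unitmx.
  by rewrite unitmx_mul row_op_unit.
apply: up2_pure => //.
- by apply: block_from_mul => //; apply: row_op_block; rewrite val_last_ord.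
- by rewrite rE r2E tauP1 tauuu mulr0 addr0 tauP3 mulfVK// subrr.
- by rewrite rE r2E tauP1 tauuu mulr0 addr0.
Qed.

Definition passes p A : Prop := ((p + 3 <= D)%N -> pass4 p A) /\
  ((2 <= D)%N -> p = (D - 2)%N -> pass3 A).

Lemma no_resampling_passes p A : block_from p A -> no_resampling p A -> passes p A.
Proof.
move=> Ap [n4 n3]; split=> [p3|D2 pE].
  by have := n4 p (leqnn p) p3; rewrite trunc_block_id.
by have := n3 D2; rewrite pE => /(_ (leqnn _)); rewrite trunc_block_id// -pE.
Qed.

Lemma triple_up_direct N p A env G : (p < D)%N -> A \in unitmx -> block_from p A ->
  passes p A -> holds_tensor env G (congr_tensor A core) ->
  triple (up L d N p.+1 G) env (14 * k3 + 14 * d3) (up_direct p A).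
Proof.
move=> pD uA Ap [p4 p3] HG; rewrite /up.
have [sp|sp] := leqP p.+1 (d - 3); first by apply: triple_up_ge4 => //; [lia|apply: p4; lia].
case: eqVneq => [pE|pE].
  have pE' : p = (D - 2)%N by lia.
  rewrite pE' in Ap p3 HG *; apply: triple_up3 => //; first by lia.
  by apply: p3 => //; lia.
have pE' : p = (D - 1)%N by lia.
by rewrite pE' in Ap HG *; apply: triple_up2 => //; lia.
Qed.

(** With fuel 0 the failed test leads to [Stop], which is admissible only if [stops] holds. The cost
    is that of a failed body, of the resampling and of a second body that passes. *)
Lemma triple_up_resampled N p A env G : (N = 0%N -> stops) ->
  (p < D)%N -> A \in unitmx -> block_from p A ->
  ~ passes p A -> holds_tensor env G (congr_tensor A core) ->
  triple (up L d N p.+1 G) env (29 * k3 + 29 * d3 + 2 * k4) (up_resampled p A).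
Proof.
move=> N0 pD uA Ap np HG; rewrite /up.
have retry (up' : nat -> rtens -> prog rmx) env' : prefix env env' ->
    (forall N' B G' e, B \in unitmx -> block_from p B -> no_resampling p B ->
      holds_tensor e G' (congr_tensor B core) ->
      triple (up' N' G') e (14 * k3 + 14 * d3) (up_direct p B)) ->
    triple (if N is N'.+1 then resample L d (up' N') p.+1 G else Stop) env'
      (d3 + 2 * k4 + (14 * k3 + 14 * d3) + k3) (up_resampled p A).
  move=> pre Hup; case: N N0 => [|N'] N0; first by apply: triple_stop; exact: N0.
  by apply: triple_resample (ltnW pD) uA Ap (holds_tensor_prefix pre HG) (Hup N').
have [sp|sp] := leqP p.+1 (d - 3).
  have p3D : (p + 3 <= D)%N by lia.
  rewrite up_ge4_unfold.
  apply: triple_cost (triple_up_ge4_body Lspec uA Ap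
    (c := d3 + 2 * k4 + (14 * k3 + 14 * d3) + k3) pD HG _ _) _.
  - move=> _ e pre; apply: (retry (fun N => up_ge4 L d N p.+1)) => // N' B G' e' uB Bp nB HB.
    apply: triple_up_ge4 => //; exact: (no_resampling_passes Bp nB).1.
  - by move=> p4; exfalso; apply: np; split=> // _ pE; lia.
  - by move=> _; cost_lia.
have [pE|pE] := eqVneq p.+1 (d - 2)%N; last first.
  by exfalso; apply: np; split=> [p3|D2 pE']; move/eqP: pE; lia.
have pE' : p = (D - 2)%N by lia.
have D2 : (2 <= D)%N by lia.
have Ap' : block_from (D - 2) A by rewrite -pE'.
rewrite up3_unfold.
apply: triple_cost (triple_up3_body (c := d3 + 2 * k4 + (14 * k3 + 14 * d3) + k3)
  D2 uA Ap' HG _ _) _.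
- move=> _ e pre; rewrite -pE; apply: (retry (fun N => up3 L d N)) => //.
  move=> N' B G' e' uB Bp nB HB; have [_ p3] := no_resampling_passes Bp nB.
  by rewrite pE' in Bp p3 *; apply: triple_up3 => //; exact: p3.
- by move=> p3; exfalso; apply: np; split=> [|_ _ //]; lia.
- by move=> _; cost_lia.
Qed.

End Recovery.

(** * Stages and the main loop *)

Section Stages.
Variables (R : realType) (mu : block_law R) (counted stops : Prop).
Variables (K : nat) (L : linalg) (D N : nat).
Hypothesis ac : absolutely_continuous mu.
Hypothesis Lspec : linalg_spec mu counted stops K L.
Hypothesis N0 : N = 0%N -> stops.
Local Notation triple := (triple mu counted stops).
Local Notation d := D.+1.
Local Notation core := (core R d).
Implicit Types (A X : 'M[R]_d) (env : seq R) (G : rtens).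
Variable Y0 : tensor R d.

Local Notation d3 := (cost3 1 D).
Local Notation k3 := (cost3 K D).
Local Notation d4 := (cost4 1 D).
Local Notation k4 := (cost4 K D).

(** The matrix [A] is a ghost: the program stores only the tensor A * C and the product Q of its
    operations, linked to the input by Q * Y0 = A * C. *)
Definition stage_invariant p A (GQ : rtens * rmx) env : Prop := exists Q : 'M[R]_d,
  [/\ A \in unitmx, block_from p A, holds_tensor env GQ.1 (congr_tensor A core),
      holds_mx env GQ.2 Q &
      Q \in unitmx /\ congr_tensor Q Y0 = congr_tensor A core].

Lemma stage_invariant_prefix p A GQ env env' : prefix env env' ->
  stage_invariant p A GQ env -> stage_invariant p A GQ env'.
Proof.
move=> pre [Q [uA Ap HG HQ uQ]]; exists Q; split=> //.
  exact: holds_tensor_prefix pre HG.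
exact: holds_mx_prefix pre HQ.
Qed.

Definition stage_down (s : nat) (G : rtens) (Q Qup : rmx) : prog (rtens * rmx) :=
  let* H := la_congr L d Qup G in
  let* o := const 1 in
  let* h := arith2 Defs.Div o (H s s s) in
  let* m := const (- 1) in
  let* mh := arith2 Defs.Mul m h in
  let* y := tabulate 0%N (d - s) (fun i => arith2 Defs.Mul mh (H s (s + i)%N s)) in
  let* Ds := Defs.diagonal s h in
  let* Ls := lower s y in
  let* Qdlow := la_mul L d Ds Ls in
  let* G' := la_congr L d Qdlow H in
  let* Q' := la_mul L d Qup Q in
  let* Q'' := la_mul L d Qdlow Q' in
  Ret (G', Q'').

(** The price [c] of the congruence by the up-matrix is a parameter: low after a direct up-step,
    high after resampling. The rest is one sparse congruence and three products, hence 7 [k3]. *)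
Lemma triple_stage_down p A Z G Q Qup env c : (p < D)%N ->
  stage_invariant p A (G, Q) env -> up_result p A Z Qup env ->
  triple (la_congr L d Qup G) env c
    (fun H env' => holds_tensor env' H (congr_tensor Z (congr_tensor A core))) ->
  triple (stage_down p.+1 G Q Qup) env (c + 7 * k3 + 4 * d3) (fun GQ env' =>
    exists A', stage_invariant p.+1 A' GQ env' /\
      (no_resampling p.+1 (Z *m A) -> no_resampling p.+1 A')).
Proof.
move=> pD [Qm [uA Ap HG HQ [uQ QY]]] [HU uZ Zp Zpure] tc.
have [d31 dd3 _] := le_d_d3 D.
set B := Z *m A in Zpure *.
have uB : B \in unitmx by rewrite unitmx_mul uZ.
have Bp : block_from p B by exact: block_from_mul.
pose a : 'I_d := inord p; have ap : (a : nat) = p by rewrite inordK// ltnS ltnW.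
pose t := B a a; have t0 : t != 0 by exact: pure_row_neq0 ap uB Zpure.
apply: triple_bind tc _ _ => [_|H e1 pre1]; first by (clear -d31 dd3 pD; cost_lia).
rewrite -congr_tensor_mul -/B => HH.
apply: triple_bind (triple_const (c := 0)) _ _ => // o e2 pre2 Ho.
have pa : p.+1 = a.+1 by rewrite ap.
have Ha (j : 'I_d) n e : prefix e1 e -> n = j.+1 ->
    onth e (H p.+1 n p.+1) = Some (t ^+ 2 * B j a).
  move=> pre ->; rewrite pa (onth_prefix pre (HH a j a)).
  by rewrite (congr_core_first ap).
apply: triple_bind (triple_arith2 Ho (Ha a _ _ pre2 pa) _) _ _ => [_|_|h e3 pre3 Hh].
- by rewrite -exprSr expf_neq0.
- by (clear -d31 dd3 pD; cost_lia).
apply: triple_bind (triple_const (c := 0)) _ _ => // m e4 pre4 Hm.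
apply: triple_bind (triple_arith2 Hm (onth_prefix pre4 Hh) _) _ _ => // [_|mh e5 pre5 Hmh].
  by (clear -d31 dd3 pD; cost_lia).
have pre15 : prefix e1 e5 by exact: prefix_trans pre2 (prefix_trans pre3 (prefix_trans pre4 pre5)).
pose f (i : 'I_d) := - (t ^+ 3)^-1 * (t ^+ 2 * B i a).
have ty : triple (tabulate 0%N (d - p.+1)
      (fun i => arith2 Defs.Mul mh (H p.+1 (p.+1 + i)%N p.+1))) e5 ((d - p.+1) * 1)
    (fun y env' => forall k : 'I_(d - p.+1), onth env' (y k.+1) = Some (f (shift_ord D p k))).
  apply: triple_tabulate_vec => k e pre.
  have kD : (k < D - p)%N by exact: ltn_ord k.
  have kE : (p.+1 + k.+1)%N = (shift_ord D p k).+1 by rewrite val_shift_ord// addnS.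
  apply: triple_post (triple_arith2 (onth_prefix pre Hmh)
    (Ha _ _ _ (prefix_trans pre15 pre) kE) _) _ => // r e' _ ->.
  by rewrite /= /f -exprSr mulN1r mul1r.
apply: triple_bind ty _ _ => [_|y e6 pre6 Hy]; first by (clear -d31 dd3 pD; cost_lia).
apply: triple_bind (triple_diagonal (ltnW pD)
  (onth_prefix (prefix_trans pre4 (prefix_trans pre5 pre6)) Hh)) _ _ => [_|Ds e7 pre7].
  by (clear -d31 dd3 pD; cost_lia).
(* The diagonal entry of the tensor is t^3, so the cube root of its inverse is exactly t^-1. *)
rewrite [arith_value _ _ _]/= mul1r -exprSr -exprVn cbrt_cube => HD.
apply: triple_bind (triple_lower (f := f) (y := y) (ltnW pD) _) _ _ => //.
  move=> i pi; have kn : (i - p.+1 < d - p.+1)%N by exact: ltn_sub2r.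
  have -> : (i - p)%N = (Ordinal kn).+1 by rewrite /= subnSK.
  rewrite (onth_prefix pre7 (Hy _)); congr (Some (f _)); apply: val_inj.
  by rewrite /= val_shift_ord ?subnKC.
rewrite subn0 => Ls e8 pre8 HL.
apply: triple_bind (triple_mul Lspec (holds_mx_prefix pre8 HD) HL) _ _ => [_|Qd e9 pre9].
  by (clear -d31 dd3 pD; cost_lia).
rewrite -/(down_mx a t B) => HQd.
have pre19 : prefix e1 e9.
  exact: prefix_trans pre15 (prefix_trans pre6 (prefix_trans pre7 (prefix_trans pre8 pre9))).
apply: triple_bind (triple_congr_sparse Lspec HQd (holds_tensor_prefix pre19 HH)
  (down_mx_nnz a t B)) _ _ => [_|]; first by (clear -d31 dd3 pD; cost_lia).
rewrite -congr_tensor_mul => G' e10 pre10 HG'.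
have pre010 := prefix_trans pre1 (prefix_trans pre19 pre10).
apply: triple_bind (triple_mul Lspec (holds_mx_prefix pre010 HU) (holds_mx_prefix pre010 HQ)) _ _.
  by move=> _; (clear -d31 dd3 pD; cost_lia).
move=> Q' e11 pre11 HQ'.
apply: triple_bind (triple_mul Lspec (holds_mx_prefix (prefix_trans pre10 pre11) HQd) HQ') _ _.
  by move=> _; (clear -d31 dd3 pD; cost_lia).
move=> Q'' e12 pre12 HQ''; apply: triple_ret.
exists (down_mx a t B *m B); split; last first.
  move=> nB; apply: no_resampling_ext nB _ => i j pi pj.
  rewrite /t (down_mxE ap)// pi; case: eqP => // ja.
  by move: pj; rewrite ja ap ltnn.
exists (down_mx a t B *m (Z *m Qm)); split => //.
- by rewrite unitmx_mul down_mx_unit.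
- by rewrite /t -/B; apply: down_mx_block.
- by move=> i j k; exact: onth_prefix (prefix_trans pre11 pre12) (HG' i j k).
- split; first by rewrite unitmx_mul down_mx_unit// unitmx_mul uZ.
  by rewrite [LHS]congr_tensor_mul (congr_tensor_mul Z) QY -(congr_tensor_mul Z) -congr_tensor_mul.
Qed.

Lemma stageE s G Q : stage L d N s (G, Q) =
  let* Qup := up L d N s G in stage_down s G Q Qup.
Proof. by []. Qed.

(** The up-step takes 14 [k3] + 14 [d3], its sparse congruence 4 [k3], the down-step 7 [k3] + 4
    [d3]. *)
Definition stage_cost := (25 * k3 + 18 * d3)%N.

Lemma triple_stage_direct p A GQ env : (p < D)%N -> passes p A ->
  stage_invariant p A GQ env ->
  triple (stage L d N p.+1 GQ) env stage_cost (fun GQ' env' => exists A',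
    stage_invariant p.+1 A' GQ' env' /\ (no_resampling p A -> no_resampling p.+1 A')).
Proof.
case: GQ => G Q pD pA inv; rewrite stageE; have [Qm [uA Ap HG _ _]] := inv.
apply: triple_bind (triple_up_direct Lspec N pD uA Ap pA HG) _ _.
  by move=> _; rewrite /stage_cost; cost_lia.
move=> U e1 pre1 [Z [res Zn nZ]]; have [HU _ _ _] := res.
apply: triple_weaken (triple_stage_down pD (stage_invariant_prefix pre1 inv) res
  (triple_congr_sparse Lspec HU (holds_tensor_prefix pre1 HG) Zn)) _ _.
  by move=> _; rewrite /stage_cost; cost_lia.
by move=> GQ' e2 _ [A' [inv' nA']]; exists A'; split=> // /nZ/nA'.
Qed.

(** Two congruences are dense, by the random block and by the resulting up-matrix, at 2 [k4] each;
    the remaining 36 [k3] + 33 [d3] are rounded up to fourth powers. *)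
Lemma triple_stage_resampled p A GQ env : (p < D)%N -> ~ passes p A ->
  stage_invariant p A GQ env ->
  triple (stage L d N p.+1 GQ) env (40 * k4 + 33 * d4) (fun GQ' env' => exists A',
    stage_invariant p.+1 A' GQ' env' /\ no_resampling p.+1 A').
Proof.
case: GQ => G Q pD pA inv; rewrite stageE; have [Qm [uA Ap HG _ _]] := inv.
have [d34 k34] := le_d3_d4 K D.
apply: triple_bind (triple_up_resampled ac Lspec N0 pD uA Ap pA HG) _ _.
  by move=> _; cost_lia.
move=> U e1 pre1 [Z [res nZ]]; have [HU _ _ _] := res.
apply: triple_weaken (triple_stage_down pD (stage_invariant_prefix pre1 inv) res
  (triple_congr_dense Lspec HU (holds_tensor_prefix pre1 HG))) _ _.
  by move=> _; cost_lia.
by move=> GQ' e2 _ [A' [inv' nA']]; exists A'; split=> //; exact: nA'.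
Qed.

(* [fresh] records that no resampling can occur any more: the large term of the
   cost is then paid already. *)
Lemma triple_stages k p A GQ env (fresh : bool) : (p + k = D)%N ->
  (fresh -> no_resampling p A) -> stage_invariant p A GQ env ->
  triple (foldp (stage L d N) (iota p.+1 k) GQ) env
    (k * stage_cost + (if fresh then 0 else 40 * k4 + 33 * d4))
    (fun GQ' env' => exists A', stage_invariant D A' GQ' env').
Proof.
elim: k p A GQ env fresh => [|k IHk] p A GQ env fresh pk nA inv.
  by apply: triple_ret; exists A; rewrite addn0 in pk; rewrite -pk.
have pD : (p < D)%N by cost_lia.
have pk' : (p.+1 + k = D)%N by cost_lia.
have [pA|npA] := pselect (passes p A).
  apply: triple_bind (triple_stage_direct pD pA inv) _ _ => [_|GQ' e1 pre1 [A' [inv' nA']]].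
    by rewrite mulSn; cost_lia.
  apply: triple_cost (IHk _ A' _ _ fresh pk' _ inv') _ => [fr|_].
    by apply: nA'; exact: nA.
  by rewrite mulSn; cost_lia.
case: fresh nA => [/(_ isT) nA|_].
  exfalso; apply: npA; apply: no_resampling_passes nA.
  by case: inv => Q [].
apply: triple_bind (triple_stage_resampled pD npA inv) _ _ => [_|GQ' e1 pre1 [A' [inv' nA']]].
  by cost_lia.
apply: triple_cost (IHk _ A' _ _ true pk' _ inv') _ => // _.
by rewrite mulSn; cost_lia.
Qed.

(** From Q * Y0 = A * C the input is Q^-1 A applied to C. Budget: 25 [k4] + 18 [d4] for direct
    stages, 40 [k4] + 33 [d4] for one resampling, at most [k4] each for the inverse and the last
    product, [d4] for the last cube root. *)
Lemma triple_recover env T : (1 <= D)%N -> core_orbit Y0 -> holds_tensor env T Y0 ->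
  triple (recover L d N T) env (67 * k4 + 52 * d4) (fun Q env' => exists A : 'M[R]_d,
    [/\ holds_mx env' Q A, A \in unitmx & Y0 = congr_tensor A core]).
Proof.
move=> D1 [A0 uA0 Y0E] HT; have [d34 k34] := le_d3_d4 K D.
have [d31 _ _] := le_d_d3 D.
have dstage : (D * stage_cost <= 25 * k4 + 18 * d4)%N.
  have -> : (25 * k4 + 18 * d4 = d * stage_cost)%N.
    by rewrite /stage_cost /cost3 /cost4 (expnS _ 3); ring.
  by rewrite leq_mul2r leqnSn orbT.
apply: triple_bind (triple_id_prog _ _ _ _ 0) _ _ => // I e1 pre1 HI.
have inv : stage_invariant 0 A0 (T, I) e1.
  exists 1%:M; split=> //.
  - by rewrite /= -Y0E; exact: holds_tensor_prefix pre1 HT.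
  - by move=> i j; rewrite HI mxE eqSS.
  - by rewrite unitmx1 congr_tensor1.
rewrite [(d - 1)%N]subn1 /=.
have nofresh : false -> no_resampling 0 A0 by [].
apply: triple_bind (triple_stages (add0n D) nofresh inv) _ _ => [_|[G' Q] e2 pre2 [A [Qm]]].
  by cost_lia.
move=> [uA AD HG HQ [uQ QY]].
apply: triple_bind (spec_inv Lspec HQ uQ) _ _ => [_|Qi e3 pre3 HQi]; first by rewrite -/(cost4 K D); cost_lia.
rewrite -/(cost4 K D).
pose a : 'I_d := inord D; have aD : (a : nat) = D by rewrite inordK.
have pure : first_row_pure D A.
  move=> i j iD ji; rewrite AD; first by rewrite eq_sym (negbTE ji).
  apply/orP; right; rewrite ltn_neqAle -ltnS ltn_ord andbT.
  by move: ji; rewrite -val_eqE /= iD.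
have Hd : onth e3 (G' d d d) = Some (A a a ^+ 3).
  have := onth_prefix pre3 (HG a a a); rewrite /= aD => ->.
  by rewrite (congr_core_first aD)// -exprSr.
apply: triple_bind (triple_diagonal (leqnn D) Hd) _ _ => [_|Dd e4 pre4]; first by cost_lia.
(* After the loop [A] differs from the identity at most in its last diagonal entry, whose cube is
   the last entry of the tensor. *)
have -> : scale_first (inord D) (cbrt (A a a ^+ 3)) = A.
  apply/matrixP => i j; rewrite mxE cbrt_cube -/a.
  have [->|ia] := eqVneq i a; have [->|ja] := eqVneq j a => //=.
  - by rewrite pure// eq_sym (negbTE ja).
  - rewrite AD// ltn_neqAle -ltnS ltn_ord andbT; apply/orP; left.
    by move: ia; rewrite -val_eqE /= aD.
  - rewrite AD// ltn_neqAle -ltnS ltn_ord andbT; apply/orP; left.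
    by move: ia; rewrite -val_eqE /= aD.
move=> HDd.
apply: triple_weaken (triple_mul Lspec (holds_mx_prefix pre4 HQi) HDd) _ _.
  by move=> _; cost_lia.
move=> C e5 pre5 HC; exists (invmx Qm *m A); split=> //.
  by rewrite unitmx_mul unitmx_inv uQ.
by rewrite congr_tensor_mul -QY -congr_tensor_mul mulVmx// congr_tensor1.
Qed.

End Stages.

(** * Almost sure success and the bound on the expected number of operations *)

Theorem theorem1p1 (R : realType) :
  (forall (L : linalg) (mu : block_law R),
     absolutely_continuous mu -> linalg_correct mu L ->
     forall (d : nat) (G : tensor R d) (env : seq R) (T : rtens),
       (2 <= d)%N -> core_orbit G -> holds_tensor env T G ->
       recover_success mu L env T G = 1%E)
  /\
  (exists (L : linalg) (c : nat),
     forall mu : block_law R, absolutely_continuous mu ->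
       linalg_correct mu L /\
       forall (d : nat) (G : tensor R d) (env : seq R) (T : rtens),
         (2 <= d)%N -> core_orbit G -> holds_tensor env T G ->
         (recover_ops mu L d env T <= (c * d ^ 4)%N%:R%:E)%E).
Proof.
split=> [L mu ac Lok [//|D] G env T D1 Gorb HT|].
  (* Stops are excluded, which is possible from fuel 1 on; the cost is not counted, so the constant
     [K] of the subroutines may be 0. *)
  have N1 : 1%N = 0%N -> False by [].
  have := triple_recover ac (linalg_correct_spec False 0 Lok) N1 D1 Gorb HT.
  move=> /prob_of_triple success.
  apply/eqP; rewrite eq_le; apply/andP; split.
    apply: ge_ereal_sup => _ [N _ <-]; exact: (expect_le1 mu _ _ _ (indicator_outcome01 _)).
  by rewrite -[leLHS]success; apply: ereal_sup_ubound; exists 1%N.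
(* 4072 = 67 * 60 + 52, where 60 is the constant of [fast_linalg_spec] and 67, 52 come from
   [triple_recover]. *)
exists fast_linalg, 4072 => mu ac; split.
  exact: spec_linalg_correct (fast_linalg_spec True False ac).
move=> [//|D] G env T D1 Gorb HT; apply: ge_ereal_sup => _ [N _ <-].
have N0 : N = 0%N -> True by [].
have tr := triple_recover ac (fast_linalg_spec True True ac) N0 D1 Gorb HT.
apply: asure_expect_le; apply: asure_mono (tr 0%N) => o e n [_ /(_ I) cost _].
apply: leq_trans cost _; rewrite add0n /cost4; move: (D.+1 ^ 4)%N => x; lia.
Qed.
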